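(* Let $n\ge 3$. Let $c:B^{n-1}(0,1)\to\mathbb{R}^{n-1}$ be a continuous map whose restriction $c|_{S^{n-2}}$ is $\alpha$-Hölder continuous for some $\alpha>\frac{(n-2)n}{(n-1)^2}$, i.e. there is a constant $C$ with $|c(u)-c(v)|\le C|u-v|^{\alpha}$ for all $u,v\in S^{n-2}$. Let $$\phi:B^{n-1}(0,1)\times[0,1]\to\mathbb{R}^n,\qquad \phi(v,t)=(c(v)+tv,\,t).$$ Then the image $\mathrm{Im}(\phi)\subset\mathbb{R}^n$ has positive ($n$-dimensional) Lebesgue measure.
   Context: $B^{n-1}(0,1)$ is the closed unit ball of $\mathbb{R}^{n-1}$ and $S^{n-2}$ is the unit sphere of $\mathbb{R}^{n-1}$, i.e. the boundary of $B^{n-1}(0,1)$. The map $\phi$ is called the Kakeya map associated with the direction map $c$, and $\mathrm{Im}(\phi)$ the associated Kakeya set. *)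

(* Defs.v *)
From HB Require Import structures.
From mathcomp Require Import all_boot all_order all_algebra.
From mathcomp Require Import all_classical all_reals all_analysis.
Set Implicit Arguments.
Unset Strict Implicit.
Unset Printing Implicit Defensive.
Import Order.TTheory GRing.Theory Num.Theory.
Import numFieldNormedType.Exports.
Local Open Scope classical_set_scope.
Local Open Scope ring_scope.

(* The library's norm on 'rV[R]_m is the sup norm; it induces the same topology
   as the Euclidean norm, but not the same unit ball. *)
Definition enorm (R : realType) (m : nat) (v : 'rV[R]_m) : R :=
  Num.sqrt (\sum_(i < m) v 0 i ^+ 2).

Definition unit_ball (R : realType) (m : nat) : set 'rV[R]_m :=
  [set v | enorm v <= 1].

Definition unit_sphere (R : realType) (m : nat) : set 'rV[R]_m :=
  [set v | enorm v = 1].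

Definition hoelder_on (R : realType) (m p : nat) (alpha : R)
    (A : set 'rV[R]_m) (f : 'rV[R]_m -> 'rV[R]_p) : Prop :=
  exists C : R, forall u v, A u -> A v ->
    enorm (f u - f v) <= C * enorm (u - v) `^ alpha.

(* [unlift ord_max i] is [None] exactly when [i] is the last index, so this is
   the point (c(v) + t v, t). *)
Definition kakeya_map (R : realType) (m : nat) (c : 'rV[R]_m -> 'rV[R]_m)
    (vt : 'rV[R]_m * R) : 'rV[R]_m.+1 :=
  \row_(i < m.+1)
    if unlift ord_max i is Some j then (c vt.1 + vt.2 *: vt.1) 0 j else vt.2.

Definition kakeya_set (R : realType) (m : nat) (c : 'rV[R]_m -> 'rV[R]_m) :
    set 'rV[R]_m.+1 :=
  kakeya_map c @` (@unit_ball R m `*` `[0, 1]).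

Section lebesgue.
Context (R : realType).

Definition box (n : nat) (a b : 'rV[R]_n) : set 'rV[R]_n :=
  [set x | forall i, a 0 i <= x 0 i <= b 0 i].

(* Some [b 0 i < a 0 i] makes the box empty and the volume 0. *)
Definition box_volume (n : nat) (a b : 'rV[R]_n) : R :=
  \prod_(i < n) Num.max 0 (b 0 i - a 0 i).

Definition box_cover (n : nat) (A : set 'rV[R]_n) :
    set (nat -> 'rV[R]_n * 'rV[R]_n) :=
  [set F | A `<=` \bigcup_k box (F k).1 (F k).2].

(* The dimension is a successor because in dimension 0 no box is empty. *)
Definition lebesgue_outer (n : nat) (A : set 'rV[R]_n.+1) : \bar R :=
  ereal_inf [set (\sum_(k <oo) (box_volume (F k).1 (F k).2)%:E)%E
            | F in box_cover A].

Local Open Scope ereal_scope.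

Lemma box_volume_ge0 n (a b : 'rV[R]_n) : (0 <= box_volume a b)%R.
Proof. by apply: prodr_ge0 => i _; rewrite le_max lexx. Qed.

Lemma lebesgue_outer_ge0 n (A : set 'rV[R]_n.+1) : 0 <= lebesgue_outer A.
Proof.
apply: le_ereal_inf_tmp => _ [F _ <-].
by apply: nneseries_ge0 => k _ _; rewrite lee_fin box_volume_ge0.
Qed.

Lemma lebesgue_outer0 n : lebesgue_outer (set0 : set 'rV[R]_n.+1) = 0.
Proof.
apply/eqP; rewrite eq_le lebesgue_outer_ge0 andbT.
apply: ereal_inf_lbound; exists (fun=> (0%R, 0%R)); first by [].
by apply: eseries0 => k _ _; rewrite /box_volume big_ord_recl !mxE subrr maxxx mul0r.
Qed.

Lemma le_lebesgue_outer n :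
  {homo @lebesgue_outer n : A B / A `<=` B >-> A <= B}.
Proof.
move=> A B AB; apply/ereal_inf_le_tmp => x [F BF <-{x}].
by exists F => //; exact: subset_trans AB BF.
Qed.

Lemma lebesgue_outer_sigma_subadditive n :
  sigma_subadditive (@lebesgue_outer n).
Proof.
move=> A; have [[i ioo]|] := pselect (exists i, lebesgue_outer (A i) = +oo).
  rewrite (eseries_pinfty _ _ ioo) ?leey// => k _.
  by rewrite -ltNye (lt_le_trans _ (lebesgue_outer_ge0 _)).
rewrite -forallNE => Aoo.
apply/lee_addgt0Pr => _/posnumP[e].
rewrite (le_trans _ (epsilon_trick _ _ _))//; last first.
  by move=> k; exact: lebesgue_outer_ge0.
pose vol (ab : 'rV[R]_n.+1 * 'rV[R]_n.+1) := (box_volume ab.1 ab.2)%:E.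
have vol0 ab : 0 <= vol ab by rewrite lee_fin box_volume_ge0.
pose P k F := box_cover (A k) F /\
  \sum_(j <oo) vol (F j) <= lebesgue_outer (A k) + (e%:num / (2 ^ k.+1)%:R)%:E.
have [G PG] : {G : nat -> nat -> 'rV[R]_n.+1 * 'rV[R]_n.+1 &
    forall k, P k (G k)}.
  apply: (@choice _ _ P) => k; rewrite /P.
  have en1 : (0 < e%:num / (2 ^ k.+1)%:R)%R by [].
  have fk : lebesgue_outer (A k) \is a fin_num.
    by rewrite ge0_fin_numE ?lebesgue_outer_ge0// ltey; apply/eqP/Aoo.
  have [_ [F AF <-] Fe] := lb_ereal_inf_adherent en1 fk.
  by exists F; split => //; exact/ltW.
have volG_ge0 x : 0 <= (vol \o uncurry G) x by exact: vol0.
apply: (@le_trans _ _ (\esum_(i in setT) (vol \o uncurry G) i)).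
  apply: ereal_inf_lbound => /=.
  have /card_esym/ppcard_eqP[f] := card_nat2.
  exists (uncurry G \o f).
    move=> t [i _ /(PG i).1 [j _ tij]].
    by exists (f^-1%FUN (i, j)) => //=; rewrite invK ?inE.
  rewrite -(esum_pred_image (vol \o uncurry G) _ xpredT) ?[fun=> _]set_true//.
  by rewrite image_eq.
rewrite (_ : esum _ _ = \sum_(i <oo) \sum_(j <oo) vol (G i j)); last first.
  pose J : nat -> set (nat * nat) := fun i => [set (i, j) | j in setT].
  rewrite (_ : setT = \bigcup_k J k); last first.
    by rewrite predeqE => -[a b]; split => // _; exists a => //; exists b.
  rewrite esum_bigcupT//=; last first.
    apply/trivIsetP => i j _ _ ij.
    rewrite predeqE => -[k m] /=; split => //= -[] [_] _ [<-{k} _].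
    by move=> [m' _] [] /esym/eqP; rewrite (negbTE ij).
  rewrite -(image_id [set: nat]) -fun_true esum_pred_image//; last first.
    by move=> k _; exact: esum_ge0.
  apply: eq_eseriesr => /= j _.
  rewrite -(esum_pred_image (vol \o uncurry G) (pair j) predT)//=; last first.
    by move=> ? ? _ _; exact: (@can_inj _ _ _ snd).
  by congr esum; rewrite predeqE => -[a b]; split; move=> [i _ <-]; exists i.
apply: lee_nneseries => k *; last exact: (PG k).2.
by apply: nneseries_ge0 => m *; exact: vol0.
Qed.

HB.instance Definition _ n := isOuterMeasure.Build R 'rV[R]_n.+1
  (@lebesgue_outer n) (@lebesgue_outer0 n) (@lebesgue_outer_ge0 n)
  (@le_lebesgue_outer n) (@lebesgue_outer_sigma_subadditive n).

(* Caratheodory's restriction: [measurable] on this type is Lebesgue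
   measurability. *)
Definition lebesgue_measure_rV (n : nat) :
  set (caratheodory_type (@lebesgue_outer n)) -> \bar R := @lebesgue_outer n.

HB.instance Definition _ n := isMeasure.Build _ _ _ (@lebesgue_measure_rV n)
  (@caratheodory_measure0 R _ (@lebesgue_outer n))
  (@caratheodory_measure_ge0 R _ (@lebesgue_outer n))
  (@caratheodory_measure_sigma_additive R _ (@lebesgue_outer n)).

End lebesgue.

Arguments lebesgue_measure_rV R n : clear implicits.

(* Main.v *)
(* Let m = n - 1 and compose c with a retraction of a cube Q onto the unit ball
   that sends the boundary of Q to the sphere; put f_t = c + t id along it.

   If the Kakeya set were null, a cover of small volume would have thin slices
   at m + 1 separated heights t, so every small cube of R^m would contain a
   still smaller cube missed by f_t.  Consider the integral J of the Jacobian
   determinant of a Bernstein approximation of f_t.  By Piola's identity it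
   depends only on the boundary values, and a partition of unity in the target
   splits it into one contribution per cell of side rho:
   - on a cell away from f_t(bd Q) the test function can be squeezed into the
     missed cube without changing the contribution much, which makes it tiny;
   - the cells near f_t(bd Q) are treated by comparing approximations at two
     scales and averaging over translates, and their total contribution tends
     to 0 exactly because the Hoelder exponent exceeds 1 - 1 / m ^ 2.
   So J is arbitrarily small at m + 1 separated values of t.  But J is a
   polynomial of degree m in t whose leading coefficient is the Jacobian
   integral of the retraction, which stays away from 0; Lagrange interpolation
   gives a contradiction. *)
From HB Require Import structures.
From mathcomp Require Import all_boot all_order all_algebra.
From mathcomp Require Import fingroup perm polyrcf.
From mathcomp Require ssrcomplements mpoly.
From mathcomp Require Import ring lra zify.
Set Implicit Arguments.
Unset Strict Implicit.
Unset Printing Implicit Defensive.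
Import Order.TTheory GRing.Theory Num.Theory.
Local Open Scope ring_scope.

(** * Piola's identity and Jacobian integrals over a cube *)

Section Jacobian.
Import mpoly.
Context (R : numDomainType) (m : nat).
Implicit Types (u : 'I_m -> {mpoly R[m]}).

(** Near [f_t(bd Q)] nothing bounds how often [f_t] covers a point; this is the obstacle. Bounded
    one at a time, by their number, the mesh and the gradient of the approximation, the near cells
    give a total that blows up as the mesh shrinks. Two scales cure this: passing from a fine map to
    a translate of a coarse one costs the displacement times the [(m - 1)]-th power of the fine
    gradient, whatever the number of cells, and averaging over the translates then shares each cell
    among them.

    The order of choices matters. The mesh [rho] is fixed by the data of [c]; then come the cover,
    the heights and the missed cubes, whose size [kappa] has no lower bound known in advance. The
    tolerance [tau] of the partition of unity is chosen last and absorbs all that depends on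
    [kappa].

    All integrands are polynomials, so integrals over the cube are finite sums, estimated by the
    mean value theorem for polynomials. Taking [Q] to be [[1/4, 3/4]^m] inside the unit cube keeps
    [x (1 - x)], by which the Bernstein gradient bound divides, away from 0. *)

Definition jac u : 'M[{mpoly R[m]}]_m := \matrix_(i, j) (u i)^`M(j).

Lemma mderiv_prod (I : eqType) (r : seq I) (P : pred I) (F : I -> {mpoly R[m]}) j :
  uniq r ->
  (\prod_(k <- r | P k) F k)^`M(j)
  = \sum_(k <- r | P k) (F k)^`M(j) * \prod_(l <- r | P l && (l != k)) F l.
Proof.
elim: r => [|x r IHr] /=; first by rewrite !big_nil -mpolyC1 mderivC.
move=> /andP[xr ur]; rewrite !big_cons.
have aux : \sum_(k <- r | P k) (F k)^`M(j) * \prod_(l <- x :: r | P l && (l != k)) F l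
  = (if P x then F x else 1) * \sum_(k <- r | P k) (F k)^`M(j) * \prod_(l <- r | P l && (l
      != k)) F l.
  rewrite mulr_sumr big_seq_cond [RHS]big_seq_cond; apply: eq_bigr => k /andP[kr _].
  rewrite big_cons; have -> : (x != k) by apply: contraNneq xr => ->.
  by rewrite andbT; case: (P x); rewrite ?mul1r // mulrCA.
case: ifP => Px; last by rewrite IHr // aux Px mul1r.
rewrite mderivM IHr // aux Px eqxx andbF; congr (_ * _ + _).
rewrite big_seq_cond [RHS]big_seq_cond; apply: eq_bigl => k; case: (boolP (k \in r)) => //= kr.
by rewrite (_ : k != x) ?andbT //; apply: contraNneq xr => <-.
Qed.

(** Differentiating the expanded cofactors gives terms indexed by the row [k] that is differentiated
    twice. Composing [s] with the transposition of [i] and [k] flips the sign and, since mixed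
    derivatives commute, preserves the rest; hence [S = - S] for each [k]. *)
Lemma piola u i : \sum_j (cofactor (jac u) i j)^`M(j) = 0.
Proof.
pose X k (s : 'S_m) := (u k)^`M(s k)^`M(s i) *
  \prod_(l | (i != l) && (l != k)) (u l)^`M(s l).
have -> : \sum_j (cofactor (jac u) i j)^`M(j)
    = \sum_(k | i != k) \sum_(s : 'S_m) (-1) ^+ s * X k s.
  rewrite exchange_big /=.
  under eq_bigr => j _ do rewrite expand_cofactor raddf_sum /=.
  rewrite [RHS](partition_big (fun s : 'S_m => s i) xpredT) //=.
  apply: eq_bigr => j _; apply: eq_bigr => s /eqP sij.
  rewrite -mulr_sumr.
  have sgnC (b : bool) (p : {mpoly R[m]}) k : ((-1) ^+ b * p)^`M(k) = (-1) ^+ b * p^`M(k).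
    by case: b; rewrite ?mulN1r ?mul1r ?mderivN.
  rewrite sgnC mderiv_prod ?index_enum_uniq //; congr (_ * _); apply: eq_bigr => k ik.
  by rewrite /X sij mxE; congr (_ * _); apply: eq_bigr => l _; rewrite mxE.
apply: big1 => k ik.
set S := \sum_s _; suff: S = - S.
  by move/eqP; rewrite -addr_eq0 -mulr2n -mulr_natl mulf_eq0 -mpolyC_nat mpolyC_eq0
      pnatr_eq0 => /eqP.
rewrite {1}/S (reindex_inj (mulgI (tperm i k))) /= -sumrN; apply: eq_bigr => s _.
rewrite odd_mul_tperm ik addTb signrN mulNr; congr (- (_ * _)).
rewrite /X !permM tpermL tpermR mderiv_comm; congr (_ * _).
apply: eq_bigr => l /andP[il lk]; rewrite permM tpermD //.
by rewrite eq_sym.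
Qed.

(** The divergence form: row [i] enters undifferentiated, so an integral over a cube sees [u i]
    through its boundary values only. *)
Lemma det_jac_div u i :
  \det (jac u) = \sum_j (u i * cofactor (jac u) i j)^`M(j).
Proof.
rewrite (expand_det_row _ i); under [RHS]eq_bigr => j _ do rewrite mderivM.
rewrite big_split /= -mulr_sumr piola mulr0 addr0.
by apply: eq_bigr => j _; rewrite mxE.
Qed.

(** The matrix determinant lemma, multiplied by [l] because [l] will be a polynomial without
    inverse. The bordered matrix [M] is made triangular in two ways. *)
Lemma det_scale_rank1 (T : idomainType) k (l : T) (x : 'cV[T]_k) (v : 'rV[T]_k) :
  \det (l%:M + x *m v) * l = l ^+ k * (l + (v *m x) 0 0).
Proof.
pose M := block_mx (1%:M : 'M_1) (- v) x l%:M.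
have e1 : \det M = \det (l%:M + x *m v).
  transitivity (\det (M *m block_mx 1%:M v 0 1%:M)).
    by rewrite det_mulmx det_ublock !det1 !mulr1.
  rewrite mulmx_block !mulmx1 !mulmx0 !addr0 mul1mx addrN.
  by rewrite det_lblock det1 mul1r addrC.
transitivity (\det (M *m block_mx l%:M 0 (- x) 1%:M)).
  by rewrite det_mulmx det_lblock det_scalar1 det1 mulr1 e1.
rewrite mulmx_block mul1mx mulmx0 mulmx1 add0r mulmx0 mulmx1 add0r.
rewrite mul_mx_scalar mulmxN mul_scalar_mx mulNmx opprK scalerN addrN det_ublock det_scalar
    mulrC; congr (_ * _).
by rewrite det_mx11 !mxE eqxx mulr1n.
Qed.

End Jacobian.

Section CubeIntegral.
Import mpoly.
Context (R : rcfType) (m : nat) (a b : R) (ltab : a < b).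
Implicit Types (p q : {mpoly R[m]}) (x y : 'I_m -> R) (s : seq 'I_m) (j : 'I_m).

Definition upd x j t : 'I_m -> R := fun i => if i == j then t else x i.

Definition in_cube x := forall i, a <= x i <= b.

Definition cube_weight1 (e : nat) : R := (b ^+ e.+1 - a ^+ e.+1) / e.+1%:R.

Definition cube_weight s x (k : 'X_{1..m}) : R :=
  \prod_i (if i \in s then cube_weight1 (k i) else x i ^+ k i).

(* Integral over the cube [a, b]^s in the variables of [s], the others being
   frozen at the values given by [x]. *)
Definition pint s x p : R := \sum_(k <- msupp p) p@_k * cube_weight s x k.

Lemma pintwE s x p w : (msize p <= w)%N ->
  pint s x p = \sum_(k : 'X_{1..m < w}) p@_k * cube_weight s x k.
Proof.
move=> le_pw; pose I : subFinType _ := 'X_{1..m < w}.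
rewrite /pint (ssrcomplements.big_mksub I) ?msupp_uniq //=; last first.
  by move=> k /msize_mdeg_lt /leq_trans; apply.
by rewrite big_rmcond //= => i /memN_msupp_eq0 ->; rewrite mul0r.
Qed.

Lemma pint_is_linear s x : linear_for *%R (pint s x).
Proof.
move=> c p q; pose w := maxn (msize (c *: p + q)) (maxn (msize p) (msize q)).
rewrite !(@pintwE _ _ _ w) /w ?leq_max ?leqnn ?orbT //.
rewrite mulr_sumr -big_split /=; apply: eq_bigr => k _.
by rewrite mcoeffD mcoeffZ mulrDl mulrA.
Qed.

HB.instance Definition _ s x :=
  GRing.isLinear.Build R {mpoly R[m]} R *%R (pint s x) (@pint_is_linear s x).

Lemma pintX s x k : pint s x 'X_[k] = cube_weight s x k.
Proof. by rewrite /pint msuppX big_seq1 mcoeffX eqxx mul1r. Qed.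

Lemma pint_nil x p : pint [::] x p = p.@[x].
Proof. by rewrite mevalE. Qed.

Lemma cube_weight_split s x i k : cube_weight s x k =
  (if i \in s then cube_weight1 (k i) else x i ^+ k i) *
  \prod_(l | l != i) (if l \in s then cube_weight1 (k l) else x l ^+ k l).
Proof. by rewrite /cube_weight (bigD1 i). Qed.

(** Mean value theorem for [P], an antiderivative in the variable [i]. Two frozen points are carried
    along so that a single [t] serves both: with [c = -1] they will lie on opposite faces of the
    cube. *)
Lemma pint_mvt1 i s x y (c : R) p : i \notin s ->
  exists2 t, a <= t <= b &
    pint (i :: s) x p + c * pint (i :: s) y p
    = (b - a) * (pint s (upd x i t) p + c * pint s (upd y i t) p).
Proof.
move=> is_.
pose T z k := \prod_(l | l != i) (if l \in s then cube_weight1 (k l) else z l ^+ k l).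
pose A (k : 'X_{1..m}) := p@_k * (T x k + c * T y k).
pose P : {poly R} := \sum_(k <- msupp p) (A k / (k i).+1%:R) *: 'X^((k i).+1).
have PE t : P.[t] = \sum_(k <- msupp p) (A k / (k i).+1%:R) * t ^+ (k i).+1.
  by rewrite /P horner_sum; apply: eq_bigr => k _; rewrite hornerZ hornerXn.
have dPE t : P^`().[t] = \sum_(k <- msupp p) A k * t ^+ (k i).
  rewrite /P raddf_sum horner_sum; apply: eq_bigr => k _ /=.
  rewrite derivZ derivXn hornerZ hornerMn hornerXn /=
     -[t ^+ _ *+ _]mulr_natl mulrA
  divfK ?pnatr_eq0 //.
have wE z k : cube_weight (i :: s) z k = cube_weight1 (k i) * T z k.
  rewrite (cube_weight_split _ _ i) inE eqxx; congr (_ * _).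
  by apply: eq_bigr => l /negPf li; rewrite inE li.
have uE z t k : cube_weight s (upd z i t) k = t ^+ k i * T z k.
  rewrite (cube_weight_split _ _ i) (negPf is_) /upd eqxx; congr (_ * _).
  by apply: eq_bigr => l /negPf li; rewrite li.
have [t /itvP tab dP] := poly_mvt P ltab.
exists t; first by rewrite !tab.
rewrite /pint !mulr_sumr -!big_split /=.
transitivity (P.[b] - P.[a]).
  rewrite !PE -sumrB; apply: eq_bigr => k _.
  by rewrite !wE /cube_weight1 /A; field; rewrite nat1r pnatr_eq0.
rewrite dP dPE mulrC; congr (_ * _); apply: eq_bigr => k _.
by rewrite !uE /A; ring.
Qed.

Lemma pint_mvt2 s x y (c : R) p : uniq s ->
  exists2 z, in_cube z &
    pint s x p + c * pint s y p = (b - a) ^+ size s *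
      (p.@[fun i => if i \in s then z i else x i]
       + c * p.@[fun i => if i \in s then z i else y i]).
Proof.
elim: s => [|i s IHs] in x y *.
  move=> _; exists (fun=> a); first by move=> i; rewrite lexx ltW.
  by rewrite !pint_nil expr0 mul1r.
move=> /= /andP[is_ us]; have [t tab ->] := pint_mvt1 x y c p is_.
have [z zQ ->] := IHs (upd x i t) (upd y i t) us.
exists (upd z i t); first by move=> l; rewrite /upd; case: eqP.
rewrite mulrA exprS; congr (_ * (_ + _ * _)); apply: meval_eq => l;
  by rewrite inE /upd; case: eqP => // ->; rewrite (negPf is_).
Qed.

Definition cint p : R := pint (enum 'I_m) (fun=> 0) p.

HB.instance Definition _ := GRing.isLinear.Build R {mpoly R[m]} R *%R cint
  (@pint_is_linear (enum 'I_m) (fun=> 0)).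

Lemma cint_mvt p : exists2 z, in_cube z & cint p = (b - a) ^+ m * p.@[z].
Proof.
have [z zQ] := pint_mvt2 (fun=> 0) (fun=> 0) 0 p (enum_uniq 'I_m).
rewrite !mul0r !addr0 => e; exists z => //.
rewrite /cint e -cardE card_ord; congr (_ * _); apply: meval_eq => i.
by rewrite mem_enum.
Qed.

(** The fundamental theorem of calculus in the variable [j], then the mean value theorem in the
    others with one [z] common to both faces. *)
Lemma cint_deriv p j : exists2 z, in_cube z &
  cint p^`M(j) = (b - a) ^+ m.-1 * (p.@[upd z j b] - p.@[upd z j a]).
Proof.
pose s := rem j (enum 'I_m).
have us : uniq s by rewrite rem_uniq ?enum_uniq.
have ins i : (i \in s) = (i != j) by rewrite mem_rem_uniq ?enum_uniq // inE mem_enum andbT.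
have szs : size s = m.-1 by rewrite size_rem ?mem_enum // -cardE card_ord.
have [z zQ e] := pint_mvt2 (upd (fun=> 0) j b) (upd (fun=> 0) j a) (-1) p us.
exists z => //.
have -> : cint p^`M(j) = pint s (upd (fun=> 0) j b) p + -1 * pint s (upd (fun=> 0) j a) p.
  rewrite mulN1r; elim/mpolyind: p {e} => [|c k p _ _ IH].
    by rewrite mderiv0 !linear0 subr0.
  rewrite mderivD mderivZ mderivX !linearD !linearZ /= IH !pintX /cint pintX.
  set u := pint s _ p; set v := pint s _ p.
  rewrite !(cube_weight_split _ _ j) mem_enum ins eqxx /upd eqxx /=.
  rewrite mnmBE mnm1E eqxx.
  set X := \prod_(l | _) _; set Y := \prod_(l | _) _; set Z := \prod_(l | _) _.
  have -> : Z = Y by apply: eq_bigr => l lj; rewrite ins lj.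
  have -> : X = Y.
    apply: eq_bigr => l lj; rewrite ins mem_enum lj mnmBE mnm1E.
    by rewrite eq_sym (negPf lj) subn0.
  case: (k j) => [|e]; first by rewrite mul0r !expr0; ring.
  by rewrite subn1 /= /cube_weight1; field; rewrite nat1r pnatr_eq0.
rewrite e szs mulN1r; congr (_ * (_ - _)); apply: meval_eq => i;
  by rewrite ins /upd; case: eqP.
Qed.

End CubeIntegral.

Section Composition.
Import mpoly.
Context (R : rcfType) (m : nat).
Implicit Types (F : {mpoly R[m]}) (q : {poly R}) (j : 'I_m).

Definition pcomp F q : {mpoly R[m]} := horner_alg F q.

HB.instance Definition _ F := GRing.LRMorphism.copy (pcomp F) (horner_alg F).

Lemma mderiv_pcomp F q j : (pcomp F q)^`M(j) = pcomp F q^`() * F^`M(j).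
Proof.
rewrite /pcomp; elim/poly_ind: q => [|q c IH].
  by rewrite deriv0 !linear0 mul0r.
rewrite derivMXaddC !rmorphD !rmorphM /= horner_algX horner_algC mderivD.
rewrite !mderivM IH alg_mpolyC mderivC addr0 mulrDl addrC; congr (_ + _).
by rewrite mulrAC.
Qed.

Lemma meval_pcomp F q x : (pcomp F q).@[x] = q.[F.@[x]].
Proof.
rewrite /pcomp; elim/poly_ind: q => [|q c IH].
  by rewrite !linear0 horner0.
rewrite rmorphD rmorphM /= horner_algX horner_algC mevalD mevalM IH.
by rewrite alg_mpolyC mevalC hornerMXaddC.
Qed.

End Composition.

Section JacobianIntegral.
Import mpoly.
Context (R : rcfType) (m : nat) (a b : R) (ltab : a < b) (leab1 : b - a <= 1).
Implicit Types (u f : 'I_m -> {mpoly R[m]}) (x : 'I_m -> R) (i j k : 'I_m).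

Definition jint u : R := cint a b (\det (jac u)).

Definition on_boundary x := in_cube a b x /\ exists j, x j = a \/ x j = b.

Lemma boundary_upd z j : in_cube a b z ->
  on_boundary (upd z j a) /\ on_boundary (upd z j b).
Proof.
by move=> zQ; split; split; do ?[move=> i; rewrite /upd; case: eqP => // _;
  rewrite lexx ltW | exists j; rewrite /upd eqxx; by [left | right]].
Qed.

Lemma cint_le p (W : R) : 0 <= W ->
  (forall x, in_cube a b x -> `|p.@[x]| <= W) -> `|cint a b p| <= W.
Proof.
move=> W0 pW; have [z zQ ->] := cint_mvt ltab p.
rewrite normrM -[W]mul1r ler_pM ?pW // ger0_norm ?exprn_ge0 ?exprn_ile1 //;
  by rewrite subr_ge0 ltW.
Qed.

Lemma cint_deriv_le p (W : R) j : 0 <= W ->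
  (forall x, on_boundary x -> `|p.@[x]| <= W) -> `|cint a b p^`M(j)| <= 2 * W.
Proof.
move=> W0 pW; have [z /boundary_upd - /(_ j) [za zb] ->] := cint_deriv ltab p j.
rewrite normrM -[_ * W]mul1r ler_pM //.
  by rewrite ger0_norm ?exprn_ge0 ?exprn_ile1 // subr_ge0 ltW.
by rewrite mulrDl !mul1r (le_trans (ler_normB _ _)) // lerD ?pW.
Qed.

Lemma cofactor_jac_le f (L : R) x i j : 0 <= L ->
  (forall k l, k != i -> `|(f k)^`M(l).@[x]| <= L) ->
  `|(cofactor (jac f) i j).@[x]| <= m`!%:R * L ^+ m.-1.
Proof.
move=> L0 fL; rewrite expand_cofactor rmorph_sum /=.
apply: (le_trans (ler_norm_sum _ _ _)).
have -> : m`!%:R * L ^+ m.-1 = \sum_(s : 'S_m) L ^+ m.-1.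
  by rewrite sumr_const card_Sn mulr_natl.
rewrite [leRHS](bigID (fun s : 'S_m => s i == j)) /= ler_wpDr //.
  by apply: sumr_ge0 => s _; rewrite exprn_ge0.
apply: ler_sum => s _; rewrite rmorphM rmorph_sign normrM normr_sign mul1r.
rewrite rmorph_prod /= normr_prod.
apply: (@le_trans _ _ (\prod_(k | i != k) L)).
  apply: ler_prod => k ik; rewrite normr_ge0 mxE fL // eq_sym //.
rewrite prodr_const; suff -> : #|[pred k | i != k]| = m.-1 by [].
rewrite -[in RHS](card_ord m) -(cardC1 i); apply: eq_card => k.
by rewrite !inE eq_sym.
Qed.

(** The factors [g t k] come out of the cofactors, leaving those of the common map [f]. The sum over
    [t] is thus taken before any absolute value, and estimates need not grow with the number of
    terms. *)
Lemma sum_jint (T : finType) (P : pred T) (U g : T -> 'I_m -> {mpoly R[m]}) f i :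
  (forall t k j, P t -> k != i -> (U t k)^`M(j) = g t k * (f k)^`M(j)) ->
  \sum_(t | P t) jint (U t) = \sum_j cint a b
    ((\sum_(t | P t) U t i * \prod_(k | k != i) g t k) * cofactor (jac f) i j)^`M(j).
Proof.
move=> dU; rewrite /jint -!raddf_sum; congr cint.
under eq_bigr => t _ do rewrite (det_jac_div (U t) i).
rewrite exchange_big /=; apply: eq_bigr => j _.
rewrite -raddf_sum; congr (_ ^`M(j)).
rewrite mulr_suml; apply: eq_bigr => t Pt; rewrite -mulrA; congr (_ * _).
rewrite !expand_cofactor mulr_sumr; apply: eq_bigr => s _.
rewrite mulrCA; congr (_ * _).
rewrite [X in X * _](eq_bigl (fun k => i != k)); last by move=> k; rewrite eq_sym.
rewrite -big_split /=; apply: eq_bigr => k ik.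
by rewrite !mxE dU // eq_sym.
Qed.

Lemma sum_jint_le (T : finType) (P : pred T) (U g : T -> 'I_m -> {mpoly R[m]}) f i (W L : R) :
  (forall t k j, P t -> k != i -> (U t k)^`M(j) = g t k * (f k)^`M(j)) ->
  0 <= L -> (forall x k l, on_boundary x -> k != i -> `|(f k)^`M(l).@[x]| <= L) ->
  0 <= W -> (forall x, on_boundary x ->
     `|\sum_(t | P t) (U t i).@[x] * \prod_(k | k != i) (g t k).@[x]| <= W) ->
  `|\sum_(t | P t) jint (U t)| <= 2 * m%:R * m`!%:R * (W * L ^+ m.-1).
Proof.
move=> dU L0 fL W0 UW; rewrite (sum_jint dU).
apply: (le_trans (ler_norm_sum _ _ _)).
have -> : 2 * m%:R * m`!%:R * (W * L ^+ m.-1)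
  = \sum_(j < m) 2 * (W * (m`!%:R * L ^+ m.-1)).
  by rewrite sumr_const card_ord -[RHS]mulr_natr; ring.
apply: ler_sum => j _; apply: cint_deriv_le => [|x xb].
  by rewrite !mulr_ge0 ?exprn_ge0 // ler0n.
rewrite mevalM normrM ler_pM //.
  rewrite rmorph_sum /=; under eq_bigr => t _ do rewrite mevalM rmorph_prod /=.
  exact: UW.
by apply: cofactor_jac_le => // k l ki; exact: fL.
Qed.

Lemma det_jac_le u (L : R) x : 0 <= L ->
  (forall k l, `|(u k)^`M(l).@[x]| <= L) -> `|(\det (jac u)).@[x]| <= m`!%:R * L ^+ m.
Proof.
move=> L0 uL; rewrite rmorph_sum /= (le_trans (ler_norm_sum _ _ _)) //.
have -> : m`!%:R * L ^+ m = \sum_(s : 'S_m) L ^+ m.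
  by rewrite sumr_const card_Sn mulr_natl.
apply: ler_sum => s _; rewrite rmorphM rmorph_sign normrM normr_sign mul1r.
rewrite rmorph_prod /= normr_prod.
have -> : L ^+ m = \prod_(k < m) L by rewrite prodr_const card_ord.
by apply: ler_prod => k _; rewrite normr_ge0 mxE uL.
Qed.

Lemma jint_comp (B : 'I_m -> {poly R}) f :
  jint (fun k => pcomp (f k) (B k))
  = cint a b ((\prod_k pcomp (f k) (B k)^`()) * \det (jac f)).
Proof.
rewrite /jint; congr cint; rewrite /determinant mulr_sumr.
apply: eq_bigr => s _; rewrite mulrCA; congr (_ * _).
by rewrite -big_split /=; apply: eq_bigr => k _; rewrite !mxE mderiv_pcomp.
Qed.

End JacobianIntegral.

(** * Bernstein approximation *)

Section Bernstein1.
Context (R : rcfType).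
Implicit Types (N k : nat) (x : R).

Definition bern N k : {poly R} := 'C(N, k)%:R *: ('X^k * (1 - 'X) ^+ (N - k)).

Lemma bern_sum N : \sum_(k < N.+1) bern N k = 1.
Proof.
rewrite -[RHS](expr1n _ N) -[X in X ^+ _](subrK 'X) exprDn.
by apply: eq_bigr => k _; rewrite /bern mulrC scaler_nat.
Qed.

Lemma bern_ge0 N k x : 0 <= x <= 1 -> 0 <= (bern N k).[x].
Proof.
by move=> /andP[x0 x1]; rewrite /bern !hornerE !mulr_ge0 ?exprn_ge0 ?subr_ge0 ?ler0n.
Qed.

(** The factor ['X * (1 - 'X)] clears the denominators. Each central moment then follows by
    differentiating the previous one, starting from [bern_sum]. *)
Lemma bern_deriv N k : (k <= N)%N ->
  'X * (1 - 'X) * (bern N k)^`() = (k%:R - N%:R * 'X) * bern N k.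
Proof.
move=> kN; rewrite /bern derivZ -!scalerAr; congr (_ *: _).
have dX : 'X * ('X^k)^`() = k%:R * 'X^k :> {poly R}.
  by rewrite derivXn; case: k {kN} => [|k] /=; rewrite ?mulr0n ?mulr0 ?mul0r // mulrnAr
      -exprS mulr_natl.
have dY n : (1 - 'X) * ((1 - 'X) ^+ n)^`() = - n%:R * (1 - 'X) ^+ n :> {poly R}.
  rewrite deriv_exp derivB derivX derivC; case: n => [|n] /=.
    by rewrite mulr0n mulr0 oppr0 mul0r.
  by rewrite sub0r mulN1r mulNrn mulrN mulrnAr -exprS mulNr mulr_natl.
rewrite derivM mulrDr.
have -> : 'X * (1 - 'X) * (('X^k)^`() * (1 - 'X) ^+ (N - k))
  = (1 - 'X) * (1 - 'X) ^+ (N - k) * ('X * ('X^k)^`()) :> {poly R} by ring.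
have -> : 'X * (1 - 'X) * ('X^k * ((1 - 'X) ^+ (N - k))^`())
  = 'X * 'X^k * ((1 - 'X) * ((1 - 'X) ^+ (N - k))^`()) :> {poly R} by ring.
by rewrite dX dY natrB //; ring.
Qed.

Lemma bern_deriv_eval N k x : (k <= N)%N ->
  x * (1 - x) * (bern N k)^`().[x] = (k%:R - N%:R * x) * (bern N k).[x].
Proof.
move=> /bern_deriv /(congr1 (horner^~ x)).
by move: (bern N k)^`() (bern N k) => D B; rewrite -!polyC_natr !hornerE.
Qed.

Lemma bern_moment1 N : \sum_(k < N.+1) (k%:R - N%:R * 'X) * bern N k = 0.
Proof.
transitivity ('X * (1 - 'X) * (\sum_(k < N.+1) bern N k)^`()).
  rewrite raddf_sum mulr_sumr; apply: eq_bigr => k _ /=.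
  by rewrite bern_deriv // -ltnS.
by rewrite bern_sum derivC mulr0.
Qed.

Lemma bern_moment2 N :
  \sum_(k < N.+1) (k%:R - N%:R * 'X) ^+ 2 * bern N k = N%:R * ('X * (1 - 'X)).
Proof.
have H (k : 'I_N.+1) : 'X * (1 - 'X) * ((k%:R - N%:R * 'X) * bern N k)^`()
    = (k%:R - N%:R * 'X) ^+ 2 * bern N k - N%:R * ('X * (1 - 'X)) * bern N k.
  have e := @bern_deriv N k; rewrite -ltnS ltn_ord in e; move/(_ isT): e => e.
  rewrite derivM derivB derivM derivX -!polyC_natr !derivC !polyC_natr.
  rewrite mul0r !add0r mulr1 mulrDr [X in _ + X]mulrCA e.
  by move: (bern N k) (k%:R - _) ('X * _) => B u v; rewrite mulNr mulrN addrC expr2 !mulrA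
      [v * _]mulrC.
have /(congr1 (fun q => 'X * (1 - 'X) * q^`())) := bern_moment1 N.
rewrite deriv0 mulr0 raddf_sum mulr_sumr /=.
under eq_bigr => k _ do rewrite H.
rewrite sumrB => /eqP; rewrite subr_eq0 => /eqP ->.
by rewrite -mulr_sumr bern_sum mulr1.
Qed.

Lemma bern_var N x : (0 < N)%N ->
  \sum_(k < N.+1) (k%:R / N%:R - x) ^+ 2 * (bern N k).[x] = x * (1 - x) / N%:R.
Proof.
move=> N0; have N0' : N%:R != 0 :> R by rewrite pnatr_eq0 -lt0n.
have := congr1 (horner^~ x) (bern_moment2 N); rewrite horner_sum !hornerE => h.
apply: (mulIf (expf_neq0 2 N0')); rewrite mulr_suml.
transitivity (N%:R * (x * (1 - x))); last by field.
move: h; rewrite -polyC_natr hornerC /= => h; rewrite mulrA -h.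
apply: eq_bigr => k _; rewrite -!polyC_natr !hornerE /=.
by field.
Qed.

Lemma bern_sum_eval N x : \sum_(k < N.+1) (bern N k).[x] = 1.
Proof. by rewrite -horner_sum bern_sum hornerC. Qed.

(* AM-GM [2 |u| <= 1/s + s u^2] turns the variance bound into a bound on the
   mean absolute deviation. *)
Lemma bern_absdev s x : (0 < s)%N -> 0 <= x <= 1 ->
  \sum_(k < (s ^ 2).+1) `|k%:R / (s ^ 2)%:R - x| * (bern (s ^ 2) k).[x] <= s%:R^-1.
Proof.
move=> s0 x01; have s0' : 0 < s%:R :> R by rewrite ltr0n.
have N0 : (0 < s ^ 2)%N by rewrite expn_gt0 s0.
pose u k : R := k%:R / (s ^ 2)%:R - x.
apply: (@le_trans _ _ (\sum_(k < (s ^ 2).+1) (s%:R^-1 / 2 * (bern (s ^ 2) k).[x] +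
   s%:R / 2 * (u k ^+ 2 * (bern (s ^ 2) k).[x])))).
  apply: ler_sum => k _; rewrite mulrA -mulrDl ler_wpM2r ?bern_ge0 //.
  rewrite -[u k ^+ 2]real_normK ?num_real // -/(u k); set v := `|u k|.
  have := sqr_ge0 (s%:R * v - 1).
  have -> : (s%:R * v - 1) ^+ 2 = 2 * s%:R * (s%:R^-1 / 2 + s%:R / 2 * v ^+ 2 - v).
    by field; rewrite gt_eqF.
  by rewrite pmulr_rge0 ?mulr_gt0 // subr_ge0.
rewrite big_split /= -!mulr_sumr bern_sum_eval mulr1 bern_var //.
rewrite [leRHS](_ : _ = s%:R^-1 / 2 + s%:R / 2 * (s ^ 2)%:R^-1); last first.
  by rewrite natrX; field; rewrite gt_eqF.
rewrite lerD2l ler_pM2l ?divr_gt0 // ler_piMl ?invr_ge0 ?ler0n //.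
by case/andP: x01 => x0 x1; apply: mulr_ile1; lra.
Qed.

End Bernstein1.

Section BernsteinOperator.
Import mpoly.
Context (R : rcfType) (m : nat).
Implicit Types (phi : ('I_m -> R) -> R) (x : 'I_m -> R) (N s : nat) (j i : 'I_m).

Definition node N (p : {ffun 'I_m -> 'I_N.+1}) : 'I_m -> R := fun i => (p i)%:R / N%:R.

Definition tbern N (p : {ffun 'I_m -> 'I_N.+1}) : {mpoly R[m]} :=
  \prod_i pcomp 'X_i (bern R N (p i)).

Definition bernop N phi : {mpoly R[m]} := \sum_p phi (@node N p) *: tbern p.

Definition unit_cube x := forall i, 0 <= x i <= 1.

Definition l1dist x y : R := \sum_i `|x i - y i|.

Lemma node_unit N p : unit_cube (@node N p).
Proof.
move=> i; rewrite /node divr_ge0 ?ler0n //=; move: (p i) => k.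
case: N p k => [|N] p k; first by rewrite invr0 mulr0 ler01.
by rewrite ler_pdivrMr ?ltr0n // mul1r ler_nat -ltnS.
Qed.

Lemma tbern_eval N p x : (@tbern N p).@[x] = \prod_i (bern R N (p i)).[x i].
Proof.
by rewrite rmorph_prod; apply: eq_bigr => i _ /=; rewrite meval_pcomp mevalXU.
Qed.

Lemma tbern_ge0 N p x : unit_cube x -> 0 <= (@tbern N p).@[x].
Proof. by move=> xU; rewrite tbern_eval prodr_ge0 // => i _; exact: bern_ge0. Qed.

Lemma tbern_sum N : \sum_p @tbern N p = 1.
Proof.
rewrite -(bigA_distr_bigA (fun i (k : 'I_N.+1) => pcomp 'X_i (bern R N k))) /=.
by apply: big1 => i _; rewrite -raddf_sum bern_sum; exact: rmorph1.
Qed.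

Lemma tbern_sum_eval N x : \sum_p (@tbern N p).@[x] = 1.
Proof. by rewrite -raddf_sum tbern_sum /= meval1. Qed.

Lemma bernop_eval N phi x : (bernop N phi).@[x] = \sum_p phi (node p) * (@tbern N p).@[x].
Proof. by rewrite raddf_sum; apply: eq_bigr => p _; rewrite /= mevalZ. Qed.

Lemma tbern_marginal N i (h : 'I_N.+1 -> R) x :
  \sum_(p : {ffun 'I_m -> 'I_N.+1}) h (p i) * (@tbern N p).@[x] = \sum_k h k * (bern R N k).[x i].
Proof.
pose G l (k : 'I_N.+1) := (if l == i then h k else 1) * (bern R N k).[x l].
transitivity (\sum_(p : {ffun 'I_m -> 'I_N.+1}) \prod_l G l (p l)).
  apply: eq_bigr => p _; rewrite tbern_eval big_split /=; congr (_ * _).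
  by rewrite -big_mkcond big_pred1_eq.
rewrite -(bigA_distr_bigA G) (bigD1 i) //= [X in _ * X]big1 ?mulr1.
  by apply: eq_bigr => k _; rewrite /G eqxx.
move=> l /negPf li; rewrite /G li; under eq_bigr => k _ do rewrite mul1r.
by rewrite -horner_sum bern_sum hornerC.
Qed.

Lemma tbern_var N i x : (0 < N)%N -> unit_cube x ->
  \sum_p (node p i - x i) ^+ 2 * (@tbern N p).@[x] <= N%:R^-1.
Proof.
move=> N0 xU; rewrite (tbern_marginal i (fun k => (k%:R / N%:R - x i) ^+ 2)) bern_var //.
rewrite ler_piMl ?invr_ge0 ?ler0n //; have := xU i; nra.
Qed.

Lemma tbern_absdev s i x : (0 < s)%N -> unit_cube x ->
  \sum_p `|node p i - x i| * (@tbern (s ^ 2) p).@[x] <= s%:R^-1.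
Proof.
move=> s0 xU; rewrite (tbern_marginal i (fun k => `|k%:R / (s ^ 2)%:R - x i|)).
exact: bern_absdev.
Qed.

Lemma tbern_l1 s x : (0 < s)%N -> unit_cube x ->
  \sum_p l1dist (node p) x * (@tbern (s ^ 2) p).@[x] <= m%:R / s%:R.
Proof.
move=> s0 xU; under eq_bigr => p _ do rewrite mulr_suml.
rewrite exchange_big /=.
have -> : m%:R / s%:R = \sum_(i < m) s%:R^-1 :> R by rewrite sumr_const card_ord mulr_natl.
by apply: ler_sum => i _; exact: tbern_absdev.
Qed.

(** An affine modulus [A + K * l1dist] is what both Hoelder and uniformly continuous data provide,
    and its average needs only the first absolute moment. Degree [s ^ 2] corresponds to the
    resolution [1 / s]. *)
Lemma bernop_le s phi x A K : (0 < s)%N -> unit_cube x -> 0 <= K ->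
  (forall y, unit_cube y -> `|phi y - phi x| <= A + K * l1dist y x) ->
  `|(bernop (s ^ 2) phi).@[x] - phi x| <= A + K * (m%:R / s%:R).
Proof.
move=> s0 xU K0 hphi.
have -> : (bernop (s ^ 2) phi).@[x] - phi x =
    \sum_p (phi (node p) - phi x) * (@tbern (s ^ 2) p).@[x].
  rewrite bernop_eval -[phi x in LHS]mulr1 -(tbern_sum_eval (s ^ 2) x) mulr_sumr -sumrB.
  by apply: eq_bigr => p _; rewrite mulrBl.
apply: (le_trans (ler_norm_sum _ _ _)).
apply: (@le_trans _ _ (\sum_p (A * (@tbern (s ^ 2) p).@[x] +
    K * (l1dist (node p) x * (@tbern (s ^ 2) p).@[x])))).
  apply: ler_sum => p _; rewrite normrM (ger0_norm (tbern_ge0 _ xU)) mulrA -mulrDl.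
  by rewrite ler_wpM2r ?tbern_ge0 // hphi //; exact: node_unit.
rewrite big_split /= -!mulr_sumr tbern_sum_eval mulr1 lerD2l ler_wpM2l //.
exact: tbern_l1.
Qed.

Lemma mderiv_tbern N p x j : (0 < N)%N ->
  x j * (1 - x j) * (@tbern N p)^`M(j).@[x]
  = N%:R * ((node p j - x j) * (@tbern N p).@[x]).
Proof.
move=> N0; rewrite /tbern (bigD1 j) //= mderivM mderiv_pcomp.
set T := \prod_(i | _) _.
have -> : T^`M(j) = 0.
  rewrite /T mderiv_prod ?index_enum_uniq // big1 // => k kj.
  rewrite mderiv_pcomp mderivX mnm1E (negPf kj) scale0r mulr0 mul0r //.
rewrite mulr0 addr0 mderivX mnm1E eqxx scale1r.
have -> : (U_(j) - U_(j))%MM = 0%MM by apply/mnmP => i; rewrite mnmBE subnn mnm0E.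
rewrite mpolyX0 mulr1.
rewrite !mevalM !meval_pcomp mevalXU [LHS]mulrA.
have pN : (p j <= N)%N by rewrite -ltnS.
have -> := @bern_deriv_eval R N (p j) (x j) pN.
rewrite /node; move: (bern R N _).[_] T.@[x] => B C.
by field; rewrite pnatr_eq0 -lt0n.
Qed.

(** The derivatives of the weights sum to 0, so [phi] may be replaced by [phi - phi x] before the
    modulus is applied. *)
Lemma bernop_grad s phi x A K j : (0 < s)%N -> unit_cube x ->
  1 / 4 <= x j <= 3 / 4 -> 0 <= A -> 0 <= K ->
  (forall y, unit_cube y -> `|phi y - phi x| <= A + K * l1dist y x) ->
  `|(bernop (s ^ 2) phi)^`M(j).@[x]| <= 6 * (A * s%:R + K * m%:R).
Proof.
move=> s0 xU xj A0 K0 hphi; have s0' : 0 < s%:R :> R by rewrite ltr0n.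
have N0 : (0 < s ^ 2)%N by rewrite expn_gt0 s0.
pose w p := (@tbern (s ^ 2) p).@[x].
have w0 p : 0 <= w p by exact: tbern_ge0.
(* This lower bound is where the range [[1/4, 3/4]] enters; the constant 6 rounds up 16/3. *)
have v0 : 3 / 16 <= x j * (1 - x j) by nra.
pose v := x j * (1 - x j).
have vD : v * (bernop (s ^ 2) phi)^`M(j).@[x] =
   \sum_p (phi (node p) - phi x) * (s%:R ^+ 2 * ((node p j - x j) * w p)).
  rewrite /bernop (raddf_sum (mderiv j)) (raddf_sum (meval x)) mulr_sumr /=.
  under [RHS]eq_bigr => p _ do rewrite mulrBl.
  rewrite sumrB -[LHS]subr0; congr (_ - _).
    by apply: eq_bigr => p _; rewrite mderivZ mevalZ mulrCA mderiv_tbern // natrX.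
  rewrite -mulr_sumr -natrX.
  under eq_bigr => p _ do rewrite -mderiv_tbern //.
  rewrite -mulr_sumr -(raddf_sum (meval x)) -(raddf_sum (mderiv j)) tbern_sum /= -mpolyC1
      mderivC meval0.
  by rewrite !mulr0.
have vpos : 0 < v by apply: lt_le_trans v0; lra.
suff h : v * `|(bernop (s ^ 2) phi)^`M(j).@[x]| <= A * s%:R + K * m%:R.
  have n0 := normr_ge0 ((bernop (s ^ 2) phi)^`M(j).@[x]).
  have : 3 / 16 * `|(bernop (s ^ 2) phi)^`M(j).@[x]| <= v * `|(bernop (s ^ 2) phi)^`M(j).@[x]|.
    by rewrite ler_wpM2r.
  lra.
rewrite -(ger0_norm (ltW vpos)) -normrM vD.
apply: (le_trans (ler_norm_sum _ _ _)).
(* The [A] part needs the mean deviation, at most [1/s]. In the [K] part AM-GM splits the products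
   of deviations, so that only variances, at most [1/s^2], remain. *)
apply: (@le_trans _ _ (\sum_p (A * s%:R ^+ 2 * (`|node p j - x j| * w p) +
    \sum_i K * s%:R ^+ 2 / 2 * ((node p i - x i) ^+ 2 * w p + (node p j - x j) ^+ 2 * w p)))).
  apply: ler_sum => p _; rewrite !normrM (ger0_norm (w0 p)) !normr_nat -expr2.
  under eq_bigr => i _ do rewrite -mulrDl mulrA.
  rewrite -mulr_suml; set u := `|node p j - x j|; set V := \sum_i _.
  have -> : `|phi (node p) - phi x| * (s%:R ^+ 2 * (u * w p))
    = `|phi (node p) - phi x| * s%:R ^+ 2 * u * w p by ring.
  have -> : A * s%:R ^+ 2 * (u * w p) + V * w p = (A * s%:R ^+ 2 * u + V) * w p by ring.
  rewrite ler_wpM2r // /V.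
  apply: (@le_trans _ _ ((A + K * l1dist (node p) x) * s%:R ^+ 2 * u)).
    have u0 : 0 <= u by exact: normr_ge0.
    rewrite ler_wpM2r // ler_wpM2r ?exprn_ge0 ?ler0n // hphi //; exact: node_unit.
  rewrite !mulrDl lerD2l /l1dist mulr_sumr !mulr_suml.
  apply: ler_sum => i _.
  rewrite -[(node p i - x i) ^+ 2]real_normK ?num_real //.
  rewrite -[(node p j - x j) ^+ 2]real_normK ?num_real // -/u.
  set t := `|_|.
  have -> : K * t * s%:R ^+ 2 * u = K * s%:R ^+ 2 / 2 * (2 * t * u) by field.
  rewrite ler_wpM2l //; first by rewrite divr_ge0 // mulr_ge0 // exprn_ge0.
  by have := sqr_ge0 (t - u); nra.
rewrite big_split /= lerD //.
  rewrite -mulr_sumr; have h := @tbern_absdev s j x s0 xU.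
  have -> : A * s%:R = A * s%:R ^+ 2 * s%:R^-1 by field; rewrite gt_eqF.
  by rewrite ler_wpM2l // mulr_ge0 // exprn_ge0 // ltW.
rewrite exchange_big /=.
have -> : K * m%:R = \sum_(i < m) K by rewrite sumr_const card_ord mulr_natr.
apply: ler_sum => i _; rewrite -mulr_sumr big_split /=.
have hi := @tbern_var (s ^ 2) i x N0 xU; have hj := @tbern_var (s ^ 2) j x N0 xU.
apply: (@le_trans _ _ (K * s%:R ^+ 2 / 2 * ((s ^ 2)%:R^-1 + (s ^ 2)%:R^-1))).
  by rewrite ler_wpM2l ?divr_ge0 ?mulr_ge0 ?exprn_ge0 ?lerD // ler0n.
by rewrite natrX le_eqVlt; apply/orP; left; apply/eqP; field; rewrite gt_eqF.
Qed.

Lemma bernop_norm_le N phi x M : unit_cube x ->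
  (forall y, unit_cube y -> `|phi y| <= M) -> `|(bernop N phi).@[x]| <= M.
Proof.
move=> xU hphi; rewrite bernop_eval (le_trans (ler_norm_sum _ _ _)) //.
rewrite -[M]mulr1 -(tbern_sum_eval N x) mulr_sumr; apply: ler_sum => p _.
rewrite normrM (ger0_norm (tbern_ge0 _ xU)) ler_wpM2r ?tbern_ge0 // hphi //.
exact: node_unit.
Qed.

Lemma bernop_ge N phi x M : unit_cube x ->
  (forall y, unit_cube y -> M <= phi y) -> M <= (bernop N phi).@[x].
Proof.
move=> xU hphi; rewrite bernop_eval.
rewrite -[M]mulr1 -(tbern_sum_eval N x) mulr_sumr; apply: ler_sum => p _.
by rewrite ler_wpM2r ?tbern_ge0 // hphi //; exact: node_unit.
Qed.

(** A crude bound on the whole unit cube, for places where only finiteness matters. *)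
Definition coefnorm (p : {mpoly R[m]}) : R := \sum_(k <- msupp p) `|p@_k|.

Lemma coefnorm_ge0 p : 0 <= coefnorm p.
Proof. by apply: sumr_ge0. Qed.

Lemma meval_le_coefnorm p x : unit_cube x -> `|p.@[x]| <= coefnorm p.
Proof.
move=> xU; rewrite mevalE (le_trans (ler_norm_sum _ _ _)) //.
apply: ler_sum => k _; rewrite normrM ler_piMr // normr_prod.
apply: prodr_ile1 => i _; rewrite normr_ge0 normrX /=.
have /andP[x0 x1] := xU i.
by rewrite ger0_norm // exprn_ile1.
Qed.

End BernsteinOperator.

Section PolynomialGrowth.
Context (R : rcfType).
Implicit Types (q : {poly R}).

Lemma poly_incr_le q a b C : a <= b -> (forall t, a <= t <= b -> q^`().[t] <= C) ->
  q.[b] - q.[a] <= C * (b - a).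
Proof.
rewrite le_eqVlt => /predU1P[->|ab] qC; first by rewrite !subrr mulr0.
have [t /itvP tab ->] := poly_mvt q ab.
by rewrite ler_wpM2r ?subr_ge0 ?(ltW ab) // qC // !tab.
Qed.

Lemma poly_incr_ge q a b C : a <= b -> (forall t, a <= t <= b -> C <= q^`().[t]) ->
  C * (b - a) <= q.[b] - q.[a].
Proof.
move=> ab qC; have := @poly_incr_le (- q) a b (- C) ab.
rewrite !hornerN mulNr -opprD lerN2; apply=> t /qC.
by rewrite derivN hornerN lerN2.
Qed.

Lemma poly_lip q a b C x y : a <= x <= b -> a <= y <= b ->
  (forall t, a <= t <= b -> `|q^`().[t]| <= C) -> `|q.[y] - q.[x]| <= C * `|y - x|.
Proof.
wlog xy : x y / x <= y => [hw|] xab yab qC.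
  case: (leP x y) => [|/ltW] h; first exact: hw.
  by rewrite distrC [`|y - x|]distrC; apply: hw.
have qC' t : x <= t <= y -> `|q^`().[t]| <= C by move=> ?; apply: qC; lra.
rewrite [`|y - x|]ger0_norm ?subr_ge0 // ler_norml -mulNr poly_incr_le ?poly_incr_ge //.
  by move=> t /qC'; rewrite ler_norml => /andP[].
by move=> t /qC'; rewrite ler_norml => /andP[].
Qed.

Definition antideriv q : {poly R} := \sum_(k < size q) (q`_k / k.+1%:R) *: 'X^(k.+1).

Lemma antiderivE q : (antideriv q)^`() = q.
Proof.
rewrite raddf_sum -[RHS]coefK poly_def; apply: eq_bigr => k _ /=.
by rewrite derivZ derivXn /= -scaler_nat scalerA divfK ?pnatr_eq0.
Qed.

End PolynomialGrowth.

(** * Partitions of unity in the target *)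

Section TestFunctions.
Context (R : rcfType).
Implicit Types (r z w s y : R).

Definition ramp s : R := Num.max 0 (Num.min 1 s).

(** The tent on [[z, z + 2 w]] with peak 1 at [z + w]. As a difference of ramps, its sums over
    shifts by [w] telescope. *)
Definition hat z w s : R := ramp ((s - z) / w) - ramp ((s - z) / w - 1).

Lemma ramp_cases s : [\/ s <= 0 /\ ramp s = 0, 0 <= s <= 1 /\ ramp s = s
                       | 1 <= s /\ ramp s = 1].
Proof.
rewrite /ramp; case: (leP s 0) => s0; last first.
  case: (leP 1 s) => s1.
    by constructor 3; split => //; rewrite maxEle ler01.
  by constructor 2; split; [lra | rewrite maxEle ltW].
constructor 1; split => //; rewrite minEle; case: leP => h; first by lra.
by rewrite maxEle; case: leP => h' //; lra.
Qed.

Lemma ramp_lip s y : `|ramp s - ramp y| <= `|s - y|.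
Proof.
have h1 := ler_norm (s - y); have h2 := ler_norm (- (s - y)); rewrite normrN in h2.
move: h1 h2; move: `|s - y| => t h1 h2.
case: (ramp_cases s) => -[hs ->]; case: (ramp_cases y) => -[hy ->];
  rewrite ler_norml; apply/andP; split; lra.
Qed.

Lemma hat_ge0 z w s : 0 <= hat z w s.
Proof.
rewrite /hat; move: ((s - z) / w) => u.
by case: (ramp_cases u) => -[hs ->]; case: (ramp_cases (u - 1)) => -[hy ->]; lra.
Qed.

Lemma hat_le1 z w s : hat z w s <= 1.
Proof.
rewrite /hat; move: ((s - z) / w) => u.
by case: (ramp_cases u) => -[hs ->]; case: (ramp_cases (u - 1)) => -[hy ->]; lra.
Qed.

Lemma hat_out z w s : 0 < w -> s <= z \/ z + 2 * w <= s -> hat z w s = 0.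
Proof.
move=> w0 h; rewrite /hat; set u := (s - z) / w.
have us : u * w = s - z by rewrite divfK // gt_eqF.
have {}h : u <= 0 \/ 2 <= u by case: h => h; [left|right]; nra.
by case: (ramp_cases u) => -[hs ->]; case: (ramp_cases (u - 1)) => -[hy ->];
  case: h => h; lra.
Qed.

Lemma hat_mid z w s : 0 < w -> z + w / 2 <= s <= z + 3 * w / 2 -> 1 / 2 <= hat z w s.
Proof.
move=> w0 h; rewrite /hat; set u := (s - z) / w.
have us : u * w = s - z by rewrite divfK // gt_eqF.
have {}h : 1 / 2 <= u <= 3 / 2 by nra.
by case: (ramp_cases u) => -[hs ->]; case: (ramp_cases (u - 1)) => -[hy ->]; lra.
Qed.

Lemma hat_lip z w s y : 0 < w -> `|hat z w s - hat z w y| <= 2 / w * `|s - y|.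
Proof.
move=> w0; rewrite /hat.
have -> : 2 / w * `|s - y| = `|(s - z) / w - (y - z) / w| + `|((s - z) / w - 1) - ((y - z)
    / w - 1)|.
  rewrite opprD addrACA subrr addr0 -mulrBl opprD addrACA subrr addr0 normrM.
  by rewrite (ger0_norm (_ : 0 <= w^-1)) ?invr_ge0 ?ltW //; ring.
set a := ramp _; set b := ramp _; set c := ramp _; set e := ramp _.
have -> : a - b - (c - e) = (a - c) - (b - e) by ring.
by rewrite (le_trans (ler_normB _ _)) // lerD // ramp_lip.
Qed.

Lemma hat_sum (M : nat) z w s : 0 < w -> z + w <= s <= z + M%:R * w ->
  \sum_(p < M) hat (z + p%:R * w) w s = 1.
Proof.
move=> w0 hs; pose g (k : nat) := - ramp ((s - z) / w - k%:R).
transitivity (\sum_(0 <= p < M) (g p.+1 - g p)).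
  rewrite big_mkord; apply: eq_bigr => p _; rewrite /hat /g opprK [RHS]addrC -natr1.
  congr (ramp _ - ramp _); field; exact: lt0r_neq0.
rewrite telescope_sumr // /g subr0; set u := (s - z) / w.
have us : u * w = s - z by rewrite divfK // gt_eqF.
have : 1 <= u by nra.
have : u - M%:R <= 0 by nra.
by case: (ramp_cases u) => -[h ->]; case: (ramp_cases (u - M%:R)) => -[h' ->]; lra.
Qed.

Lemma hat_sum_shift (A : nat) z w s : 0 < w ->
  \sum_(a < A) hat z w (s + w * a%:R) <= 1.
Proof.
move=> w0; pose g (k : nat) := ramp ((s - z) / w + k%:R - 1).
have -> : \sum_(a < A) hat z w (s + w * a%:R) = \sum_(0 <= a < A) (g a.+1 - g a).
  rewrite big_mkord; apply: eq_bigr => a _; rewrite /hat /g -natr1.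
  congr (ramp _ - ramp _); field; exact: lt0r_neq0.
rewrite telescope_sumr // /g.
move: (_ + A%:R - 1) (_ + 0%:R - 1) => u v.
by case: (ramp_cases u) => -[h ->]; case: (ramp_cases v) => -[h' ->]; lra.
Qed.

(* Bernstein operator of degree [N] on the interval [-r, r]. *)
Definition bern1 r N (phi : R -> R) : {poly R} :=
  \sum_(k < N.+1) phi (2 * r * (k%:R / N%:R) - r) *: (bern R N k \Po ((2 * r)^-1 *: ('X + r%:P))).

Lemma bern1_eval r N phi y : (bern1 r N phi).[y] =
  \sum_(k < N.+1) phi (2 * r * (k%:R / N%:R) - r) * (bern R N k).[(y + r) / (2 * r)].
Proof.
rewrite horner_sum; apply: eq_bigr => k _; rewrite hornerZ horner_comp.
rewrite [(_ *: (_ + _)).[_]]hornerZ hornerD hornerX hornerC; congr (_ * _.[_]); exact: mulrC.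
Qed.

Lemma bern1_unit r y : 0 < r -> -r <= y <= r -> 0 <= (y + r) / (2 * r) <= 1.
Proof.
move=> r0 yr; have r20 : 0 < 2 * r by lra.
by rewrite divr_ge0 ?ler_pdivrMr ?mul1r //; lra.
Qed.

Lemma bern1_ge0 r N phi y : 0 < r -> -r <= y <= r -> (forall t, 0 <= phi t) ->
  0 <= (bern1 r N phi).[y].
Proof.
move=> r0 yr phi0; rewrite bern1_eval; apply: sumr_ge0 => k _.
by rewrite mulr_ge0 // bern_ge0 // bern1_unit.
Qed.

Lemma bern1_approx r (s : nat) phi y C : 0 < r -> (0 < s)%N -> -r <= y <= r -> 0 <= C ->
  (forall t t', `|phi t - phi t'| <= C * `|t - t'|) ->
  `|(bern1 r (s ^ 2) phi).[y] - phi y| <= C * (2 * r) / s%:R.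
Proof.
move=> r0 s0 yr C0 lip; rewrite bern1_eval; set x := (y + r) / (2 * r).
have x01 : 0 <= x <= 1 by exact: bern1_unit.
have yx : y = 2 * r * x - r by rewrite /x; field; rewrite gt_eqF.
rewrite -[phi y]mulr1 -[X in phi y * X](bern_sum_eval (s ^ 2) x) mulr_sumr -sumrB.
rewrite (le_trans (ler_norm_sum _ _ _)) //.
have Cr0 : 0 <= C * (2 * r) by rewrite mulr_ge0 //; lra.
apply: le_trans (ler_wpM2l Cr0 (bern_absdev s0 x01)).
rewrite mulr_sumr; apply: ler_sum => k _.
rewrite -mulrBl normrM (ger0_norm (bern_ge0 _ _ x01)) [leRHS]mulrA ler_wpM2r ?bern_ge0 //.
apply: le_trans (lip _ _) _; rewrite -[leRHS]mulrA ler_wpM2l // yx.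
have -> : 2 * r * (k%:R / (s ^ 2)%:R) - r - (2 * r * x - r) = 2 * r * (k%:R / (s ^ 2)%:R -
    x) by ring.
by rewrite normrM ger0_norm //; lra.
Qed.

Lemma bern1_sum r N (M : nat) (phi : 'I_M -> R -> R) : 0 < r -> (0 < N)%N ->
  (forall y, -r <= y <= r -> \sum_p phi p y = 1) -> \sum_p bern1 r N (phi p) = 1.
Proof.
move=> r0 N0 h; rewrite /bern1 exchange_big /=.
under eq_bigr => k _.
  rewrite -scaler_suml h ?scale1r; last first.
    have k0 : 0 <= k%:R / N%:R :> R by rewrite divr_ge0 ?ler0n.
    have k1 : k%:R / N%:R <= 1 :> R by rewrite ler_pdivrMr ?ltr0n // mul1r ler_nat -ltnS.
    by nra.
  over.
by rewrite -raddf_sum bern_sum /= comp_polyC.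
Qed.

End TestFunctions.

Section TestFamily.
Context (R : archiRcfType).
Implicit Types (r rho tau y : R) (q : {poly R}).

Definition prim r q : {poly R} := antideriv q - ((antideriv q).[- r])%:P.

Lemma primE r q : (prim r q)^`() = q.
Proof. by rewrite derivB derivC subr0 antiderivE. Qed.

Lemma prim_left r q : (prim r q).[- r] = 0.
Proof. by rewrite !hornerE subrr. Qed.

(** The grid starts one step to the left of [- r], so that the tents already sum to 1 at [- r]. *)
Definition grid r rho (p : nat) : R := - r - rho + p%:R * rho.

(** The sum is exactly 1, so a Jacobian integral splits without error. Only the support condition is
    relaxed: outside its tent a member is at most [tau] instead of 0. *)
Definition test_family r rho tau M (beta : 'I_M -> {poly R}) :=
  [/\ \sum_p beta p = 1,
      forall p y, - r <= y <= r -> 0 <= (beta p).[y] &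
      forall p y, - r <= y <= r -> `|(beta p).[y] - hat (grid r rho p) rho y| <= tau].

(** One degree serves all [z], since the Lipschitz constant of a tent depends on its width alone. *)
Lemma hat_poly r w tau : 0 < r -> 0 < w -> 0 < tau ->
  exists2 N, (0 < N)%N & forall z y, - r <= y <= r ->
    `|(bern1 r N (hat z w)).[y] - hat z w y| <= tau.
Proof.
move=> r0 w0 tau0; pose C := 2 / w * (2 * r).
have C0 : 0 < C by rewrite mulr_gt0 ?divr_gt0 // mulr_gt0.
pose s := (Num.truncn (C / tau)).+1.
have s0 : 0 < s%:R :> R by rewrite ltr0n.
have hs : C / s%:R <= tau.
  rewrite ler_pdivrMr // mulrC -ler_pdivrMr // ltW // /s.
  by have /andP[] := truncn_itv (ltW (divr_gt0 C0 tau0)).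
exists (s ^ 2)%N; first by rewrite expn_gt0.
move=> z y yr; apply: le_trans hs.
apply: bern1_approx => //; first by rewrite divr_ge0 // ltW.
by move=> t t'; exact: hat_lip.
Qed.

Lemma test_family_exists r rho tau M : 0 < r -> 0 < rho -> 0 < tau ->
  r <= grid r rho M -> exists beta : 'I_M -> {poly R}, test_family r rho tau beta.
Proof.
move=> r0 rho0 tau0 rM; have [N N0 h] := hat_poly r0 rho0 tau0.
exists (fun p => bern1 r N (hat (grid r rho p) rho)); split.
- apply: bern1_sum => // y yr; apply: hat_sum => //.
  by move: rM; rewrite /grid => rM; lra.
- by move=> p y yr; apply: bern1_ge0 => // t; exact: hat_ge0.
- by move=> p y yr; exact: h.
Qed.

Section Properties.
Context (r rho tau : R) (r0 : 0 < r) (rho0 : 0 < rho) (tau0 : 0 < tau).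
Context (M : nat) (beta : 'I_M -> {poly R}) (tf : test_family r rho tau beta).

Lemma test_ge0 (p : 'I_M) y : - r <= y <= r -> 0 <= (beta p).[y].
Proof. by case: tf => _ + _; apply. Qed.

Lemma test_le1 (p : 'I_M) y : - r <= y <= r -> (beta p).[y] <= 1.
Proof.
move=> yr; case: tf => /(congr1 (horner^~ y)) + _ _.
rewrite horner_sum hornerC (bigD1 p) //= => <-.
by rewrite lerDl sumr_ge0 // => q _; exact: test_ge0.
Qed.

Lemma test_out (p : 'I_M) y : - r <= y <= r ->
  y <= grid r rho p \/ grid r rho p + 2 * rho <= y -> (beta p).[y] <= tau.
Proof.
move=> yr out; case: tf => _ _ /(_ p y yr); rewrite hat_out // subr0.
exact/le_trans/ler_norm.
Qed.

Lemma test_sum_ge0 m (P : pred {ffun 'I_m -> 'I_M}) (Q : pred 'I_m) (y : 'I_m -> R) :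
  (forall k, - r <= y k <= r) -> 0 <= \sum_(p | P p) \prod_(k | Q k) (beta (p k)).[y k].
Proof.
by move=> yr; apply: sumr_ge0 => p _; apply: prodr_ge0 => k _; exact: test_ge0.
Qed.

Lemma test_sum_le1 m (P : pred {ffun 'I_m -> 'I_M}) (y : 'I_m -> R) :
  (forall k, - r <= y k <= r) -> \sum_(p | P p) \prod_k (beta (p k)).[y k] <= 1.
Proof.
move=> yr; apply: (@le_trans _ _ (\sum_(p : {ffun 'I_m -> 'I_M}) \prod_k (beta (p k)).[y k])).
  by rewrite [leRHS](bigID P) /= lerDl; exact: test_sum_ge0.
rewrite -(bigA_distr_bigA (fun k (l : 'I_M) => (beta l).[y k])) big1 // => k _.
by rewrite -horner_sum; case: tf => -> _ _; rewrite hornerC.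
Qed.

(** Shifts by whole mesh steps leave a given cell quickly: the tents contribute at most 1 in total,
    and the errors at most [A * tau]. *)
Lemma test_shift_sum (A : nat) (p : 'I_M) y : A%:R * tau <= 1 ->
  (forall a, (a < A)%N -> - r <= y + rho * a%:R <= r) ->
  \sum_(a < A) (beta p).[y + rho * a%:R] <= 2.
Proof.
move=> Atau yr; have := @hat_sum_shift _ A (grid r rho p) rho y rho0.
suff : \sum_(a < A) (beta p).[y + rho * a%:R]
   <= \sum_(a < A) hat (grid r rho p) rho (y + rho * a%:R) + A%:R * tau by lra.
have -> : A%:R * tau = \sum_(a < A) tau by rewrite sumr_const card_ord mulr_natl.
rewrite -big_split /=; apply: ler_sum => a _.
case: tf => _ _ /(_ p _ (yr a (ltn_ord a))) h.
by have := le_trans (ler_norm _) h; lra.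
Qed.

Lemma prim_ge0 (p : 'I_M) y : - r <= y <= r -> 0 <= (prim r (beta p)).[y].
Proof.
move=> yr; have := @poly_incr_ge _ (prim r (beta p)) (- r) y 0.
rewrite prim_left mul0r subr0; apply; first by case/andP: yr.
by move=> t ty; rewrite primE test_ge0 //; lra.
Qed.

Lemma prim_le_left (p : 'I_M) y : - r <= y <= r -> y <= grid r rho p ->
  (prim r (beta p)).[y] <= 2 * r * tau.
Proof.
move=> yr yp; have := @poly_incr_le _ (prim r (beta p)) (- r) y tau.
rewrite prim_left subr0 => h; apply: le_trans (h _ _) _; first by case/andP: yr.
  by move=> t ty; rewrite primE test_out //; [lra | left; lra].
by move: tau0; nra.
Qed.

Lemma prim_le_right (p : 'I_M) y : - r <= y <= r -> grid r rho p + 2 * rho <= y ->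
  0 <= (prim r (beta p)).[r] - (prim r (beta p)).[y] <= 2 * r * tau.
Proof.
move=> yr yp; apply/andP; split.
  have := @poly_incr_ge _ (prim r (beta p)) y r 0; rewrite mul0r; apply; first by lra.
  by move=> t ty; rewrite primE test_ge0 //; lra.
have h := @poly_incr_le _ (prim r (beta p)) y r tau.
apply: le_trans (h _ _) _; first by lra.
  by move=> t ty; rewrite primE test_out //; [lra | right; lra].
by move: tau0; nra.
Qed.

Lemma prim_mono (p : 'I_M) y y' : - r <= y <= r -> - r <= y' <= r -> y <= y' ->
  (prim r (beta p)).[y] <= (prim r (beta p)).[y'].
Proof.
move=> yr yr' yy; rewrite -subr_ge0.
have := @poly_incr_ge _ (prim r (beta p)) y y' 0; rewrite mul0r; apply => // t ty.
by rewrite primE test_ge0 //; lra.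
Qed.

(** The tent's interval, clamped to [[- r, r]] as [[y1, y2]], has length at most [2 rho]; the two
    tails add at most [4 r tau]. *)
Lemma prim_mass (p : 'I_M) : 4 * r * tau <= rho -> (prim r (beta p)).[r] <= 3 * rho.
Proof.
move: (r0) (rho0) (tau0) => r0' rho0' tau0'.
move=> rt; set z := grid r rho p; set B := prim r (beta p).
pose y1 := Num.min r (Num.max (- r) z); pose y2 := Num.min r (Num.max (- r) (z + 2 * rho)).
have clamp u : let y := Num.min r (Num.max (- r) u) in
    [\/ u <= - r /\ y = - r, - r <= u <= r /\ y = u | r <= u /\ y = r].
  rewrite /= maxEle minEle; case: (leP (- r) u) => h1.
    case: (leP r u) => h2; first by constructor 3.
    by constructor 2; split; lra.
  constructor 1; split; first by lra.
  by rewrite ifF //; apply/negbTE; rewrite -ltNge; move: r0; lra.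
have /= c1 := clamp z; have /= c2 := clamp (z + 2 * rho).
rewrite -/y1 in c1; rewrite -/y2 in c2; move: y1 y2 c1 c2 => y1 y2 c1 c2.
have [y1r [y2r [y12 y1y2]]] :
    - r <= y1 <= r /\ - r <= y2 <= r /\ y2 - y1 <= 2 * rho /\ y1 <= y2.
  by case: c1 => -[? ->]; case: c2 => -[? ->]; do 3?[split; first by lra]; lra.
have rt0 : 0 <= 2 * r * tau by rewrite !mulr_ge0 // ltW.
have h1 : B.[y1] <= 2 * r * tau.
  case: c1 => -[zr e]; first by rewrite e prim_left.
    by apply: prim_le_left => //; rewrite e.
  by apply: prim_le_left => //; rewrite e.
have hr : z + 2 * rho <= y2 -> B.[r] - B.[y2] <= 2 * r * tau.
  by move=> /(@prim_le_right p y2 y2r) /andP[].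
have h3 : B.[r] - B.[y2] <= 2 * r * tau.
  by case: c2 => -[zr e]; [apply: hr; rewrite e | apply: hr; rewrite e | rewrite e subrr].
have h2 : B.[y2] - B.[y1] <= 1 * (y2 - y1).
  by apply: poly_incr_le => // t ty; rewrite primE test_le1 //; lra.
by lra.
Qed.

End Properties.
End TestFamily.

(** * Comparing and averaging Jacobian integrals through boundary values *)

Lemma sum_telescope (V : zmodType) (S : nat -> V) n :
  \sum_(i < n) (S i - S i.+1) = S 0%N - S n.
Proof.
elim: n => [|n IH]; first by rewrite big_ord0 subrr.
by rewrite big_ord_recr /= IH addrA subrK.
Qed.

Section Estimates.
Import mpoly.
Context (R : archiRcfType) (d : nat).
Local Notation m := d.+1.
Implicit Types (u v w f h : 'I_m -> {mpoly R[m]}) (x : 'I_m -> R) (i j k : 'I_m).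
Local Notation lo := (1 / 4 : R).
Local Notation hi := (3 / 4 : R).
Local Notation J := (@jint R m lo hi).
Local Notation bd := (@on_boundary R m lo hi).

Lemma lo_lt_hi : lo < hi. Proof. lra. Qed.
Lemma hi_sub_lo : hi - lo <= 1. Proof. lra. Qed.
#[local] Hint Resolve lo_lt_hi hi_sub_lo : core.

Lemma jint_ext u v : u =1 v -> J u = J v.
Proof.
move=> uv; rewrite /jint; congr (cint _ _ (\det _)).
by apply/matrixP => k j; rewrite [LHS]mxE [RHS]mxE uv.
Qed.

Lemma jint_row_sub u v w i : u i = v i - w i ->
  (forall k, k != i -> u k = v k) -> (forall k, k != i -> u k = w k) ->
  J u = J v - J w.
Proof.
move=> ui uv uw; rewrite /jint -raddfB; congr cint.
have -> : \det (jac v) - \det (jac w) = 1 * \det (jac v) + (-1) * \det (jac w).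
  by rewrite mul1r mulN1r.
apply: (determinant_multilinear (i0 := i)).
- apply/rowP => j; rewrite scale1r scaleN1r [LHS]mxE [LHS]mxE ui mderivB.
  by rewrite mxE [X in _ = X + _]mxE [X in _ = X + _]mxE mxE [X in _ = _ - X]mxE [X in _ =
      _ - X]mxE.
- by apply/matrixP => k j; rewrite [LHS]mxE [LHS]mxE [RHS]mxE [RHS]mxE uv // eq_sym neq_lift.
- by apply/matrixP => k j; rewrite [LHS]mxE [LHS]mxE [RHS]mxE [RHS]mxE uw // eq_sym neq_lift.
Qed.

Definition bdconst : R := 2 * m%:R * m`!%:R.

Lemma bdconst_ge0 : 0 <= bdconst.
Proof. by rewrite /bdconst !mulr_ge0 ?ler0n. Qed.

Lemma sum_jint_bd (T : finType) (P : pred T) (U g : T -> 'I_m -> {mpoly R[m]}) f i (W L : R) :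
  (forall t k j, P t -> k != i -> (U t k)^`M(j) = g t k * (f k)^`M(j)) ->
  0 <= L -> (forall x k l, bd x -> k != i -> `|(f k)^`M(l).@[x]| <= L) ->
  0 <= W -> (forall x, bd x ->
     `|\sum_(t | P t) (U t i).@[x] * \prod_(k | k != i) (g t k).@[x]| <= W) ->
  `|\sum_(t | P t) J (U t)| <= bdconst * (W * L ^+ d).
Proof.
move=> h1 h2 h3 h4 h5; exact: (sum_jint_le lo_lt_hi hi_sub_lo h1 h2 h3 h4 h5).
Qed.

Section Telescope.
Context (T : finType) (P : pred T) (V V' : T -> 'I_m -> {mpoly R[m]}).

Definition mix (X : Type) (F F' : 'I_m -> X) (n : nat) k := if (k < n)%N then F' k else F k.

(** [V] is changed into [V'] one row at a time. By multilinearity each step is again a Jacobian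
    integral, with row [i] equal to [V i - V' i], and this is the row left undifferentiated on the
    boundary. *)
Lemma telescope_jint_le (g : 'I_m -> T -> 'I_m -> {mpoly R[m]})
    (f : 'I_m -> 'I_m -> {mpoly R[m]}) (W L : R) :
  0 <= L -> 0 <= W ->
  (forall i t k j, P t -> k != i ->
     (mix (V t) (V' t) i k)^`M(j) = g i t k * (f i k)^`M(j)) ->
  (forall i x k l, bd x -> k != i -> `|(f i k)^`M(l).@[x]| <= L) ->
  (forall i x, bd x -> `|\sum_(t | P t) ((V t i).@[x] - (V' t i).@[x]) *
     \prod_(k | k != i) (g i t k).@[x]| <= W) ->
  `|\sum_(t | P t) J (V t) - \sum_(t | P t) J (V' t)| <= m%:R * (bdconst * (W * L ^+ d)).
Proof.
move=> L0 W0 dV fL VW; pose S n := \sum_(t | P t) J (mix (V t) (V' t) n).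
have -> : \sum_(t | P t) J (V t) - \sum_(t | P t) J (V' t) = \sum_(i < m) (S i - S i.+1).
  rewrite sum_telescope.
  have -> : S 0%N = \sum_(t | P t) J (V t) by apply: eq_bigr => t _; exact: jint_ext.
  have -> // : S m = \sum_(t | P t) J (V' t).
  by apply: eq_bigr => t _; apply: jint_ext => k; rewrite /mix ltn_ord.
rewrite (le_trans (ler_norm_sum _ _ _)) //.
rewrite mulr_natl -[X in _ *+ X](card_ord m) -sumr_const; apply: ler_sum => i _.
pose U t k := if k == i then V t i - V' t i else mix (V t) (V' t) i k.
have -> : S i - S i.+1 = \sum_(t | P t) J (U t).
  rewrite /S -sumrB; apply: eq_bigr => t _; symmetry; apply: (@jint_row_sub _ _ _ i).
  - by rewrite /U /mix eqxx ltnn ltnS leqnn.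
  - by move=> k /negPf ki; rewrite /U ki.
  - move=> k ki; have e : (k < i.+1)%N = (k < i)%N by rewrite ltnS [RHS]ltn_neqAle ki.
    by rewrite /U (negPf ki) /mix e.
apply: (@sum_jint_bd _ _ _ (g i) (f i) i) => //.
- by move=> t k j Pt ki; rewrite /U (negPf ki) dV.
- by move=> x k l xb ki; apply: fL.
- move=> x xb; apply: le_trans (VW i x xb); rewrite le_eqVlt; apply/orP; left; apply/eqP.
  by congr `|_|; apply: eq_bigr => t _; rewrite /U eqxx mevalB.
Qed.

End Telescope.

Lemma telescope_jint1_le (V V' : 'I_m -> {mpoly R[m]}) (g : 'I_m -> 'I_m -> {mpoly R[m]})
    (f : 'I_m -> 'I_m -> {mpoly R[m]}) (W L : R) :
  0 <= L -> 0 <= W ->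
  (forall i k j, k != i -> (mix V V' i k)^`M(j) = g i k * (f i k)^`M(j)) ->
  (forall i x k l, bd x -> k != i -> `|(f i k)^`M(l).@[x]| <= L) ->
  (forall i x, bd x -> `|((V i).@[x] - (V' i).@[x]) * \prod_(k | k != i) (g i k).@[x]| <= W) ->
  `|J V - J V'| <= m%:R * (bdconst * (W * L ^+ d)).
Proof.
move=> L0 W0 dV fL VW.
have u1 (F : unit -> R) : \sum_(t | predT t) F t = F tt by rewrite (big_pred1 tt) //; case.
have u2 (F : unit -> R) : `|\sum_(t | predT t) F t| = `|F tt| by rewrite u1.
have -> : J V = \sum_(t : unit | predT t) J V by rewrite (u1 (fun _ => J V)).
have -> : J V' = \sum_(t : unit | predT t) J V' by rewrite (u1 (fun _ => J V')).
have h := @telescope_jint_le unit predT (fun _ => V) (fun _ => V') (fun i _ => g i) f W L L0 W0.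
apply: (h _ fL _) => [i _ k j _|i x xb]; first exact: dV.
by rewrite u2; exact: VW.
Qed.

Definition tmap f (B : 'I_m -> {poly R}) k : {mpoly R[m]} := pcomp (f k) (B k).

Lemma mderiv_tmap f B k j : (tmap f B k)^`M(j) = pcomp (f k) (B k)^`() * (f k)^`M(j).
Proof. exact: mderiv_pcomp. Qed.

Lemma mix_tmap f f' B B' n k :
  mix (tmap f B) (tmap f' B') n k = tmap (mix f f' n) (mix B B' n) k.
Proof. by rewrite /mix /tmap; case: ifP. Qed.

Section WithFamily.
Context (r rho tau : R) (r0 : 0 < r) (rho0 : 0 < rho) (tau0 : 0 < tau).
Context (M : nat) (beta : 'I_M -> {poly R}) (tf : test_family r rho tau beta).
Implicit Types (P : pred {ffun 'I_m -> 'I_M}) (p : {ffun 'I_m -> 'I_M}).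

Definition bprim p k : {poly R} := prim r (beta (p k)).

(* Integrating the partition of unity along the segment from [f' i x] to
   [f i x] gives the factor [Delta], whatever the number of cells in [P]. *)
Lemma compare_maps P f f' (Delta L : R) : 0 <= L -> 0 <= Delta ->
  (forall x k, bd x -> - r <= (f k).@[x] <= r) ->
  (forall x k, bd x -> - r <= (f' k).@[x] <= r) ->
  (forall x k l, bd x -> `|(f k)^`M(l).@[x]| <= L) ->
  (forall x k l, bd x -> `|(f' k)^`M(l).@[x]| <= L) ->
  (forall x k, bd x -> `|(f k).@[x] - (f' k).@[x]| <= Delta) ->
  `|\sum_(p | P p) J (tmap f (bprim p)) - \sum_(p | P p) J (tmap f' (bprim p))|
    <= m%:R * (bdconst * (Delta * L ^+ d)).
Proof.
move=> L0 D0 fr f'r fL f'L ff'.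
pose g i p k := pcomp (mix f f' i k) (beta (p k)).
apply: (@telescope_jint_le _ P _ _ g (fun i => mix f f' i)) => //.
- move=> i p k j _ ki; rewrite mix_tmap mderiv_tmap /g; congr (pcomp _ _ * _).
  by rewrite /mix /bprim; case: ifP => _; rewrite primE.
- by move=> i x k l xb ki; rewrite /mix; case: ifP => _; [apply: f'L | apply: fL].
move=> i x xb; pose y k := (mix f f' i k).@[x].
have yr k : - r <= y k <= r by rewrite /y /mix; case: ifP => _; [apply: f'r | apply: fr].
pose c p := \prod_(k | k != i) (beta (p k)).[y k].
pose q : {poly R} := \sum_(p | P p) c p *: bprim p i.
have qE t : q.[t] = \sum_(p | P p) c p * (bprim p i).[t].
  by rewrite horner_sum; apply: eq_bigr => p _; rewrite hornerZ.
have dq t : q^`().[t] = \sum_(p | P p) c p * (beta (p i)).[t].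
  rewrite raddf_sum horner_sum; apply: eq_bigr => p _ /=.
  by rewrite derivZ hornerZ primE.
have -> : \sum_(p | P p) ((tmap f (bprim p) i).@[x] - (tmap f' (bprim p) i).@[x]) *
    \prod_(k | k != i) (g i p k).@[x] = q.[(f i).@[x]] - q.[(f' i).@[x]].
  rewrite !qE -sumrB; apply: eq_bigr => p _; rewrite /tmap !meval_pcomp mulrC mulrBr.
  have -> : \prod_(k | k != i) (g i p k).@[x] = c p.
    by apply: eq_bigr => k _; rewrite /g meval_pcomp.
  by [].
rewrite -[leRHS]mul1r.
apply: le_trans (_ : 1 * `|(f i).@[x] - (f' i).@[x]| <= _); last by rewrite !mul1r ff'.
apply: (@poly_lip _ q (- r) r) => [||t tr]; [exact: f'r | exact: fr |].
pose z k := if k == i then t else y k.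
have -> : q^`().[t] = \sum_(p | P p) \prod_k (beta (p k)).[z k].
  rewrite dq; apply: eq_bigr => p _; rewrite [RHS](bigD1 i) //= mulrC /z eqxx; congr (_ * _).
  by apply: eq_bigr => k /negPf ->.
have zr k : - r <= z k <= r by rewrite /z; case: ifP.
rewrite ger0_norm; first exact: (test_sum_le1 tf).
exact: (test_sum_ge0 tf).
Qed.

(** Row [ord0] stays undifferentiated and is bounded by the mass [3 rho]; its shifts are merely
    counted and give [A]. In each of the other [d] rows the sum over shifts costs 2 instead of [A],
    which is the gain. *)
Lemma average_maps P f (A : nat) (L : R) : 0 <= L -> (0 < A)%N ->
  A%:R * tau <= 1 -> 4 * r * tau <= rho ->
  (forall x k a, bd x -> (a < A)%N -> - r <= (f k).@[x] + rho * a%:R <= r) ->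
  (forall x k l, bd x -> `|(f k)^`M(l).@[x]| <= L) ->
  `|\sum_(a : {ffun 'I_m -> 'I_A}) \sum_(p | P p)
       J (tmap (fun k => f k + (rho * (a k)%:R)%:MP) (bprim p))|
    <= bdconst * ((#|P|%:R * (3 * rho * A%:R * 2 ^+ d)) * L ^+ d).
Proof.
move=> L0 A0 At rt fr fL.
pose s (a : {ffun 'I_m -> 'I_A}) k : {mpoly R[m]} := f k + (rho * (a k)%:R)%:MP.
rewrite pair_big /=.
apply: (@sum_jint_bd _ _ (fun t => tmap (s t.1) (bprim t.2)) (fun t k => pcomp (s t.1 k)
    (beta (t.2 k))) f ord0) => //.
- move=> [a p] k j _ _ /=; rewrite mderiv_tmap /bprim primE mderivD mderivC addr0 //.
- by move=> x k l xb _; exact: fL.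
- by rewrite !mulr_ge0 ?ler0n ?exprn_ge0 // ltW.
move=> x xb; rewrite -(pair_big xpredT P (fun a p => (tmap (s a) (bprim p) ord0).@[x] *
  \prod_(k | k != ord0) (pcomp (s a k) (beta (p k))).@[x])) /= exchange_big /=.
have sE (a : {ffun 'I_m -> 'I_A}) k : (s a k).@[x] = (f k).@[x] + rho * (a k)%:R.
  by rewrite mevalD mevalC.
have sr a k : - r <= (s a k).@[x] <= r by rewrite sE fr.
have b0 a p k : 0 <= (pcomp (s a k) (beta (p k))).@[x].
  by rewrite meval_pcomp (test_ge0 tf).
rewrite (le_trans (ler_norm_sum _ _ _)) // -sum1_card natr_sum mulr_suml.
apply: ler_sum => p _; rewrite mul1r ger0_norm; last first.
  apply: sumr_ge0 => a _; rewrite mulr_ge0 ?prodr_ge0 //.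
  by rewrite /tmap meval_pcomp (prim_ge0 tf).
pose h k (l : 'I_A) := if k == ord0 then 1 else (beta (p k)).[(f k).@[x] + rho * l%:R].
have h0 k l : 0 <= h k l.
  by rewrite /h; case: ifP => _ //; rewrite (test_ge0 tf) // fr.
apply: (@le_trans _ _ (\sum_(a : {ffun 'I_m -> 'I_A}) 3 * rho * \prod_k h k (a k))).
  apply: ler_sum => a _; rewrite [X in _ <= _ * X](bigD1 ord0) //= {1}/h eqxx mul1r.
  have -> : \prod_(k | k != ord0) (pcomp (s a k) (beta (p k))).@[x] = \prod_(k | k != ord0)
      h k (a k).
    by apply: eq_bigr => k /negPf k0; rewrite /h k0 meval_pcomp sE.
  rewrite ler_wpM2r ?prodr_ge0 // /tmap meval_pcomp.
  apply: le_trans (prim_mass r0 rho0 tau0 tf (p ord0) rt).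
  apply: (prim_mono tf) => //; first by rewrite lexx andbT; move: (r0); lra.
  by case/andP: (sr a ord0).
rewrite -mulr_sumr -(bigA_distr_bigA h) -!mulrA !ler_pM2l // big_ord_recl.
rewrite {1}/h eqxx sumr_const card_ord ler_wpM2l ?ler0n //.
have -> : 2 ^+ d = \prod_(i < d) 2 :> R by rewrite prodr_const card_ord.
apply: ler_prod => k _; rewrite sumr_ge0 //= /h /=.
apply: (test_shift_sum rho0 tf) => // a aA; exact: fr.
Qed.

End WithFamily.
End Estimates.

Section Products.
Context (R : realDomainType) (I : finType).

Lemma prod_le_exp (Q : pred I) (a : I -> R) (G : R) n : 1 <= G -> (#|Q| <= n)%N ->
  (forall k, Q k -> 0 <= a k <= G) -> \prod_(k | Q k) a k <= G ^+ n.
Proof.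
move=> G1 Qn aG; apply: (@le_trans _ _ (\prod_(k | Q k) G)); first exact: ler_prod.
by rewrite prodr_const ler_weXn2l.
Qed.

Lemma prod_le_small (Q : pred I) (a : I -> R) (G s : R) n k0 :
  1 <= G -> (#|Q| <= n.+1)%N -> Q k0 ->
  (forall k, Q k -> 0 <= a k <= G) -> a k0 <= s -> \prod_(k | Q k) a k <= s * G ^+ n.
Proof.
move=> G1 Qn Qk0 aG as0; rewrite (bigD1 k0) //=.
have a0 : 0 <= a k0 by case/andP: (aG _ Qk0).
apply: ler_pM => //; first by apply: prodr_ge0 => k /andP[/aG /andP[]].
apply: (@prod_le_exp (fun k => Q k && (k != k0))) => //.
- by move: Qn; rewrite (cardD1x Qk0) add1n ltnS.
- by move=> k /andP[/aG].
Qed.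

End Products.

Lemma dist_via (R : realDomainType) (e a b s t : R) :
  0 <= e - a <= s -> 0 <= e - b <= t -> `|a - b| <= s + t.
Proof. by move=> h h'; rewrite ler_norml; apply/andP; split; lra. Qed.

Lemma dist_le (R : realDomainType) (a b s : R) : 0 <= a <= s -> 0 <= b <= s -> `|a - b| <= s.
Proof. by move=> h h'; rewrite ler_norml; apply/andP; split; lra. Qed.

(** * Cells away from the image of the boundary *)

Section FarCells.
Import mpoly.
Context (R : archiRcfType) (d : nat).
Local Notation m := d.+1.
Local Notation lo := (1 / 4 : R).
Local Notation hi := (3 / 4 : R).
Local Notation J := (@jint R m lo hi).
Local Notation bd := (@on_boundary R m lo hi).

Section ThinBump.
Context (r kappa tau y : R) (q : {poly R}).
Context (r0 : 0 < r) (kappa0 : 0 < kappa) (tau0 : 0 < tau) (tau4 : tau <= 1 / 4).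
Context (yl : - r <= y) (yu : y + 2 * kappa <= r).
Context (q0 : forall t, - r <= t <= r -> 0 <= q.[t]).
Context (qh : forall t, - r <= t <= r -> `|q.[t] - hat y kappa t| <= tau).

Lemma thin_le2 t : - r <= t <= r -> q.[t] <= 2.
Proof.
move=> /qh h; have := le_trans (ler_norm _) h; have := hat_le1 y kappa t.
by move: tau4; lra.
Qed.

Lemma thin_out t : - r <= t <= r -> t <= y \/ y + 2 * kappa <= t -> q.[t] <= tau.
Proof.
by move=> tr out; have := qh tr; rewrite hat_out // subr0; exact/le_trans/ler_norm.
Qed.

(** On the middle interval, of length [kappa], the tent is at least 1/2 and the error at most
    1/4. *)
Lemma thin_mass : kappa / 4 <= (prim r q).[r].
Proof.
move: (kappa0) (yl) (yu) => k0 yl' yu'.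
have h1 := @poly_incr_ge _ (prim r q) (- r) (y + kappa / 2) 0.
have h2 := @poly_incr_ge _ (prim r q) (y + kappa / 2) (y + 3 * kappa / 2) (1 / 4).
have h3 := @poly_incr_ge _ (prim r q) (y + 3 * kappa / 2) r 0.
have {}h1 : 0 * (y + kappa / 2 - - r) <= (prim r q).[y + kappa / 2] - (prim r q).[- r].
  by apply: h1 => [|t ht]; [lra | rewrite primE q0 //; lra].
have {}h3 : 0 * (r - (y + 3 * kappa / 2)) <= (prim r q).[r] - (prim r q).[y + 3 * kappa / 2].
  by apply: h3 => [|t ht]; [lra | rewrite primE q0 //; lra].
have {}h2 : 1 / 4 * (y + 3 * kappa / 2 - (y + kappa / 2))
    <= (prim r q).[y + 3 * kappa / 2] - (prim r q).[y + kappa / 2].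
  apply: h2 => [|t ht]; first by lra.
  rewrite primE; have tr : - r <= t <= r by lra.
  have := qh tr; rewrite ler_norml => /andP[h _].
  by have := @hat_mid _ y kappa t k0 ht; move: tau4; lra.
by rewrite prim_left in h1; lra.
Qed.

Lemma thin_incr s t : - r <= s -> s <= t -> t <= r -> 0 <= (prim r q).[t] - (prim r q).[s].
Proof.
move=> h1 h2 h3; have := @poly_incr_ge _ (prim r q) s t 0.
by rewrite mul0r; apply => // u hu; rewrite primE q0 //; lra.
Qed.

Lemma thin_incr_out s t : - r <= s -> s <= t -> t <= r -> t <= y \/ y + 2 * kappa <= s ->
  (prim r q).[t] - (prim r q).[s] <= 2 * r * tau.
Proof.
move: (r0) (tau0) => r0' tau0' h1 h2 h3 out.
apply: (@le_trans _ _ (tau * (t - s))); last by nra.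
apply: poly_incr_le => // u hu; rewrite primE; apply: thin_out; first by lra.
by case: out => h; [left | right]; lra.
Qed.

End ThinBump.
(* The test function of a cell [p] away from the image of the boundary can be
   squeezed, keeping its mass, into a small cube missed by the whole image. *)
Lemma far_cell (r rho kappa eps : R) M (f f' : 'I_m -> {mpoly R[m]})
    (p : {ffun 'I_m -> 'I_M}) (y : 'I_m -> R) :
  0 < r -> 0 < rho -> 0 < kappa -> 0 < eps ->
  (forall x k, in_cube lo hi x -> - r <= (f k).@[x] <= r) ->
  (forall x k, in_cube lo hi x -> - r <= (f' k).@[x] <= r) ->
  (forall x, bd x -> exists k,
     ((f k).@[x] <= grid r rho (p k) /\ (f' k).@[x] <= grid r rho (p k)) \/
     (grid r rho (p k) + 2 * rho <= (f k).@[x] /\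
      grid r rho (p k) + 2 * rho <= (f' k).@[x])) ->
  (forall k, [/\ grid r rho (p k) <= y k, y k + 2 * kappa <= grid r rho (p k) + 2 * rho,
     - r <= y k & y k + 2 * kappa <= r]) ->
  (forall x, in_cube lo hi x -> exists k,
     (f' k).@[x] <= y k \/ y k + 2 * kappa <= (f' k).@[x]) ->
  exists2 tau0, 0 < tau0 & forall tau beta, 0 < tau -> tau <= tau0 ->
    test_family r rho tau beta -> `|J (tmap f (bprim r beta p))| <= eps.
Proof.
move=> r0 rho0 kappa0 eps0 fr f'r far ybox miss.
pose L := \sum_k \sum_l (coefnorm (f k)^`M(l) + coefnorm (f' k)^`M(l)).
have L0 : 0 <= L by do 2!apply: sumr_ge0 => ? _; rewrite addr_ge0 ?coefnorm_ge0.
have Lkl k l : coefnorm (f k)^`M(l) + coefnorm (f' k)^`M(l) <= L.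
  rewrite /L (bigD1 k) //= (bigD1 l) //= -addrA lerDl addr_ge0 //; last first.
    by do 2!apply: sumr_ge0 => ? _; rewrite addr_ge0 ?coefnorm_ge0.
  by apply: sumr_ge0 => ? _; rewrite addr_ge0 ?coefnorm_ge0.
have cubeU x : in_cube lo hi x -> unit_cube x by move=> xQ i; have := xQ i; lra.
have fL x k l : in_cube lo hi x -> `|(f k)^`M(l).@[x]| <= L.
  move=> /cubeU xU; apply: le_trans (meval_le_coefnorm _ xU) _.
  by apply: le_trans (Lkl k l); rewrite lerDl coefnorm_ge0.
have f'L x k l : in_cube lo hi x -> `|(f' k)^`M(l).@[x]| <= L.
  move=> /cubeU xU; apply: le_trans (meval_le_coefnorm _ xU) _.
  by apply: le_trans (Lkl k l); rewrite lerDr coefnorm_ge0.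
(* A bound on the ratio of masses: at most [3 rho] for the cell, at least [kappa / 4] for the thin
   bump. [G] then bounds the derivatives of all the primitives in play. *)
pose C := 12 * rho / kappa.
have C0 : 0 < C by rewrite divr_gt0 // mulr_gt0.
pose G := 1 + 2 * C.
have G1 : 1 <= G by rewrite /G; lra.
have C1 : 0 <= 1 + C by rewrite addr_ge0 // ltW.
have G0 : 0 <= G by rewrite (le_trans ler01).
have Gd : 0 <= G ^+ d by rewrite exprn_ge0.
have r0' := ltW r0; have rho0' := ltW rho0.
pose W := (2 * r + 3 * rho) * (1 + C) * G ^+ d.
have W0 : 0 <= W by rewrite mulr_ge0 // mulr_ge0 // addr_ge0 // mulr_ge0.
pose K := m%:R * (bdconst R d * (W * L ^+ d)) + (1 + C) * G ^+ d * (m`!%:R * L ^+ m).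
have K0 : 0 <= K.
  apply: addr_ge0; rewrite !mulr_ge0 ?bdconst_ge0 ?exprn_ge0 //.
  by rewrite addr_ge0 ?mulr_ge0.
(* The three terms serve [thin_mass], [prim_mass] and the final bound [tau * K <= eps]. *)
pose tau0 := Num.min (1 / 4) (Num.min (rho / (4 * r)) (eps / (K + 1))).
have K10 : 0 < K + 1 by lra.
exists tau0; first by rewrite !lt_min !divr_gt0 ?mulr_gt0.
move=> tau beta tau_gt0; have tau0' := ltW tau_gt0; rewrite !le_min => /and3P[tau4 taur tauK] tf.
have {}taur : 4 * r * tau <= rho by move: taur; rewrite ler_pdivlMr ?mulr_gt0 // mulrC.
have {}tauK : tau * K <= eps.
  by move: tauK; rewrite ler_pdivlMr // => tauK; nra.
have [N N0 hN] := hat_poly r0 kappa0 tau_gt0.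
pose q k := bern1 r N (hat (y k) kappa).
have q0 k t : - r <= t <= r -> 0 <= (q k).[t] by move=> tr; apply: bern1_ge0 => // ?;
    exact: hat_ge0.
have qh k t : - r <= t <= r -> `|(q k).[t] - hat (y k) kappa t| <= tau by move=> ?; exact: hN.
have yl k : - r <= y k by case: (ybox k).
have yu k : y k + 2 * kappa <= r by case: (ybox k).
have yz k : grid r rho (p k) <= y k by case: (ybox k).
have yz' k : y k + 2 * kappa <= grid r rho (p k) + 2 * rho by case: (ybox k).
pose mu k := (prim r (q k)).[r].
have mu_ge k : kappa / 4 <= mu k by apply: (thin_mass kappa0 tau4 (yl k) (yu k) (q0 k) (qh k)).
have mu0 k : 0 < mu k by apply: lt_le_trans (mu_ge k); rewrite divr_gt0.
pose b := bprim r beta p.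
have rr : - r <= r <= r by lra.
have br0 k : 0 <= (b k).[r] by exact: (prim_ge0 tf (p k) rr).
have br3 k : (b k).[r] <= 3 * rho by exact: (prim_mass r0 rho0 tau_gt0 tf).
pose c k := (b k).[r] / mu k.
have c0 k : 0 <= c k by rewrite divr_ge0 // ltW.
have cC k : c k <= C.
  rewrite /c ler_pdivrMr //; apply: le_trans (br3 k) _.
  have -> : 3 * rho = C * (kappa / 4) by rewrite /C; field; rewrite gt_eqF.
  by rewrite ler_wpM2l // ltW.
(* With the masses matched, [b] and [b'] agree at both [- r] and [r]; hence they differ by O([tau])
   on either side of the cell, which is the only region the far coordinate visits. *)
pose b' k : {poly R} := c k *: prim r (q k).
have b'r k : (b' k).[r] = (b k).[r] by rewrite hornerZ /c divfK // gt_eqF.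
have b'E k : (b' k)^`() = c k *: q k by rewrite derivZ primE.
have bE k : (b k)^`() = beta (p k) by rewrite /b /bprim primE.
have db k t : - r <= t <= r -> 0 <= (b k)^`().[t] <= G.
  move=> tr; rewrite bE (test_ge0 tf) //=; apply: le_trans G1.
  exact: (test_le1 tf).
have db' k t : - r <= t <= r -> 0 <= (b' k)^`().[t] <= G.
  move=> tr; rewrite b'E hornerZ mulr_ge0 ?q0 //=.
  apply: (@le_trans _ _ (C * 2)); last by rewrite /G; lra.
  by apply: ler_pM => //; [exact: q0 | exact: (thin_le2 tau4 (qh k))].
have tauC : tau <= (1 + C) * tau by nra.
have db_out k t : - r <= t <= r ->
    t <= grid r rho (p k) \/ grid r rho (p k) + 2 * rho <= t -> (b k)^`().[t] <= (1 + C) * tau.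
  by move=> tr out; rewrite bE; apply: le_trans tauC; exact: (test_out rho0 tf).
have db'_out k t : - r <= t <= r ->
    t <= y k \/ y k + 2 * kappa <= t -> (b' k)^`().[t] <= (1 + C) * tau.
  move=> tr out; rewrite b'E hornerZ; apply: (@le_trans _ _ (C * tau)); last by nra.
  by apply: ler_pM => //; [exact: q0 | exact: (thin_out kappa0 (qh k) tr out)].
have bb k t : - r <= t <= r -> 0 <= (b k).[t] <= 3 * rho.
  move=> tr; rewrite (prim_ge0 tf) //=; apply: le_trans (br3 k).
  by apply: (prim_mono tf) => //; case/andP: tr.
have thin_inc k s t : - r <= s -> s <= t -> t <= r ->
    0 <= (b' k).[t] - (b' k).[s].
  move=> h1 h2 h3; rewrite !hornerZ -mulrBr mulr_ge0 //.
  exact: (thin_incr (q0 k) h1 h2 h3).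
have thin_inc_out k s t : - r <= s -> s <= t -> t <= r ->
    t <= y k \/ y k + 2 * kappa <= s -> (b' k).[t] - (b' k).[s] <= C * (2 * r * tau).
  move=> h1 h2 h3 out; rewrite !hornerZ -mulrBr; apply: ler_pM => //.
    exact: (thin_incr (q0 k) h1 h2 h3).
  exact: (thin_incr_out r0 kappa0 tau_gt0 (qh k) h1 h2 h3 out).
have b'l k : (b' k).[- r] = 0 by rewrite hornerZ prim_left mulr0.
have bb' k t : - r <= t <= r -> 0 <= (b' k).[t] <= 3 * rho.
  move=> /andP[tl tu].
  have := thin_inc k (- r) t (lexx _) tl tu; have := thin_inc k t r tl tu (lexx _).
  rewrite b'l subr0 b'r => h2 h1; apply/andP; split => //.
  by move: h2; rewrite subr_ge0 => h2; exact: le_trans h2 (br3 k).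
have rt0 : 0 <= 2 * r * tau by rewrite !mulr_ge0 // ltW.
have diff k s t : - r <= s <= r -> - r <= t <= r -> `|(b k).[s] - (b' k).[t]| <= 3 * rho.
  by move=> sr tr; apply: dist_le; [exact: bb | exact: bb'].
have diff_out k s t : - r <= s <= r -> - r <= t <= r ->
    (s <= grid r rho (p k) /\ t <= grid r rho (p k)) \/
    (grid r rho (p k) + 2 * rho <= s /\ grid r rho (p k) + 2 * rho <= t) ->
    `|(b k).[s] - (b' k).[t]| <= 2 * r * (1 + C) * tau.
  have -> : 2 * r * (1 + C) * tau = 2 * r * tau + C * (2 * r * tau) by ring.
  move=> sr tr; case/andP: (sr) => sl su; case/andP: (tr) => tl tu.
  case=> -[sz tz].
    rewrite -normrN opprD.
    apply: (@dist_via _ 0); rewrite sub0r opprK.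
      by rewrite (prim_le_left rho0 tau_gt0 tf sr sz) (prim_ge0 tf _ sr).
    have /andP[-> _] /= := bb' k t tr; rewrite -[(b' k).[t]]subr0 -(b'l k).
    by apply: thin_inc_out => //; left; exact: le_trans tz (yz k).
  apply: (@dist_via _ (b k).[r]); first exact: (prim_le_right rho0 tau_gt0 tf sr sz).
  rewrite -b'r (thin_inc k t r tl tu (lexx _)) /=.
  by apply: thin_inc_out => //; right; exact: le_trans (yz' k) tz.
have cardC (i : 'I_m) : #|[pred k | k != i]| = d by rewrite (cardC1 i) card_ord.
have step : `|J (tmap f b) - J (tmap f' b')| <= m%:R * (bdconst R d * (W * tau * L ^+ d)).
  pose g (i : 'I_m) k := pcomp (mix f f' i k) (mix b b' i k)^`().
  apply: (@telescope_jint1_le R d _ _ g (fun i => mix f f' i)) => //.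
  - by rewrite mulr_ge0 // ltW.
  - by move=> i k j _; rewrite mix_tmap mderiv_tmap.
  - by move=> i x k l [xQ _] _; rewrite /mix; case: ifP => _; [exact: f'L | exact: fL].
  move=> i x xb; have [xQ _] := xb.
  rewrite /tmap !meval_pcomp normrM.
  have gx k : (g i k).@[x] = (mix b b' i k)^`().[(mix f f' i k).@[x]].
    by rewrite meval_pcomp.
  have mr k : - r <= (mix f f' i k).@[x] <= r.
    by rewrite /mix; case: ifP => _; [exact: f'r | exact: fr].
  have g0 k : 0 <= (g i k).@[x] <= G.
    by rewrite gx; move: (mr k); rewrite /mix; case: ifP => _ h; [exact: db' | exact: db].
  have gprod0 : 0 <= \prod_(k | k != i) (g i k).@[x].
    by apply: prodr_ge0 => k _; case/andP: (g0 k).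
  rewrite [X in _ * X](ger0_norm gprod0).
  have [k0 far0] := far x xb.
  (* If the far coordinate is the row being exchanged, the difference of primitives is small;
     otherwise the derivative factor of row [k0] is. *)
  have [k0i|k0i] := eqVneq k0 i.
    rewrite k0i in far0.
    apply: (@le_trans _ _ (2 * r * (1 + C) * tau * G ^+ d)).
      apply: ler_pM => //; first by apply: diff_out => //; [exact: fr | exact: f'r].
      by apply: prod_le_exp => //; rewrite cardC.
    rewrite /W; have h : 0 <= 3 * rho * ((1 + C) * G ^+ d * tau).
      by rewrite !mulr_ge0.
    by rewrite -subr_ge0; apply: le_trans h _; rewrite le_eqVlt; apply/orP; left; apply/eqP; ring.
  have d0 : (0 < d)%N.
    rewrite -(cardC i); apply/card_gt0P; exists k0; exact: k0i.
  apply: (@le_trans _ _ (3 * rho * ((1 + C) * tau * G ^+ d.-1))).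
    apply: ler_pM => //; first by apply: diff; [exact: fr | exact: f'r].
    apply: (@prod_le_small _ _ _ _ _ _ _ k0) => //; first by rewrite cardC prednK.
    rewrite gx; move: (mr k0); rewrite /mix; case: ifP => _ h.
      apply: db'_out => //; case: far0 => -[h1 h2]; [left | right].
        exact: le_trans h2 (yz k0).
      exact: le_trans (yz' k0) h2.
    by apply: db_out => //; case: far0 => -[h1 h2]; [left | right].
  have hG : G ^+ d.-1 <= G ^+ d by rewrite ler_weXn2l // leq_pred.
  apply: (@le_trans _ _ (3 * rho * ((1 + C) * tau * G ^+ d))).
    by rewrite ler_wpM2l ?mulr_ge0 // ler_wpM2l // mulr_ge0.
  rewrite /W; have h : 0 <= 2 * r * ((1 + C) * G ^+ d * tau).
    by rewrite !mulr_ge0.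
  by rewrite -subr_ge0; apply: le_trans h _; rewrite le_eqVlt; apply/orP; left; apply/eqP; ring.
(* At every point of the cube some coordinate of [f'] avoids its thin bump, so one factor of the
   product of derivatives is O([tau]). *)
have last : `|J (tmap f' b')| <= (1 + C) * tau * G ^+ d * (m`!%:R * L ^+ m).
  rewrite /tmap jint_comp; apply: cint_le.
  - exact: lo_lt_hi.
  - exact: hi_sub_lo.
  - by rewrite !mulr_ge0 ?exprn_ge0.
  move=> x xQ; rewrite mevalM normrM.
  apply: ler_pM => //; last by apply: det_jac_le => // k l; exact: f'L.
  rewrite rmorph_prod /=; under eq_bigr => k _ do rewrite meval_pcomp.
  rewrite ger0_norm; last by apply: prodr_ge0 => k _; have /andP[] := db' k _ (f'r x k xQ).
  have [k0 miss0] := miss x xQ.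
  apply: (@prod_le_small _ _ _ _ _ _ _ k0) => //; first by rewrite card_ord.
    by move=> k _; apply: db'; exact: f'r.
  by apply: db'_out => //; exact: f'r.
apply: le_trans tauK.
have := ler_normD (J (tmap f b) - J (tmap f' b')) (J (tmap f' b')); rewrite subrK => h.
apply: le_trans h (le_trans (lerD step last) _).
by rewrite le_eqVlt; apply/orP; left; apply/eqP; rewrite /K; ring.
Qed.

End FarCells.

(** * Polynomial approximants of the ray maps *)

Lemma grad_arith (R : realFieldType) (c k n : R) : 1 <= k -> 1 <= n ->
  6 * c * k + 1 * (6 * c * k * 4 + 1 * 8) <= (30 * c + 8 * n) * k.
Proof.
move=> k1 n1; have : 1 <= n * k by apply: mulr_ege1.
have -> : (30 * c + 8 * n) * k = 30 * (c * k) + 8 * (n * k) by ring.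
by rewrite -[6 * c * k]mulrA; lra.
Qed.

Lemma close_arith (R : realFieldType) (c k n : R) : 0 <= c * k ->
  c * k + 1 * (c * k * 4 + 1 * (8 * (n * k))) <= (30 * c + 8 * n) * k.
Proof.
have -> : (30 * c + 8 * n) * k = 30 * (c * k) + 8 * (n * k) by ring.
lra.
Qed.

Section Approximants.
Import mpoly.
Context (R : archiRcfType) (d : nat).
Local Notation m := d.+1.
Local Notation lo := (1 / 4 : R).
Local Notation hi := (3 / 4 : R).
Local Notation bd := (@on_boundary R m lo hi).
Implicit Types (phi : ('I_m -> R) -> R) (x y z : 'I_m -> R) (t : R) (i j l : 'I_m) (k : nat).

(* [m ^ 2 - 1], the numerator of the critical exponent [1 - 1 / m ^ 2]. *)
Definition hexp : nat := (d * d.+2)%N.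

(* Taking [k ^ (m ^ 2) = 1 / |y - x|] gives back Hoelder continuity with
   exponent [hexp / m ^ 2]. *)
Definition hoelder_bd C phi := forall k x y, (0 < k)%N -> bd x -> unit_cube y ->
  `|phi y - phi x| <= C * ((k%:R ^+ hexp)^-1 + k%:R * l1dist y x).

Definition unif_cont phi := forall e, 0 < e -> exists2 K, 0 <= K &
  forall x y, unit_cube x -> unit_cube y -> `|phi y - phi x| <= e + K * l1dist y x.

Lemma bd_in_cube x : bd x -> in_cube lo hi x. Proof. by case. Qed.

Lemma cube_unit x : in_cube lo hi x -> unit_cube x.
Proof. by move=> xQ i; have := xQ i; lra. Qed.

Lemma bd_unit x : bd x -> unit_cube x.
Proof. by move/bd_in_cube/cube_unit. Qed.

(** The exponent is [m ^ 2]. At distance [1 / scale k] the two terms of [hoelder_bd] balance: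
    [k / scale k] equals [1 / k ^ hexp]. The approximant then has error of order [1 / k ^ hexp] and
    gradient of order [k]. *)
Definition scale k : nat := (k ^ hexp.+1)%N.

Lemma scale_gt0 k : (0 < k)%N -> (0 < scale k)%N.
Proof. by move=> k0; rewrite expn_gt0 k0. Qed.

Lemma bernop_bd_close C phi k x : 0 <= C -> hoelder_bd C phi -> (0 < k)%N -> bd x ->
  `|(bernop (scale k ^ 2) phi).@[x] - phi x| <= C * m.+1%:R * (k%:R ^+ hexp)^-1.
Proof.
move=> C0 h k0 xb; have k0' : k%:R != 0 :> R by rewrite pnatr_eq0 -lt0n.
have := @bernop_le R m (scale k) phi x (C * (k%:R ^+ hexp)^-1) (C * k%:R) (scale_gt0 k0)
    (bd_unit xb).
move=> /(_ _ _) /le_trans; apply.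
- by rewrite mulr_ge0 ?ler0n.
- by move=> y yU; rewrite -mulrA -mulrDr; exact: h.
rewrite le_eqVlt; apply/orP; left; apply/eqP.
rewrite /scale natrX exprS -natr1; field.
by rewrite k0' expf_neq0.
Qed.

Lemma bernop_bd_grad C phi k x j : 0 <= C -> hoelder_bd C phi -> (0 < k)%N -> bd x ->
  `|(bernop (scale k ^ 2) phi)^`M(j).@[x]| <= 6 * C * m.+1%:R * k%:R.
Proof.
move=> C0 h k0 xb; have k0' : k%:R != 0 :> R by rewrite pnatr_eq0 -lt0n.
have := @bernop_grad R m (scale k) phi x (C * (k%:R ^+ hexp)^-1) (C * k%:R) j (scale_gt0
    k0) (bd_unit xb).
move=> /(_ (bd_in_cube xb j) _ _ _) /le_trans; apply.
- by rewrite mulr_ge0 // invr_ge0 exprn_ge0 ?ler0n.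
- by rewrite mulr_ge0 ?ler0n.
- by move=> y yU; rewrite -mulrA -mulrDr; exact: h.
rewrite le_eqVlt; apply/orP; left; apply/eqP.
rewrite /scale natrX exprS -natr1; field.
by rewrite expf_neq0.
Qed.

Lemma bernop_unif phi e : unif_cont phi -> 0 < e -> exists s0, forall s, (s0 <= s)%N ->
  forall x, unit_cube x -> `|(bernop (s ^ 2) phi).@[x] - phi x| <= e.
Proof.
move=> uc e0; have [K K0 hK] := uc _ (divr_gt0 e0 (ltr0n _ 2)).
pose s0 := (Num.truncn (2 * K * m%:R / e)).+1.
exists s0 => s ss0 x xU.
have s0' : 0 < s%:R :> R by rewrite ltr0n (leq_trans _ ss0).
have := @bernop_le R m s phi x (e / 2) K; move=> /(_ _ xU K0 _) /le_trans; apply.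
- by rewrite -(ltr0n R).
- by move=> y yU; exact: hK.
suff : K * (m%:R / s%:R) <= e / 2 by lra.
rewrite mulrA ler_pdivrMr //.
have h0 : 0 <= 2 * K * m%:R / e by rewrite divr_ge0 ?mulr_ge0 ?ler0n // ltW.
have /andP[_ hs] := truncn_itv h0.
have {}hs : 2 * K * m%:R / e <= s%:R.
  by apply: le_trans (ltW hs) _; rewrite ler_nat.
by move: hs; rewrite ler_pdivrMr // => hs; lra.
Qed.

Section Maps.
Context (F : 'I_m -> ('I_m -> R) -> R) (lam : ('I_m -> R) -> R) (C M0 : R).
Context (C0 : 0 <= C) (M00 : 0 <= M0).
Context (Fh : forall i, hoelder_bd C (F i)) (lh : hoelder_bd C lam).
Context (Fu : forall i, unif_cont (F i)) (lu : unif_cont lam).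
Context (FM : forall i x, unit_cube x -> `|F i x| <= M0).
Context (l1 : forall x, unit_cube x -> 0 <= lam x <= 1).

(** The factor 8 sends [[1/4, 3/4]] to [[-2, 2]], so the boundary of the cube lands at norm at least
    2, well outside the unit ball. *)
Definition zvar i : {mpoly R[m]} := 8 *: ('X_i - (1 / 2)%:MP).

Definition ray_map t x i : R := F i x + t * (lam x * (8 * (x i - 1 / 2))).

(** In the [t] term only [lam] is approximated. The direction stays the exact [zvar], so the leading
    coefficient in [t] is the Jacobian integral of some [l * zvar], which can be bounded below. *)
Definition fapp s t i : {mpoly R[m]} :=
  bernop (s ^ 2) (F i) + t *: (bernop (s ^ 2) lam * zvar i).

Lemma zvar_eval x i : (zvar i).@[x] = 8 * (x i - 1 / 2).
Proof. by rewrite mevalZ mevalB mevalXU mevalC. Qed.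

Lemma fapp_eval s t i x : (fapp s t i).@[x] =
  (bernop (s ^ 2) (F i)).@[x] + t * ((bernop (s ^ 2) lam).@[x] * (8 * (x i - 1 / 2))).
Proof. by rewrite mevalD mevalZ mevalM zvar_eval. Qed.

Lemma zvar_le x i : unit_cube x -> `|8 * (x i - 1 / 2)| <= 4.
Proof. by move=> /(_ i) xi; rewrite ler_norml; apply/andP; split; lra. Qed.

Lemma fapp_close (e : R) s t x i : 0 <= t <= 1 -> unit_cube x ->
  `|(bernop (s ^ 2) (F i)).@[x] - F i x| <= e ->
  `|(bernop (s ^ 2) lam).@[x] - lam x| <= e ->
  `|(fapp s t i).@[x] - ray_map t x i| <= 5 * e.
Proof.
move=> t01 xU hF hl; rewrite fapp_eval /ray_map.
set a := _.@[x]; set b := _.@[x]; set z := 8 * _.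
have -> : a + t * (b * z) - (F i x + t * (lam x * z)) = (a - F i x) + t * ((b - lam x) * z).
  by ring.
have e0 : 0 <= e by apply: le_trans hF.
have z4 : `|z| <= 4 by exact: zvar_le.
have t1 : `|t| <= 1 by case/andP: t01 => ? ?; rewrite ger0_norm.
have h : `|t * ((b - lam x) * z)| <= 1 * (e * 4).
  rewrite normrM; apply: ler_pM => //; rewrite normrM; exact: ler_pM.
by apply: le_trans (ler_normD _ _) _; move: (lerD hF h); lra.
Qed.

Lemma fapp_bound s t x i : 0 <= t <= 1 -> unit_cube x -> `|(fapp s t i).@[x]| <= M0 + 4.
Proof.
move=> t01 xU; rewrite fapp_eval.
have hF := bernop_norm_le (s ^ 2) xU (FM i).
have hl : `|(bernop (s ^ 2) lam).@[x]| <= 1.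
  apply: bernop_norm_le => // y /l1 ?; rewrite ger0_norm; lra.
have z4 := zvar_le i xU.
have t1 : `|t| <= 1 by case/andP: t01 => ? ?; rewrite ger0_norm.
have h : `|t * ((bernop (s ^ 2) lam).@[x] * (8 * (x i - 1 / 2)))| <= 1 * (1 * 4).
  rewrite normrM; apply: ler_pM => //; rewrite normrM; exact: ler_pM.
by apply: le_trans (ler_normD _ _) _; move: (lerD hF h); lra.
Qed.

(** One constant for error, gradient and oscillation. The gradient dictates 30: [6 + 4 * 6], with 4
    bounding [zvar]. The other term pays for the slope 8 of [zvar]. *)
Definition Econst : R := 30 * (C * m.+1%:R) + 8 * m%:R.

Lemma Econst_ge : 8 <= Econst.
Proof.
have : 0 <= C * m.+1%:R by rewrite mulr_ge0 ?ler0n.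
have : 1 <= m%:R :> R by rewrite ler1n.
by rewrite /Econst; move: m%:R (C * _) => m' c; lra.
Qed.

Lemma fapp_bd_close k t x i : (0 < k)%N -> 0 <= t <= 1 -> bd x ->
  `|(fapp (scale k) t i).@[x] - ray_map t x i| <= Econst * (k%:R ^+ hexp)^-1.
Proof.
move=> k0 t01 xb.
apply: le_trans (fapp_close t01 (bd_unit xb) (bernop_bd_close C0 (Fh i) k0 xb)
  (bernop_bd_close C0 lh k0 xb)) _.
rewrite mulrA ler_wpM2r ?invr_ge0 ?exprn_ge0 ?ler0n // /Econst.
have : 0 <= C * m.+1%:R by rewrite mulr_ge0 ?ler0n.
move: (C * _) => c c0; have m0 : 0 <= m%:R :> R by rewrite ler0n.
by move: m%:R m0 => m' m0; lra.
Qed.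

Lemma fapp_bd_grad k t x i l : (0 < k)%N -> 0 <= t <= 1 -> bd x ->
  `|(fapp (scale k) t i)^`M(l).@[x]| <= Econst * k%:R.
Proof.
move=> k0 t01 xb; have xU := bd_unit xb.
rewrite mderivD mderivZ mderivM mevalD mevalZ mevalD !mevalM zvar_eval.
have gF := bernop_bd_grad l C0 (Fh i) k0 xb; have gl := bernop_bd_grad l C0 lh k0 xb.
have z4 := zvar_le i xU.
have hl : `|(bernop (scale k ^ 2) lam).@[x]| <= 1.
  by apply: bernop_norm_le => // y /l1 ?; rewrite ger0_norm; lra.
have hz : `|(zvar i)^`M(l).@[x]| <= 8.
  rewrite mderivZ mderivB mderivX mderivC subr0 mevalZ mevalZ mnm1E normrM ger0_norm //.
  case: eqP => [->|_]; last by rewrite mul0r normr0 mulr0.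
  have -> : (U_(l) - U_(l))%MM = 0%MM :> 'X_{1..m} by apply/mnmP => u; rewrite mnmBE subnn mnm0E.
  by rewrite mpolyX0 meval1 mulr1 normr1 mulr1.
set a := _.@[x] in gF *; set b := _.@[x] in gl *; set u := _.@[x] in hl *.
set v := _.@[x] in hz *; set z := 8 * _ in z4 *.
have k1 : 1 <= k%:R :> R by rewrite ler1n.
set c := C * m.+1%:R; have c0 : 0 <= c by rewrite mulr_ge0 ?ler0n.
have h1 : `|b * z| <= (6 * c * k%:R) * 4.
  by rewrite normrM; apply: ler_pM => //; rewrite /c mulrA.
have h2 : `|u * v| <= 1 * 8 by rewrite normrM; apply: ler_pM.
have t1 : `|t| <= 1 by case/andP: t01 => ? ?; rewrite ger0_norm.
have h3 : `|t * (b * z + u * v)| <= 1 * ((6 * c * k%:R) * 4 + 1 * 8).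
  rewrite normrM; apply: ler_pM => //.
  exact: le_trans (ler_normD _ _) (lerD h1 h2).
apply: le_trans (ler_normD _ _) _; apply: le_trans (lerD gF h3) _.
rewrite /Econst -/c -[6 * C * _]mulrA -/c.
by apply: grad_arith => //; rewrite ler1n.
Qed.

Lemma fapp_unif e : 0 < e -> exists s, forall t x i, 0 <= t <= 1 -> unit_cube x ->
  `|(fapp s t i).@[x] - ray_map t x i| <= e.
Proof.
move=> e0; have e5 : 0 < e / 5 by rewrite divr_gt0.
have [sl hsl] := bernop_unif lu e5.
have /fin_all_exists[sF hsF] : forall i, exists s0, forall s, (s0 <= s)%N ->
  forall x, unit_cube x -> `|(bernop (s ^ 2) (F i)).@[x] - F i x| <= e / 5.
  by move=> i; exact: bernop_unif.
pose s := maxn sl (\max_i sF i); exists s => t x i t01 xU.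
have -> : e = 5 * (e / 5) by field.
apply: fapp_close => //.
  by apply: hsF => //; rewrite leq_max; apply/orP; right; exact: leq_bigmax.
by apply: hsl => //; rewrite leq_max leqnn.
Qed.

Lemma ray_map_bd_close k t x y i : (0 < k)%N -> 0 <= t <= 1 -> bd x -> unit_cube y ->
  l1dist y x <= m%:R / (scale k)%:R ->
  `|ray_map t y i - ray_map t x i| <= Econst * (k%:R ^+ hexp)^-1.
Proof.
move=> k0 t01 xb yU yx; have k0' : 0 < k%:R :> R by rewrite ltr0n.
have k0n : k%:R != 0 :> R by rewrite gt_eqF.
set K := (k%:R ^+ hexp)^-1; have K0 : 0 <= K by rewrite invr_ge0 exprn_ge0 ?ler0n.
have hk phi : hoelder_bd C phi -> `|phi y - phi x| <= C * m.+1%:R * K.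
  move=> h; apply: le_trans (h k x y k0 xb yU) _; rewrite -mulrA ler_wpM2l //.
  rewrite -natr1 mulrDl mul1r [leRHS]addrC lerD2l.
  apply: le_trans (ler_wpM2l (ltW k0') yx) _.
  rewrite le_eqVlt; apply/orP; left; apply/eqP.
  by rewrite /K /scale natrX exprS; field; rewrite k0n expf_neq0.
have hF := hk _ (Fh i); have hl := hk _ lh.
rewrite /ray_map.
have -> : F i y + t * (lam y * (8 * (y i - 1 / 2))) - (F i x + t * (lam x * (8 * (x i - 1 / 2))))
  = (F i y - F i x) + t * ((lam y - lam x) * (8 * (y i - 1 / 2)) + lam x * (8 * (y i - x
      i))) by ring.
have z4 := zvar_le i yU.
have yxi : `|8 * (y i - x i)| <= 8 * (m%:R * K).
  rewrite normrM ger0_norm // ler_wpM2l //.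
  apply: le_trans (_ : l1dist y x <= _).
    by rewrite /l1dist (bigD1 i) //= lerDl sumr_ge0.
  apply: le_trans yx _; rewrite ler_wpM2l ?ler0n // /K lef_pV2 ?posrE ?exprn_gt0 ?ltr0n
      ?scale_gt0 //.
  by rewrite /scale natrX exprS ler_peMl ?exprn_ge0 ?ler0n // ler1n.
have lx : `|lam x| <= 1 by have := l1 (bd_unit xb); move=> ?; rewrite ger0_norm; lra.
have hs : `|(lam y - lam x) * (8 * (y i - 1 / 2)) + lam x * (8 * (y i - x i))|
    <= C * m.+1%:R * K * 4 + 1 * (8 * (m%:R * K)).
  by apply: le_trans (ler_normD _ _) _; rewrite !(normrM (_ - _)) (normrM (lam x)) lerD // ler_pM.
have t1 : `|t| <= 1 by case/andP: t01 => ? ?; rewrite ger0_norm.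
apply: le_trans (ler_normD _ _) _; rewrite normrM.
apply: (@le_trans _ _ (C * m.+1%:R * K + 1 * (C * m.+1%:R * K * 4 + 1 * (8 * (m%:R * K))))).
  by rewrite lerD // ler_pM.
have cK : 0 <= C * m.+1%:R * K by rewrite !mulr_ge0 ?ler0n.
exact: close_arith.
Qed.

End Maps.
End Approximants.

Lemma hexp_compare d : (2 * hexp d = (2 * d.+1 + 1) * d + d)%N.
Proof. by rewrite /hexp; lia. Qed.

(** Powers of [n] in the averaged bound: on the left [nshift], [kcoarse ^ d] and the number of near
    cells; on the right the inverse of the mesh and the [nshift ^ m] translates. The successor on
    the left is the factor [n] gained. *)
Lemma hexp_average d : (0 < d)%N ->
  (((2 * d + 1) * hexp d + 2 * d + (2 * d.+1 + 1) * ((hexp d).+1 * d)).+1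
   <= (2 * d.+1 + 1) * hexp d + (2 * d + 1) * hexp d * d.+1)%N.
Proof.
by move=> d0; rewrite /hexp; lia.
Qed.

(** * Cells near the image of the boundary *)

Section NearCells.
Import mpoly.
Context (R : archiRcfType) (d : nat).
Local Notation m := d.+1.
Local Notation lo := (1 / 4 : R).
Local Notation hi := (3 / 4 : R).
Local Notation J := (@jint R m lo hi).
Local Notation bd := (@on_boundary R m lo hi).
Local Notation X := (hexp d).
Implicit Types (x y : 'I_m -> R) (i j l : 'I_m) (k n s : nat).

(** Sample points on the faces: normal direction, side, and position in the other [d] coordinates.
    Their number grows like [s ^ d], which is what the count of near cells rests on. *)
Definition face_grid s := ('I_m * bool * {ffun 'I_d -> 'I_s.+1})%type.

Definition face_pt s (z : face_grid s) i : R :=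
  if unlift z.1.1 i is Some i' then lo + (z.2 i')%:R / (2 * s%:R)
  else if z.1.2 then hi else lo.

Lemma card_face_grid s : #|{: face_grid s}| = (m * 2 * s.+1 ^ d)%N.
Proof. by rewrite !card_prod card_ffun !card_ord card_bool. Qed.

Lemma face_pt_unit s z : (0 < s)%N -> unit_cube (@face_pt s z).
Proof.
move=> s0 i; have s0' : 0 < s%:R :> R by rewrite ltr0n.
rewrite /face_pt; case: unlift => [i'|]; last by case: ifP; lra.
have h1 : 0 <= (z.2 i')%:R / (2 * s%:R) :> R by rewrite divr_ge0 ?mulr_ge0 ?ler0n.
have h2 : (z.2 i')%:R / (2 * s%:R) <= 1 / 2 :> R.
  rewrite ler_pdivrMr ?mulr_gt0 //.
  have : (z.2 i')%:R <= s%:R :> R by rewrite ler_nat -ltnS.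
  lra.
lra.
Qed.

Lemma face_pt_dense s x : (0 < s)%N -> bd x ->
  exists z : face_grid s, l1dist (face_pt z) x <= m%:R / s%:R.
Proof.
move=> s0 [xQ [j xj]]; have s0' : 0 < s%:R :> R by rewrite ltr0n.
pose a := [ffun i' : 'I_d => inord (Num.truncn (2 * s%:R * (x (lift j i') - lo))) : 'I_s.+1].
exists (j, x j == hi, a).
have -> : m%:R / s%:R = \sum_(i < m) s%:R^-1 :> R by rewrite sumr_const card_ord mulr_natl.
apply: ler_sum => i _; rewrite /face_pt /=.
have inv0 : 0 < s%:R^-1 :> R by rewrite invr_gt0.
case: unliftP => [i' ->|->]; last first.
  case: eqP => [->|/eqP xh]; first by rewrite subrr normr0 ltW.
  by case: xj => e; rewrite e ?eqxx // in xh *; rewrite subrr normr0 ltW.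
have := xQ (lift j i'); set u := x _ => /andP[ul uh].
set v := 2 * s%:R * (u - lo).
have v0 : 0 <= v by rewrite /v !mulr_ge0 ?ler0n //; lra.
have /andP[tl tu] := truncn_itv v0.
have vs : v <= s%:R.
  have h : u - lo <= 1 / 2 by lra.
  have := ler_wpM2l (ltW s0') h; rewrite /v -mulrA; lra.
have ts : (Num.truncn v < s.+1)%N by rewrite ltnS -(ler_nat R) (le_trans tl).
rewrite ffunE inordK //.
have -> : u = lo + v / (2 * s%:R) by rewrite /v; field; rewrite gt_eqF.
rewrite opprD addrACA subrr add0r -mulrBl normrM [X in _ * X]ger0_norm; last first.
  by rewrite invr_ge0 mulr_ge0 ?ler0n.
rewrite invfM mulrA ler_piMl ?(ltW inv0) //.
rewrite distrC ger0_norm; first by rewrite -natr1 in tu; lra.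
by rewrite subr_ge0.
Qed.

Lemma card_window (r rho c : R) M : 0 < rho ->
  (#|[pred q : 'I_M | (`|c - grid r rho q| <= 4 * rho)%R]| <= 9)%N.
Proof.
move=> rho0; set S := [pred q | _].
have close (p q : 'I_M) : p \in S -> q \in S -> (q <= p + 8)%N.
  rewrite !inE => hp hq; rewrite -(ler_nat R) natrD.
  have h : `|grid r rho q - grid r rho p| <= 8 * rho.
    have -> : grid r rho q - grid r rho p = (c - grid r rho p) - (c - grid r rho q) by ring.
    by apply: le_trans (ler_normB _ _) _; lra.
  have := le_trans (ler_norm _) h; rewrite /grid.
  have -> : - r - rho + q%:R * rho - (- r - rho + p%:R * rho) = (q%:R - p%:R) * rho by ring.
  by rewrite ler_pM2r // lerBlDl.
have [q0 q0S|S0] := pickP S; last by rewrite (eq_card0 S0).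
have [p pS pmin] := @arg_minnP _ q0 (mem S) (@nat_of_ord M) q0S.
rewrite cardE -(size_map (@nat_of_ord M)) -(size_iota p 9).
apply: uniq_leq_size; first by rewrite map_inj_uniq ?enum_uniq //; exact: val_inj.
move=> _ /mapP[q + ->]; rewrite mem_enum mem_iota => qS.
by rewrite pmin //= addnS ltnS close.
Qed.

Section Near.
Context (E : R) (E1 : 1 <= E) (f : ('I_m -> R) -> 'I_m -> R) (fa : nat -> 'I_m -> {mpoly R[m]}).
Context (M1 : R).
Context (fclose : forall k x i, (0 < k)%N -> bd x -> `|(fa k i).@[x] - f x i| <= E * (k%:R
    ^+ X)^-1).
Context (fgrad : forall k x i l, (0 < k)%N -> bd x -> `|(fa k i)^`M(l).@[x]| <= E * k%:R).
Context (fmod : forall k x y i, (0 < k)%N -> bd x -> unit_cube y ->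
  l1dist y x <= m%:R / (scale d k)%:R -> `|f y i - f x i| <= E * (k%:R ^+ X)^-1).
Context (fbound : forall k x i, bd x -> `|(fa k i).@[x]| <= M1).

(** Write [kfine = kcoarse ^ s]. Passing to coarse translates costs about
    [kfine ^ d / kcoarse ^ hexp], small when [s < m + 1]; the averaged sum is about
    [kcoarse ^ (m^2 d) / kfine ^ (m d)], small when [s > m]. The exponents [2 m + 1] and 2 realise
    [s = m + 1/2]. *)
Definition kfine n : nat := (n ^ (2 * m + 1))%N.
Definition kcoarse n : nat := (n ^ 2)%N.
(** Chosen so that the longest shift equals the error of the coarse approximation: translating then
    costs no more than changing scale. *)
Definition nshift n : nat := (n ^ ((2 * d + 1) * X))%N.
Definition mesh n : R := E * ((kfine n)%:R ^+ X)^-1.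

(** Four mesh widths: one is lost between a sample point and a boundary point, one between [f] and
    its approximants, and the cell itself reaches two widths to the right of its grid point. *)
Definition near n r M (p : {ffun 'I_m -> 'I_M}) :=
  [exists z : face_grid (scale d (kfine n)),
     [forall i, `|f (face_pt z) i - grid r (mesh n) (p i)| <= 4 * mesh n]].

Lemma kfine_gt0 n : (0 < n)%N -> (0 < kfine n)%N.
Proof. by move=> n0; rewrite expn_gt0 n0. Qed.

Lemma kcoarse_gt0 n : (0 < n)%N -> (0 < kcoarse n)%N.
Proof. by move=> n0; rewrite expn_gt0 n0. Qed.

Lemma mesh_gt0 n : (0 < n)%N -> 0 < mesh n.
Proof.
move=> n0; rewrite mulr_gt0 ?invr_gt0 ?exprn_gt0 ?ltr0n ?kfine_gt0 //.
by apply: lt_le_trans E1.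
Qed.

Lemma not_near n r M (p : {ffun 'I_m -> 'I_M}) x : (0 < n)%N -> bd x -> ~~ near n r p ->
  exists i, f x i <= grid r (mesh n) (p i) - 3 * mesh n \/
            grid r (mesh n) (p i) + 3 * mesh n <= f x i.
Proof.
move=> n0 xb; have s0 : (0 < scale d (kfine n))%N by rewrite scale_gt0 ?kfine_gt0.
have [z zx] := face_pt_dense s0 xb.
rewrite negb_exists => /forallP /(_ z); rewrite negb_forall => /existsP[i].
rewrite -ltNge => hi_; exists i.
have := fmod i (kfine_gt0 n0) xb (face_pt_unit z s0) zx; rewrite -/(mesh n).
move: hi_; set g := grid _ _ _; set w := f _ i; set v := f x i.
rewrite ler_norml => h1 /andP[h2 h3].
have [h|h] := leP 0 (w - g); first by rewrite ger0_norm // in h1; right; lra.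
by rewrite ltr0_norm // in h1; left; lra.
Qed.

Lemma card_near n r M : (0 < n)%N ->
  (#|[pred p : {ffun 'I_m -> 'I_M} | near n r p]| <= m * 2 * (scale d (kfine n)).+1 ^ d * 9
      ^ m)%N.
Proof.
move=> n0; rewrite -card_face_grid -sum1_card.
pose N (p : {ffun 'I_m -> 'I_M}) (z : face_grid (scale d (kfine n))) :=
  [forall i, `|f (face_pt z) i - grid r (mesh n) (p i)| <= 4 * mesh n].
apply: (@leq_trans (\sum_(p : {ffun 'I_m -> 'I_M}) \sum_(z | N p z) 1)%N).
  rewrite big_mkcond /=; apply: leq_sum => p _; rewrite inE; case: ifP => //.
  by move=> /existsP[z zN]; rewrite (bigD1 z).
rewrite (exchange_big_dep xpredT) //= -sum_nat_const; apply: leq_sum => z _.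
rewrite sum1_card.
rewrite (eq_card (_ : _ =i family (fun i => [pred q : 'I_M |
    `|f (face_pt z) i - grid r (mesh n) q| <= 4 * mesh n]))); last first.
  by move=> p; rewrite inE; apply/forallP/familyP => h i; have := h i; rewrite inE.
rewrite card_family -[X in (9 ^ X)%N]card_ord -[X in (_ <= X)%N]prod_nat_const.
rewrite foldrE big_map -[X in (_ <= X)%N]big_enum /=.
by apply: leq_prod => i _; exact: card_window (mesh_gt0 n0).
Qed.

Definition near_const : R :=
  m%:R * (bdconst R d * (3 * E * E ^+ d)) +
  bdconst R d * ((2 * m%:R * 2 ^+ d * 9 ^+ m) * (3 * E * 2 ^+ d) * E ^+ d).

Lemma near_const_ge0 : 0 <= near_const.
Proof.
have E0 : 0 <= E by apply: le_trans E1.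
by rewrite addr_ge0 ?mulr_ge0 ?bdconst_ge0 ?exprn_ge0 ?ler0n.
Qed.

Lemma mesh_nshift n : (0 < n)%N ->
  mesh n * (nshift n)%:R = E * ((kcoarse n)%:R ^+ X)^-1.
Proof.
move=> n0; have e0 : n%:R != 0 :> R by rewrite pnatr_eq0 -lt0n.
rewrite /mesh /kfine /nshift /kcoarse !natrX -!exprM -mulrA; congr (_ * _).
apply: (mulIf (expf_neq0 (2 * X) e0)); rewrite mulVf ?expf_neq0 //.
rewrite -mulrA -exprD; apply: (mulfI (expf_neq0 ((2 * m + 1) * X) e0)).
rewrite mulrA mulfV ?expf_neq0 // mul1r mulr1; congr (_ ^+ _).
by rewrite -mulnDl; congr muln; lia.
Qed.

(** Only coarse maps are averaged, so the large number of cells meets the coarse gradient; the fine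
    gradient appears only in the comparison, whose cost is independent of that number. *)
Lemma near_cells n r tau M (beta : 'I_M -> {poly R}) :
  (0 < d)%N -> (0 < n)%N -> 0 < r -> M1 + E <= r -> 0 < tau ->
  (nshift n)%:R * tau <= 1 -> 4 * r * tau <= mesh n ->
  test_family r (mesh n) tau beta ->
  `|\sum_(p | near n r p) J (tmap (fa (kfine n)) (bprim r beta p))| <= near_const / n%:R.
Proof.
move=> d0 n0 r0 rM tau0 At rt tf.
have E0 : 0 < E by apply: lt_le_trans E1.
set A := nshift n; set rho := mesh n; have rho0 : 0 < rho by exact: mesh_gt0.
have A0 : (0 < A)%N by rewrite expn_gt0 n0.
have A0' : 0 < A%:R :> R by rewrite ltr0n.
set P := near n r (M := M).
have e0 : 0 < n%:R :> R by rewrite ltr0n.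
have e0n : n%:R != 0 :> R by rewrite gt_eqF.
have e1 : 1 <= n%:R :> R by rewrite ler1n.
have kf0 := kfine_gt0 n0; have kc0 := kcoarse_gt0 n0.
set kN := kfine n; set kJ := kcoarse n.
have kNJ : kJ%:R <= kN%:R :> R.
  by rewrite ler_nat /kJ /kN /kfine /kcoarse leq_pexp2l // addn1 leqW // leq_pmulr.
have invle (k : nat) : (0 < k)%N -> (k%:R ^+ X)^-1 <= 1 :> R.
  by move=> k0; rewrite invf_le1 ?exprn_ege1 ?exprn_gt0 ?ltr0n // ler1n.
set D := E * (kJ%:R ^+ X)^-1; have D0 : 0 <= D by rewrite mulr_ge0 ?invr_ge0 ?exprn_ge0
    ?ler0n // ltW.
have DE : D <= E by rewrite /D ler_piMr ?invle // ltW.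
have rhoD : rho <= D.
  rewrite /rho /mesh /D ler_wpM2l ?(ltW E0) // lef_pV2 ?posrE ?exprn_gt0 ?ltr0n //.
  by rewrite lerXn2r ?nnegrE ?ler0n.
have rhoA (a : nat) : (a < A)%N -> 0 <= rho * a%:R <= D.
  move=> aA; have -> : D = rho * A%:R by rewrite /rho mesh_nshift.
  rewrite mulr_ge0 ?ler0n ?(ltW rho0) //= ler_wpM2l ?(ltW rho0) //.
  by rewrite ler_nat ltnW.
have rng (k : nat) x i (v : R) : (0 < k)%N -> bd x -> 0 <= v <= D -> - r <= (fa k i).@[x] +
    v <= r.
  move=> k0 xb vD; have := fbound k i xb; rewrite ler_norml => /andP[h1 h2].
  by apply/andP; split; lra.
have rng0 (k : nat) x i : (0 < k)%N -> bd x -> - r <= (fa k i).@[x] <= r.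
  by move=> k0 xb; have := rng k x i 0 k0 xb; rewrite addr0; apply; rewrite lexx.
pose sh (a : {ffun 'I_m -> 'I_A}) i : {mpoly R[m]} := fa kJ i + (rho * (a i)%:R)%:MP.
have shE a i x : (sh a i).@[x] = (fa kJ i).@[x] + rho * (a i)%:R by rewrite mevalD mevalC.
set S := \sum_(p | P p) _.
have kN1 : 1 <= kN%:R :> R by rewrite ler1n.
have EkN : 0 <= E * kN%:R by rewrite mulr_ge0 ?ler0n // ltW.
pose T1 : R := m%:R * (bdconst R d * (3 * D * (E * kN%:R) ^+ d)).
have cmp a : `|S - \sum_(p | P p) J (tmap (sh a) (bprim r beta p))| <= T1.
  apply: (compare_maps tf) => //.
  - by rewrite mulr_ge0.
  - by move=> x i xb; exact: rng0.
  - by move=> x i xb; rewrite shE; apply: rng => //; exact: rhoA.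
  - by move=> x i l xb; exact: fgrad.
  - move=> x i l xb; rewrite mderivD mderivC addr0.
    apply: le_trans (@fgrad kJ x i l kc0 xb) _; by rewrite ler_wpM2l // ltW.
  move=> x i xb; rewrite shE.
  have h1 := @fclose kN x i kf0 xb; have h2 := @fclose kJ x i kc0 xb; rewrite -/rho -/(mesh
      n) in h1.
  rewrite -/D in h2; have /andP[h3 h4] := rhoA _ (ltn_ord (a i)).
  have -> : (fa kN i).@[x] - ((fa kJ i).@[x] + rho * (a i)%:R)
    = ((fa kN i).@[x] - f x i) - ((fa kJ i).@[x] - f x i) - rho * (a i)%:R by ring.
  apply: le_trans (ler_normB _ _) _; rewrite [X in _ + X]ger0_norm //.
  have h5 := ler_normB ((fa kN i).@[x] - f x i) ((fa kJ i).@[x] - f x i).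
  apply: (@le_trans _ _ ((rho + D) + D)); last by lra.
  by rewrite lerD // (le_trans h5) // lerD.
pose T2 : R := bdconst R d * ((#|[pred p | P p]|%:R * (3 * rho * A%:R * 2 ^+ d)) * (E *
    kJ%:R) ^+ d).
have avg : `|\sum_(a : {ffun 'I_m -> 'I_A}) \sum_(p | P p) J (tmap (sh a) (bprim r beta
    p))| <= T2.
  apply: (average_maps r0 rho0 tau0 tf) => //.
  - by rewrite mulr_ge0 ?ler0n // ltW.
  - by move=> x k a xb aA; apply: rng => //; exact: rhoA.
  - by move=> x k l xb; exact: fgrad.
have cardA : #|{: {ffun 'I_m -> 'I_A}}|%:R = A%:R ^+ m :> R.
  by rewrite card_ffun !card_ord natrX.
have Am0 : 0 < A%:R ^+ m :> R by rewrite exprn_gt0.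
(* The fine sum [S] does not depend on the shift, so it is [A ^ m] times itself: each copy is
   compared with its own coarse translate. *)
have main : A%:R ^+ m * `|S| <= A%:R ^+ m * T1 + T2.
  rewrite -[X in X * `|S| <= _](ger0_norm (ltW Am0)) -normrM.
  have -> : A%:R ^+ m * S = \sum_(a : {ffun 'I_m -> 'I_A}) (S - \sum_(p | P p) J (tmap (sh
      a) (bprim r beta p)))
    + \sum_(a : {ffun 'I_m -> 'I_A}) \sum_(p | P p) J (tmap (sh a) (bprim r beta p)).
    by rewrite sumrB subrK sumr_const -[RHS]mulr_natl cardA.
  apply: le_trans (ler_normD _ _) (lerD _ avg).
  apply: le_trans (ler_norm_sum _ _ _) _.
  have -> : A%:R ^+ m * T1 = \sum_(a : {ffun 'I_m -> 'I_A}) T1.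
    by rewrite sumr_const -[RHS]mulr_natl cardA.
  by apply: ler_sum => a _; exact: cmp.
have cP : #|[pred p | P p]|%:R <= 2 * m%:R * 2 ^+ d * 9 ^+ m * kN%:R ^+ (X.+1 * d) :> R.
  have h := card_near r M n0; rewrite -(ler_nat R) !natrM !natrX in h.
  apply: le_trans h _.
  have -> : 2 * m%:R * 2 ^+ d * 9 ^+ m * kN%:R ^+ (X.+1 * d) = m%:R * 2 * (2 * kN%:R ^+
      X.+1) ^+ d * 9 ^+ m :> R.
    by rewrite [(2 * _) ^+ d]exprMn exprM; ring.
  rewrite ler_wpM2r ?exprn_ge0 ?ler0n // ler_wpM2l ?mulr_ge0 ?ler0n //.
  rewrite lerXn2r ?nnegrE ?mulr_ge0 ?ler0n ?exprn_ge0 ?ler0n // -natr1 natrX.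
  have : 1 <= kN%:R ^+ X.+1 :> R by rewrite exprn_ege1.
  by rewrite /kN; lra.
have bd0 := bdconst_ge0 R d.
have hT1 : T1 <= m%:R * (bdconst R d * (3 * E * E ^+ d)) / n%:R.
  have -> : T1 = m%:R * (bdconst R d * (3 * E * E ^+ d)) * ((kJ%:R ^+ X)^-1 * kN%:R ^+ d).
    by rewrite /T1 /D exprMn; ring.
  rewrite ler_wpM2l //; first by rewrite !mulr_ge0 ?exprn_ge0 ?ler0n // ltW.
  rewrite /kJ /kN /kfine /kcoarse !natrX -!exprM ler_pdivrMl ?exprn_gt0 //.
  rewrite hexp_compare exprD -mulrA ler_peMr ?exprn_ge0 ?(ltW e0) //.
  by rewrite ler_pdivlMr // mul1r -[leLHS]expr1 ler_weXn2l.
have hT2 : T2 / A%:R ^+ m <=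
    bdconst R d * ((2 * m%:R * 2 ^+ d * 9 ^+ m) * (3 * E * 2 ^+ d) * E ^+ d) / n%:R.
  set c := #|_|%:R in cP; set G := 2 * m%:R * 2 ^+ d * 9 ^+ m in cP *.
  have -> : T2 = bdconst R d * (3 * rho * 2 ^+ d * E ^+ d * A%:R * kJ%:R ^+ d) * c.
    by rewrite /T2 -/c exprMn; ring.
  rewrite ler_pdivrMr //.
  have B0 : 0 <= bdconst R d * (3 * rho * 2 ^+ d * E ^+ d * A%:R * kJ%:R ^+ d).
    by rewrite !mulr_ge0 ?invr_ge0 ?exprn_ge0 ?ler0n ?(ltW E0) //.
  apply: le_trans (ler_wpM2l B0 cP) _.
  have -> : bdconst R d * (3 * rho * 2 ^+ d * E ^+ d * A%:R * kJ%:R ^+ d) * (G * kN%:R ^+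
      (X.+1 * d))
    = bdconst R d * (G * (3 * E * 2 ^+ d) * E ^+ d) *
      ((kN%:R ^+ X)^-1 * (A%:R * kJ%:R ^+ d * kN%:R ^+ (X.+1 * d))).
    by rewrite /rho /mesh -/kN; ring.
  rewrite -[leRHS]mulrA ler_wpM2l //.
    by rewrite /G !mulr_ge0 ?exprn_ge0 ?ler0n // ltW.
  rewrite ler_pdivrMl ?exprn_gt0 ?ltr0n // mulrCA ler_pdivlMl //.
  rewrite /A /kJ /kN /kfine /kcoarse /nshift !natrX -!exprM -!exprD -exprS.
  by rewrite ler_weXn2l // hexp_average.
rewrite -(ler_pM2l Am0); apply: le_trans main _.
have -> : T2 = A%:R ^+ m * (T2 / A%:R ^+ m) by rewrite mulrC divfK // gt_eqF.
by rewrite -mulrDr ler_pM2l // /near_const mulrDl lerD.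
Qed.

End Near.
End NearCells.

(** * The leading coefficient in t *)

Section LagrangeBound.
Context (R : realFieldType).
Implicit Types (q : {poly R}) (m : nat).

Lemma monic_prod_others m (t : 'I_m.+1 -> R) i :
  let l := \prod_(j | j != i) ('X - (t j)%:P) in (size l <= m.+1)%N /\ l`_m = 1.
Proof.
move=> l; have sz : size l = m.+1.
  by rewrite /l -(big_enum _ _ (predC1 i)) size_prod_XsubC -cardE cardC1 card_ord.
split; first by rewrite sz.
have /monicP : l \is monic by exact: monic_prod_XsubC.
by rewrite /lead_coef sz.
Qed.

(** By Lagrange interpolation the coefficient is the sum of the [q.[t i] / w i]: the difference [p]
    has too many roots for its size. *)
Lemma lead_coef_le m q (t : 'I_m.+1 -> R) (e delta : R) : 0 < delta ->
  (size q <= m.+1)%N -> (forall i j, i != j -> delta <= `|t i - t j|) ->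
  (forall i, `|q.[t i]| <= e) -> `|q`_m| <= m.+1%:R * (e / delta ^+ m).
Proof.
move=> d0 szq td qe.
pose l i := \prod_(j | j != i) ('X - (t j)%:P).
pose w i := \prod_(j | j != i) (t i - t j).
have w_ge i : delta ^+ m <= `|w i|.
  have -> : delta ^+ m = \prod_(j | j != i) delta.
    by rewrite prodr_const (cardC1 i) card_ord.
  rewrite normr_prod; apply: ler_prod => j ji; rewrite ltW //= td // eq_sym //.
have dm0 : 0 < delta ^+ m by rewrite exprn_gt0.
have w0 i : w i != 0 by rewrite -normr_gt0 (lt_le_trans dm0).
have tinj : injective t.
  move=> i j tij; apply/eqP; apply: contraT => /td; rewrite tij subrr normr0.
  by rewrite leNgt d0.
pose p := q - \sum_i (q.[t i] / w i) *: l i.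
have p0 : p = 0.
  apply/eqP; apply: contraT => pn0.
  have := @max_poly_roots _ p [seq t i | i <- enum 'I_m.+1] pn0.
  rewrite map_inj_uniq ?enum_uniq // size_map -cardE card_ord => /(_ _ isT) h.
  have : (m.+1 < size p)%N.
    apply: h; apply/allP => _ /mapP[i _ ->]; rewrite /root /p hornerD hornerN horner_sum.
    rewrite (bigD1 i) //= big1 ?addr0; last first.
      move=> j ji; rewrite hornerZ /l horner_prod (bigD1 i) 1?eq_sym //=.
      by rewrite hornerXsubC subrr mul0r mulr0.
    rewrite hornerZ /l horner_prod; under eq_bigr => j _ do rewrite hornerXsubC.
    by rewrite divfK ?w0 // subrr.
  rewrite ltnNge => /negP; case; rewrite (leq_trans (size_polyD _ _)) // geq_max szq.
  rewrite size_polyN (leq_trans (size_sum _ _ _)) //; apply/bigmax_leqP => i _.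
  by rewrite (leq_trans (size_scale_leq _ _)) //; have /= [hs _] := monic_prod_others t i.
have -> : q`_m = \sum_i q.[t i] / w i.
  move/eqP: p0; rewrite subr_eq0 => /eqP qE; rewrite [in LHS]qE coef_sum.
  by apply: eq_bigr => i _; rewrite coefZ; have /= [_ hm] := monic_prod_others t i; rewrite
      hm mulr1.
rewrite (le_trans (ler_norm_sum _ _ _)) //.
rewrite mulr_natl -[X in _ *+ X](card_ord m.+1) -sumr_const; apply: ler_sum => i _.
rewrite normrM normfV ler_pM ?invr_ge0 // lef_pV2 ?posrE ?normr_gt0 //.
Qed.

End LagrangeBound.

Section LinearPencil.
Context (T : comNzRingType).

Lemma prod_linear_coef (I : Type) (r : seq I) (a b : I -> T) :
  let P := \prod_(k <- r) ((a k)%:P + (b k)%:P * 'X) in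
  (size P <= (size r).+1)%N /\ P`_(size r) = \prod_(k <- r) b k.
Proof.
elim: r => [|k r [IH1 IH2]] /=; first by rewrite !big_nil size_poly1 coefC.
rewrite !big_cons; set P := \prod_(_ <- _) _ in IH1 IH2 *; split.
  rewrite mulrDl -mulrA [in X in _ + _ * X]mulrC mulrA.
  rewrite (leq_trans (size_polyD _ _)) // geq_max; apply/andP; split.
    by rewrite mul_polyC (leq_trans (size_scale_leq _ _)) // ltnW.
  rewrite -mulrA mul_polyC (leq_trans (size_scale_leq _ _)) //.
  by rewrite (leq_trans (size_polyMleq _ _)) // size_polyX addn2 /=.
rewrite mulrDl coefD mul_polyC coefZ nth_default // mulr0 add0r.
by rewrite -mulrA mul_polyC coefZ ['X * _]mulrC coefMX /= IH2.
Qed.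

Lemma det_pencil_coef m (A B : 'M[T]_m) :
  exists2 D : {poly T}, (size D <= m.+1)%N /\ D`_m = \det B &
    forall t, D.[t] = \det (A + t *: B).
Proof.
pose L (s : 'S_m) k : {poly T} := (A k (s k))%:P + (B k (s k))%:P * 'X.
exists (\sum_(s : 'S_m) (-1) ^+ s *: \prod_k L s k); last first.
  move=> t; rewrite horner_sum; apply: eq_bigr => s _; rewrite hornerZ horner_prod.
  congr (_ * _); apply: eq_bigr => k _.
  by rewrite /L hornerD hornerMX !hornerC !mxE mulrC.
have h s := prod_linear_coef (index_enum 'I_m) (fun k => A k (s k)) (fun k => B k (s k)).
have sz : size (index_enum 'I_m) = m by rewrite -[RHS](card_ord m) cardT enumT.
split.
  rewrite (leq_trans (size_sum _ _ _)) //; apply/bigmax_leqP => s _.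
  by rewrite (leq_trans (size_scale_leq _ _)) //; have [] := h s; rewrite sz.
rewrite coef_sum; apply: eq_bigr => s _; rewrite coefZ; congr (_ * _).
by have [_] := h s; rewrite sz.
Qed.

End LinearPencil.

Section LeadingTerm.
Import mpoly.
Context (R : archiRcfType) (d : nat).
Local Notation m := d.+1.
Local Notation lo := (1 / 4 : R).
Local Notation hi := (3 / 4 : R).
Local Notation J := (@jint R m lo hi).

Lemma jint_pencil (u v : 'I_m -> {mpoly R[m]}) :
  exists2 q : {poly R}, (size q <= m.+1)%N /\ q`_m = J v &
    forall t, q.[t] = J (fun i => u i + t *: v i).
Proof.
have [D [szD Dm] DE] := det_pencil_coef (jac u) (jac v).
exists (\poly_(e < m.+1) cint lo hi D`_e).
  by rewrite size_poly coef_poly ltnSn Dm.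
move=> t; rewrite horner_poly.
have -> : J (fun i => u i + t *: v i) = cint lo hi D.[t%:MP].
  rewrite /jint DE; congr (cint _ _ (\det _)); apply/matrixP => i j.
  by rewrite mxE [RHS]mxE [X in _ = X + _]mxE [X in _ = _ + X]mxE [X in _ = _ + _ * X]mxE
    mderivD mderivZ mul_mpolyC.
rewrite (horner_coef_wide _ szD) raddf_sum; apply: eq_bigr => e _ /=.
by rewrite -(rmorphXn (@mpolyC m R)) [D`_e * _]mulrC mul_mpolyC linearZ /= mulrC.
Qed.

Lemma jac_scaled (l : {mpoly R[m]}) :
  \det (jac (fun i => l * zvar R i)) * (8 *: l) =
  (8 *: l) ^+ m * (8 *: l + \sum_j l^`M(j) * zvar R j).
Proof.
pose x : 'cV[{mpoly R[m]}]_m := \col_i zvar R i.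
pose v : 'rV[{mpoly R[m]}]_m := \row_j l^`M(j).
have -> : jac (fun i => l * zvar R i) = (8 *: l)%:M + x *m v.
  apply/matrixP => i j; rewrite !mxE big_ord1 !mxE mderivM addrC mulrC; congr (_ + _).
  rewrite mderivZ mderivB mderivX mderivC subr0 mnm1E eq_sym.
  case: eqP => [->|_]; last by rewrite scale0r scaler0 mulr0 mulr0n.
  have -> : (U_(i) - U_(i))%MM = 0%MM :> 'X_{1..m} by apply/mnmP => u; rewrite mnmBE subnn mnm0E.
  by rewrite mpolyX0 scale1r mulr1n -scalerAr mulr1.
rewrite det_scale_rank1; congr (_ * (_ + _)); rewrite mxE.
by apply: eq_bigr => j _; rewrite !mxE.
Qed.

(** By [jac_scaled], [m] times the determinant is the divergence of the radial field
    [8 ^ d * l ^ m * zvar]. Since [zvar] is 2 and -2 on opposite faces, the outward flux is positive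
    on every face, so a lower bound on [l] suffices. *)
Lemma jint_scaled_ge (l : {mpoly R[m]}) (c : R) : 0 < c ->
  (forall x, unit_cube x -> c <= l.@[x]) ->
  (4 * c) ^+ m <= J (fun i => l * zvar R i).
Proof.
move=> c0 lc.
have l0 : 8 *: l != 0.
  have half : unit_cube ((fun=> 1 / 2) : 'I_m -> R) by move=> i; lra.
  apply: contraTneq (lc _ half) => e; rewrite -ltNge.
  have : (8 *: l).@[fun=> 1 / 2] = 0 by rewrite e meval0.
  by rewrite mevalZ => /eqP; rewrite mulf_eq0 pnatr_eq0 /= => /eqP ->.
have powD (e : nat) j : (l ^+ e.+1)^`M(j) = e.+1%:R * (l ^+ e * l^`M(j)).
  elim: e => [|e IH]; first by rewrite expr1 expr0 !mul1r.
  by rewrite exprS mderivM IH -[e.+2%:R]natr1 exprS; ring.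
pose k8 : {mpoly R[m]} := 8%:MP.
pose p j := zvar R j * (k8 ^+ d * l ^+ m).
have pD j : (p j)^`M(j) = k8 * (k8 ^+ d * l ^+ m) + m%:R * (k8 ^+ d * l ^+ d) * (l^`M(j) *
    zvar R j).
  rewrite /p mderivM; have -> : (zvar R j)^`M(j) = k8.
    rewrite mderivZ mderivB mderivX mderivC subr0 mnm1E eqxx scale1r.
    have -> : (U_(j) - U_(j))%MM = 0%MM :> 'X_{1..m} by apply/mnmP => u; rewrite mnmBE
        subnn mnm0E.
    by rewrite mpolyX0 -mul_mpolyC mulr1.
  rewrite mderivM powD /k8 -(rmorphXn (@mpolyC m R)) mderivC mul0r add0r; congr (_ + _); ring.
have detE : m%:R * \det (jac (fun i => l * zvar R i)) = \sum_j (p j)^`M(j).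
  (* [jac_scaled] carries an extra factor [8 *: l], cancelled here because it is a nonzero
     polynomial. *)
  apply: (mulIf l0); rewrite -mulrA jac_scaled.
  rewrite [in RHS](eq_bigr _ (fun j _ => pD j)) big_split /= sumr_const card_ord.
  rewrite -mulr_sumr -mul_mpolyC -/k8 -[k8 * _ *+ _]mulr_natl.
  move: (\sum_j _) (d.+1%:R : {mpoly R[m]}) => S m'; move: (k8) => k.
  by rewrite exprMn !exprS; ring.
have hJ : m%:R * J (fun i => l * zvar R i) = \sum_j cint lo hi (p j)^`M(j).
  rewrite -raddf_sum /= -detE /jint -mpolyC_nat mul_mpolyC linearZ //.
have m0 : 0 < m%:R :> R by rewrite ltr0n.
rewrite -(ler_pM2l m0) hJ.
have -> : m%:R * (4 * c) ^+ m = \sum_(j < m) (4 * c) ^+ m by rewrite sumr_const card_ord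
    mulr_natl.
apply: ler_sum => j _.
have [z zQ ->] := cint_deriv (lo_lt_hi R) (p j) j.
have [/bd_unit bl /bd_unit bh] := boundary_upd (lo_lt_hi R) j zQ.
have lm x : unit_cube x -> c ^+ m <= l.@[x] ^+ m.
  by move=> xU; rewrite lerXn2r ?nnegrE ?(ltW c0) ?lc // (le_trans (ltW c0)) ?lc.
have pE x : (p j).@[x] = 8 * (x j - 1 / 2) * (8 ^+ d * l.@[x] ^+ m).
  rewrite /p mevalM zvar_eval mevalM !(rmorphXn (meval x)) /= mevalC //.
have updj t : upd z j t j = t by rewrite /upd eqxx.
rewrite !pE !updj.
have -> : (4 * c) ^+ m = (hi - lo) ^+ m.-1 * (8 ^+ d * (4 * c ^+ m)).
  rewrite /= [RHS]mulrA -[in RHS]exprMn [in LHS]exprMn [in LHS]exprS; have -> : (hi - lo) *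
      8 = 4 by field.
  by ring.
rewrite ler_pM2l ?exprn_gt0 //; last by lra.
have h8 : 0 < 8 ^+ d :> R by rewrite exprn_gt0.
have -> : 8 * (hi - 1 / 2) * (8 ^+ d * l.@[upd z j hi] ^+ m) -
    8 * (lo - 1 / 2) * (8 ^+ d * l.@[upd z j lo] ^+ m)
  = 8 ^+ d * (2 * (l.@[upd z j hi] ^+ m + l.@[upd z j lo] ^+ m)) by field.
rewrite ler_pM2l //; have := lm _ bl; have := lm _ bh.
move: (c ^+ m) (_ ^+ m) (_ ^+ m) => x y w; lra.
Qed.
End LeadingTerm.

(** * Assembly: no holes at separated heights *)

Lemma fin_pos_lower (R : realFieldType) (T : finType) (g : T -> R) :
  (forall t, 0 < g t) -> exists2 e, 0 < e & forall t, e <= g t.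
Proof.
move=> g0; pose s := 1 + \sum_t (g t)^-1.
have s0 : 0 < s by rewrite ltr_wpDr // sumr_ge0 // => t _; rewrite invr_ge0 ltW.
exists s^-1; first by rewrite invr_gt0.
move=> t; rewrite invf_ple ?posrE // /s (bigD1 t) //= addrCA lerDl addr_ge0 //.
by rewrite sumr_ge0 // => u _; rewrite invr_ge0 ltW.
Qed.

Lemma far_arith (R : realDomainType) (u v w g rho : R) : 0 < rho ->
  `|u - w| <= rho -> `|v - w| <= rho -> w <= g - 3 * rho \/ g + 3 * rho <= w ->
  (u <= g /\ v <= g) \/ (g + 2 * rho <= u /\ g + 2 * rho <= v).
Proof.
move=> rho0; rewrite !ler_norml => /andP[? ?] /andP[? ?].
by case=> ?; [left | right]; split; lra.
Qed.

Lemma hole_arith (R : realFieldType) (u w y kappa : R) : `|u - w| <= kappa / 2 ->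
  w <= y \/ y + 2 * kappa <= w ->
  u <= y + kappa / 2 \/ y + kappa / 2 + 2 * (kappa / 2) <= u.
Proof. by rewrite ler_norml => /andP[? ?]; case=> ?; [left | right]; lra. Qed.

Lemma cell_arith (R : realFieldType) (r rho g y y0 kappa : R) : 0 < kappa ->
  g <= y0 -> y0 + rho <= g + 2 * rho -> - r <= y0 -> y0 + rho <= r ->
  y0 <= y -> y + 2 * kappa <= y0 + rho ->
  [/\ g <= y + kappa / 2, y + kappa / 2 + 2 * (kappa / 2) <= g + 2 * rho,
      - r <= y + kappa / 2 & y + kappa / 2 + 2 * (kappa / 2) <= r].
Proof. by move=> *; split; lra. Qed.

Section Core.
Import mpoly.
Context (R : archiRcfType) (d : nat).
Local Notation m := d.+1.
Local Notation lo := (1 / 4 : R).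
Local Notation hi := (3 / 4 : R).
Local Notation J := (@jint R m lo hi).
Local Notation bd := (@on_boundary R m lo hi).

Lemma jint_partition (r rho tau : R) M (beta : 'I_M -> {poly R}) (f : 'I_m -> {mpoly R[m]}) :
  test_family r rho tau beta ->
  J f = \sum_(p : {ffun 'I_m -> 'I_M}) J (tmap f (bprim r beta p)).
Proof.
case=> beta1 _ _.
have E (p : {ffun 'I_m -> 'I_M}) : J (tmap f (bprim r beta p)) =
    cint lo hi ((\prod_k pcomp (f k) (beta (p k))) * \det (jac f)).
  rewrite /tmap jint_comp; congr (cint _ _ (_ * _)).
  by apply: eq_bigr => k _; rewrite /bprim primE.
rewrite (eq_bigr _ (fun p _ => E p)) -raddf_sum -mulr_suml /=.
rewrite -(bigA_distr_bigA (fun k (l : 'I_M) => pcomp (f k) (beta l))) big1 ?mul1r //.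
by move=> k _; rewrite -raddf_sum beta1; exact: rmorph1.
Qed.

Section Family.
Context (F : 'I_m -> ('I_m -> R) -> R) (lam : ('I_m -> R) -> R) (C M0 c : R).
Context (d0 : (0 < d)%N) (C0 : 0 <= C) (M00 : 0 <= M0) (c0 : 0 < c).
Context (Fh : forall i, hoelder_bd C (F i)) (lh : hoelder_bd C lam).
Context (Fu : forall i, unif_cont (F i)) (lu : unif_cont lam).
Context (FM : forall i x, unit_cube x -> `|F i x| <= M0).
Context (lc : forall x, unit_cube x -> c <= lam x <= 1).

Let l1 x : unit_cube x -> 0 <= lam x <= 1.
Proof. by move=> /lc /andP[h ->]; rewrite (le_trans (ltW c0) h). Qed.

Local Notation E := (Econst d C).
Local Notation fm := (ray_map F lam).
Local Notation fA t := (fun k => fapp F lam (scale d k) t).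

Let E1 : 1 <= E.
Proof. by apply: le_trans (Econst_ge d C0); rewrite ler1n. Qed.

(* A cell is handled either because it is near the image of the boundary, or
   because [fm t] misses a small cube inside it. *)
Lemma cell_alternative n t (e r : R) K (p : {ffun 'I_m -> 'I_(K.*2.+1)}) :
  (0 < n)%N -> 0 <= t <= 1 -> 0 < e -> M0 + 4 <= r -> 0 < r ->
  r = K%:R * mesh d E n ->
  (forall y0 : 'I_m -> R, exists y kappa, [/\ 0 < kappa,
     forall k, y0 k <= y k /\ y k + 2 * kappa <= y0 k + mesh d E n &
     forall x, unit_cube x -> exists k, fm t x k <= y k \/ y k + 2 * kappa <= fm t x k]) ->
  exists2 tau0, 0 < tau0 & forall tau beta, 0 < tau -> tau <= tau0 ->
    test_family r (mesh d E n) tau beta ->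
    near E (fm t) n r p \/ `|J (tmap (fA t (kfine d n)) (bprim r beta p))| <= e.
Proof.
move=> n0 t01 e0 Mr r0 rK hole.
have [nearp|farp] := boolP (near E (fm t) n r p).
  by exists 1 => // *; left.
set rho := mesh d E n in rK hole *; have rho0 : 0 < rho := mesh_gt0 d E1 n0.
pose g k := grid r rho (p k).
(* The leftmost cells stick out of [[- r, r]]; clamping yields a cube of side [rho] inside both the
   cell and the range. *)
pose y0 k := Num.max (- r) (g k).
have [y [kappa [kappa0 yk miss]]] := hole y0.
have pK k : (p k)%:R <= K%:R * 2 :> R.
  by rewrite -natrM ler_nat muln2 -ltnS.
have rho_le : rho <= 2 * r.
  have K0 : (0 < K)%N by case: (K) rK r0 => // ->; rewrite mul0r ltxx.
  have K1 : 1 <= K%:R :> R by rewrite ler1n.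
  by rewrite rK; nra.
have gu k : g k <= r - rho.
  rewrite /g /grid; have := pK k; move: (p k)%:R => q qK.
  have : q * rho <= K%:R * 2 * rho by rewrite ler_pM2r.
  have -> : K%:R * 2 * rho = 2 * r by rewrite rK; ring.
  move: (q * rho) => v; lra.
have gl k : - r - rho <= g k by rewrite /g /grid lerDl mulr_ge0 ?ler0n // ltW.
have y0b k : [/\ g k <= y0 k, y0 k + rho <= g k + 2 * rho, - r <= y0 k & y0 k + rho <= r].
  have := gu k; have := gl k; rewrite /y0 maxEle; move: (g k) => u.
  by case: (leP (- r) u) => h h1 h2; split; lra.
(* The error [kappa / 2] keeps the inner half of the missed cube missed, and [rho] keeps the
   boundary values away from the cell. A second approximant is needed because the one at scale
   [kfine] is controlled on the boundary only. *)
pose e' := Num.min (kappa / 2) rho.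
have e'0 : 0 < e' by rewrite lt_min divr_gt0.
have [s hs] := fapp_unif Fu lu e'0.
have hs1 x i : unit_cube x -> `|(fapp F lam s t i).@[x] - fm t x i| <= kappa / 2.
  by move=> xU; apply: le_trans (hs t x i t01 xU) _; rewrite ge_min lexx.
have hs2 x i : unit_cube x -> `|(fapp F lam s t i).@[x] - fm t x i| <= rho.
  by move=> xU; apply: le_trans (hs t x i t01 xU) _; rewrite ge_min lexx orbT.
have rng s' x k : in_cube lo hi x -> - r <= (fapp F lam s' t k).@[x] <= r.
  move=> /cube_unit xU; have := fapp_bound FM l1 s' k t01 xU.
  by rewrite ler_norml => /andP[h1 h2]; lra.
pose y' k := y k + kappa / 2.
have far_x x : bd x -> exists i, fm t x i <= g i - 3 * rho \/ g i + 3 * rho <= fm t x i.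
  move=> xb; apply: (not_near (E := E) _ n0 xb farp) => // k x' z i k0 xb' zU zx.
  exact: (ray_map_bd_close C0 Fh lh l1).
have key := @far_cell R d r rho (kappa / 2) e _ (fA t (kfine d n))
    (fapp F lam s t) p y' r0 rho0 (divr_gt0 kappa0 (ltr0n R 2)) e0 (rng _) (rng _).
have [|||tau0 tau00 htau] := key.
- move=> x xb; have xU := bd_unit xb; have [i far_i] := far_x x xb; exists i.
  have h1 := fapp_bd_close C0 Fh lh i (kfine_gt0 d n0) t01 xb; rewrite -/(mesh d E n) -/rho in h1.
  have h2 := hs2 x i xU.
  exact: far_arith h1 h2 far_i.
- move=> k; have [a1 a2 a3 a4] := y0b k; have [b1 b2] := yk k.
  exact: cell_arith kappa0 a1 a2 a3 a4 b1 b2.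
- move=> x /cube_unit xU; have [k hk] := miss x xU; exists k.
  exact: hole_arith (hs1 x k xU) hk.
- by exists tau0 => // tau beta h1 h2 h3; right; exact: htau h3.
Qed.

(** [rho] precedes the heights and the holes, since the cover producing them is chosen according to
    [rho]. The intervals alternate with gaps of length [1 / (2 (m + 1))], which separates the
    heights. *)
Theorem kakeya_core : exists2 rho : R, 0 < rho & forall t : 'I_m.+1 -> R,
  (forall i : 'I_m.+1, (2 * i)%:R / (2 * m.+1)%:R <= t i <= (2 * i + 1)%:R / (2 * m.+1)%:R) ->
  ~ forall i (y0 : 'I_m -> R), exists y kappa, [/\ 0 < kappa,
      forall k, y0 k <= y k /\ y k + 2 * kappa <= y0 k + rho &
      forall x, unit_cube x -> exists k, fm (t i) x k <= y k \/ y k + 2 * kappa <= fm (t i) x k].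
Proof.
pose delta : R := (2 * m.+1)%:R^-1.
have delta0 : 0 < delta by rewrite invr_gt0 ltr0n.
pose Lg : R := m.+1%:R / delta ^+ m.
have Lg0 : 0 < Lg by rewrite divr_gt0 ?ltr0n ?exprn_gt0.
(* With this bound at all heights, interpolation makes the leading coefficient at most half of its
   lower bound. *)
pose e : R := (4 * c) ^+ m / (2 * Lg).
have c4 : 0 < (4 * c) ^+ m by rewrite exprn_gt0 // mulr_gt0.
have e0 : 0 < e by rewrite divr_gt0 // mulr_gt0.
have nc0 : 0 <= near_const d E := near_const_ge0 d E1.
pose n := (Num.truncn (near_const d E / (e / 2))).+1.
have n0 : (0 < n)%N by [].
have hn : near_const d E / n%:R <= e / 2.
  have e20 : 0 < e / 2 by rewrite divr_gt0.
  rewrite ler_pdivrMr ?ltr0n // mulrC -ler_pdivrMr //.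
  have h0 : 0 <= near_const d E / (e / 2) by rewrite divr_ge0 // ltW.
  by have /andP[_ /ltW] := truncn_itv h0.
have rho0 := mesh_gt0 d E1 n0; set rho := mesh d E n in rho0.
exists rho => // t ht hole.
have t01 i : 0 <= t i <= 1.
  have /andP[h1 h2] := ht i; rewrite (le_trans _ h1) ?divr_ge0 ?ler0n //=.
  apply: le_trans h2 _; rewrite ler_pdivrMr ?ltr0n // mul1r ler_nat.
  by rewrite addn1 ltn_pmul2l.
have E0 : 0 < E by apply: lt_le_trans E1.
(* [r] must exceed all the values in play and also be a whole multiple of [rho], so that the last
   grid point falls on [r]. *)
pose c1 := (Num.truncn ((M0 + 4 + E) / E)).+1.
pose K := (c1 * kfine d n ^ hexp d)%N.
pose r := K%:R * rho.
have rE : r = c1%:R * E.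
  rewrite /r /K /rho /mesh natrM natrX; field.
  by rewrite expf_neq0 // pnatr_eq0 -lt0n kfine_gt0.
have Mr : M0 + 4 + E <= r.
  have h0 : 0 <= (M0 + 4 + E) / E by rewrite divr_ge0 ?(ltW E0) // addr_ge0 ?(ltW E0) // addr_ge0.
  rewrite rE -ler_pdivrMr //.
  by have /andP[_ /ltW] := truncn_itv h0.
have r0 : 0 < r by apply: lt_le_trans Mr; move: M00; lra.
pose M := (K.*2.+1)%N.
have gM : r <= grid r rho M.
  rewrite /grid /M -natr1 -muln2 natrM mulrDl mul1r.
  have -> : - r - rho + (K%:R * 2 * rho + rho) = r by rewrite /r; ring.
  by [].
pose Np := #|{: {ffun 'I_m -> 'I_M}}|.
pose e2 : R := e / 2 / (Np%:R + 1).
have Np0 : 0 <= Np%:R :> R by rewrite ler0n.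
have e20 : 0 < e2 by rewrite divr_gt0 ?divr_gt0 //; lra.
have Mr' : M0 + 4 <= r by apply: le_trans Mr; rewrite lerDl ltW.
have alt (ip : 'I_m.+1 * {ffun 'I_m -> 'I_M}) := 
  cell_alternative ip.2 n0 (t01 ip.1) e20 Mr' r0 (erefl _) (hole ip.1).
(* Heights and cells are finite in number, so a single tolerance serves them all. *)
have [tau0 tau00 htau] := fin_all_exists2 alt.
have [tau1 tau10 htau1] := fin_pos_lower tau00.
have A0 : 0 < (nshift d n)%:R :> R by rewrite ltr0n expn_gt0.
pose tau : R := Num.min tau1 (Num.min (nshift d n)%:R^-1 (rho / (4 * r))).
have tau_gt0 : 0 < tau by rewrite !lt_min tau10 invr_gt0 A0 divr_gt0 // mulr_gt0.
have tauA : (nshift d n)%:R * tau <= 1.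
  by rewrite -ler_pdivlMl // mulr1 /tau !ge_min lexx orbT.
have taur : 4 * r * tau <= rho.
  have r40 : 0 < 4 * r by rewrite mulr_gt0.
  have h : tau <= rho / (4 * r) by rewrite /tau !ge_min lexx !orbT.
  by move: h; rewrite ler_pdivlMr // mulrC.
have [beta tf] := test_family_exists r0 rho0 tau_gt0 gM.
have small i : `|J (fA (t i) (kfine d n))| <= e.
  rewrite (jint_partition _ tf).
  rewrite (bigID (near E (fm (t i)) n r (M := M))) /=.
  have -> : e = e / 2 + e / 2 by field.
  apply: le_trans (ler_normD _ _) (lerD _ _).
    apply: le_trans hn.
    have fc k x j : (0 < k)%N -> bd x ->
        `|(fA (t i) k j).@[x] - fm (t i) x j| <= E * (k%:R ^+ hexp d)^-1.
      by move=> k0 xb; exact: (fapp_bd_close C0 Fh lh j k0 (t01 i) xb).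
    have fg k x j l : (0 < k)%N -> bd x -> `|(fA (t i) k j)^`M(l).@[x]| <= E * k%:R.
      by move=> k0 xb; exact: (fapp_bd_grad C0 Fh lh l1 j l k0 (t01 i) xb).
    have fb k x j : bd x -> `|(fA (t i) k j).@[x]| <= M0 + 4.
      by move=> xb; exact: (fapp_bound FM l1 _ j (t01 i) (bd_unit xb)).
    exact: (near_cells E1 fc fg fb d0 n0 r0 Mr tau_gt0 tauA taur tf).
  apply: le_trans (ler_norm_sum _ _ _) _.
  apply: (@le_trans _ _ (\sum_(p : {ffun 'I_m -> 'I_M}) e2)).
    rewrite big_mkcond /=; apply: ler_sum => p _; case: ifP => [np|_]; last exact: ltW.
    have := htau (i, p) tau beta tau_gt0 _ tf; case => //=.
      by apply: le_trans (htau1 _); rewrite /tau ge_min lexx.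
    by rewrite (negPf np).
  have -> : \sum_(p : {ffun 'I_m -> 'I_M}) e2 = Np%:R * e2 by rewrite sumr_const mulr_natl.
  have Np1 : 0 < Np%:R + 1 :> R by lra.
  rewrite /e2 mulrA ler_pdivrMr // mulrC ler_wpM2l //; last by lra.
  by rewrite divr_ge0 // ltW.
have [q [szq qm] qE] := jint_pencil
  (fun i => bernop (scale d (kfine d n) ^ 2) (F i))
  (fun i => bernop (scale d (kfine d n) ^ 2) lam * zvar R i).
have top : (4 * c) ^+ m <= q`_m.
  rewrite qm; apply: jint_scaled_ge => // x xU; apply: bernop_ge => // y /lc /andP[] //.
have sep (i j : 'I_m.+1) : i != j -> delta <= `|t i - t j|.
  wlog ij : i j / (i < j)%N => [hw|_].
    move=> ij; case: (ltngtP i j) => h; first exact: hw.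
      by rewrite distrC; apply: hw => //; rewrite eq_sym.
    by move/val_inj: h ij => ->; rewrite eqxx.
  have /andP[_ h1] := ht i; have /andP[h2 _] := ht j.
  rewrite distrC; apply: le_trans (ler_norm _).
  apply: le_trans (lerB h2 h1); rewrite -mulrBl ler_peMl ?(ltW delta0) //.
  by rewrite lerBrDl natr1 ler_nat addn1 -[(2 * i).+2]add2n -mulnS leq_mul2l.
have h := lead_coef_le delta0 szq sep.
have {}h : `|q`_m| <= m.+1%:R * (e / delta ^+ m).
  apply: h => i; rewrite qE; apply: le_trans (small i).
  by rewrite le_eqVlt; apply/orP; left; apply/eqP; congr `|_|; exact: jint_ext.
have : (4 * c) ^+ m <= (4 * c) ^+ m / 2.
  apply: le_trans top (le_trans (ler_norm _) (le_trans h _)).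
  rewrite le_eqVlt; apply/orP; left; apply/eqP.
  have -> : m.+1%:R * (e / delta ^+ m) = Lg * e by rewrite /Lg; ring.
  by rewrite /e; field; rewrite gt_eqF.
by move: c4; move: (_ ^+ m) => u u0; rewrite leNgt => /negP; apply; lra.
Qed.

End Family.
End Core.

Require Import Defs.
From mathcomp Require Import all_classical all_reals all_analysis.
From mathcomp Require Import measurable_realfun.
Import Order.TTheory GRing.Theory Num.Theory.
Import numFieldNormedType.Exports.
Local Open Scope classical_set_scope.
Local Open Scope ring_scope.

(** * Slices of null sets *)

Section Slicing.
Context (R : realType).

Lemma slice_integral (l u w a b : R) : a < b -> 0 <= w ->
  (\int[@lebesgue_measure R]_(t in `[a, b]) (w * \1_(`[l, u]) t)%:E
   <= (w * Num.max 0 (u - l))%:E)%E.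
Proof.
move=> ab w0; under eq_integral do rewrite EFinM.
rewrite ge0_integralZl//; last first.
  by apply/measurable_EFinP; exact: measurable_indic.
rewrite EFinM lee_wpmul2l ?lee_fin// integral_indic//.
apply: (@le_trans _ _ (@lebesgue_measure R `[l, u]%classic)).
  by apply: le_measure; rewrite ?inE//; exact: measurableI.
rewrite lebesgue_measure_itv/= lte_fin; case: ifPn => lu.
  by rewrite -EFinD lee_fin le_max lexx orbT.
by rewrite lee_fin le_max lexx.
Qed.

(* If every slice had mass at least [s], integrating over [a, b] would
   contradict the bound on the total mass. *)
Lemma exists_slice (l u w : nat -> R) (a b s : R) : a < b -> 0 <= s ->
  (forall k, 0 <= w k) ->
  (\sum_(k <oo) (w k * Num.max 0 (u k - l k))%:E < (s * (b - a))%:E)%E ->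
  exists2 t, a <= t <= b & (\sum_(k <oo) (w k * \1_(`[l k, u k]) t)%:E < s%:E)%E.
Proof.
move=> ab s0 w0 hsum; apply: contrapT => /forall2NP h.
pose g k t : \bar R := (w k * \1_(`[l k, u k]) t)%:E.
have g0 k t : (0 <= g k t)%E by rewrite lee_fin mulr_ge0.
have mg k : measurable_fun `[a, b] (g k).
  apply/measurable_EFinP; exact: measurable_funM.
have mG : measurable_fun `[a, b] (fun t => \sum_(k <oo) g k t)%E.
  by apply: (@ge0_emeasurable_sum _ _ _ _ g xpredT).
have int_le : ((s * (b - a))%:E <= \int[@lebesgue_measure R]_(t in `[a, b]) (\sum_(k <oo) g
    k t))%E.
  have -> : (s * (b - a))%:E = (\int[@lebesgue_measure R]_(t in `[a, b]) (cst s%:E) t)%E.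
    by rewrite integral_cst//= lebesgue_measure_itv/= lte_fin ab EFinM EFinB.
  apply: ge0_le_integral => //.
  move=> t /= tab; rewrite leNgt; apply/negP => lts.
  by case: (h t) => [|/(_ lts)//]; rewrite in_itv/= in tab; rewrite tab.
move: hsum; apply/negP; rewrite -leNgt; apply: le_trans int_le _.
rewrite integral_nneseries//.
by apply: lee_nneseries => [k _ _|k _]; [apply: integral_ge0 | exact: slice_integral].
Qed.

(* Boxes of total volume smaller than that of a cube of side [h] leave a point
   of the cube uncovered; [D] records the boxes met by the slices fixed so far. *)
Lemma uncovered_point (m : nat) (h : R) (A : 'I_m -> R) (D : nat -> bool)
    (l u : nat -> 'I_m -> R) : 0 < h ->
  (\sum_(k <oo) ((D k)%:R * \prod_i Num.max 0 (u k i - l k i))%:E < (h ^+ m)%:E)%E ->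
  exists2 y : 'I_m -> R, (forall i, A i <= y i <= A i + h) &
    forall k, D k -> exists i, ~~ (l k i <= y i <= u k i).
Proof.
move=> h0; elim: m A D l u => [|m IH] A D l u hsum.
  (* In dimension 0 a box has volume 1, the empty product, so a single recorded box would already
     exhaust the bound [h ^ 0]. *)
  exists (fun=> 0) => [[]//|k Dk]; exfalso; move: hsum; apply/negP; rewrite -leNgt.
  apply: (@le_trans _ _ ((D k)%:R * \prod_(i < 0) Num.max 0 (u k i - l k i))%:E).
    by rewrite Dk big_ord0 mulr1.
  pose g j := ((D j)%:R * \prod_(i < 0) Num.max 0 (u j i - l j i))%:E.
  have g0 j : predT j -> (0 <= g j)%E by rewrite lee_fin big_ord0 mulr1 ler0n.
  rewrite (nneseriesD1 (n := k) g0)// leeDl// nneseries_ge0// => j _ _.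
  exact: g0.
pose w k : R := (D k)%:R * \prod_(i < m) Num.max 0 (u k (lift ord0 i) - l k (lift ord0 i)).
have w0 k : 0 <= w k.
  by rewrite mulr_ge0 ?ler0n// prodr_ge0// => i _; rewrite le_max lexx.
have Ah : A ord0 < A ord0 + h by rewrite ltrDl.
have [|t tA ht] := @exists_slice (l ^~ ord0) (u ^~ ord0) w _ _ (h ^+ m) Ah (exprn_ge0 _
    (ltW h0)) w0.
  rewrite addrAC subrr add0r -exprSr; move: hsum; congr (_ < _)%E.
  apply: eq_eseriesr => k _; congr (_%:E).
  by rewrite /w big_ord_recl mulrCA mulrC.
pose D' k := D k && (l k ord0 <= t <= u k ord0).
have [|y yA hy] := IH (fun i => A (lift ord0 i)) D' (fun k i => l k (lift ord0 i)) (fun k i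
    => u k (lift ord0 i)).
  move: ht; congr (_ < _)%E; apply: eq_eseriesr => k _; congr (_%:E).
  rewrite /w /D' indicE mem_setE in_itv/= mulrAC -natrM mulnb//.
exists (fun i => if unlift ord0 i is Some j then y j else t).
  by move=> i; case: unliftP => [j ->|->]; [exact: yA | exact: tA].
move=> k Dk; have [tk|tk] := boolP (l k ord0 <= t <= u k ord0).
  have [|j hj] := hy k; first by rewrite /D' Dk.
  by exists (lift ord0 j); rewrite liftK.
by exists ord0; rewrite unlift_none.
Qed.

End Slicing.

(** * Compactness of the Kakeya set and of its slices *)

Section Topology.
Context (R : realType).

Lemma cvg_rV (m : nat) (T : Type) (G : set_system T) (FG : Filter G)
    (f : T -> 'rV[R]_m) (l : 'rV[R]_m) :
  (forall i, (fun x => f x 0 i) @ G --> l 0 i) -> f @ G --> l.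
Proof.
move=> h; apply/cvg_ballP => e e0.
have : \forall x \near G, forall i, ball (l 0 i) e (f x 0 i).
  by apply: filter_forall => i; apply: cvg_ball.
by apply: filterS => x hx; split=> // i j; rewrite ord1; apply: hx.
Qed.

Lemma unit_ballE (m : nat) : @unit_ball R m = [set v | \sum_(i < m) v 0 i ^+ 2 <= 1].
Proof.
have E (v : 'rV[R]_m) : (enorm v <= 1) = (\sum_(i < m) v 0 i ^+ 2 <= 1).
  by rewrite /enorm -[X in (_ <= X) = _]sqrtr1 ler_sqrt ?ler01.
by apply/seteqP; split=> v; rewrite /unit_ball/= E.
Qed.

Lemma unit_ball_coord (m : nat) (v : 'rV[R]_m) i : unit_ball v -> -1 <= v 0 i <= 1.
Proof.
rewrite unit_ballE/= => h; rewrite -ler_norml -ler_sqr ?nnegrE// expr1n real_normK ?num_real//.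
apply: le_trans h.
by rewrite (bigD1 i)//= lerDl sumr_ge0// => j _; exact: sqr_ge0.
Qed.

Lemma compact_unit_ball (m : nat) : compact (@unit_ball R m).
Proof.
apply: (@subclosed_compact _ _ 
  [set v : 'rV[R]_m | forall i, v ord0 i \in `[-1, 1]]).
- rewrite unit_ballE.
  apply: (@preimage_closed _ _ (fun v : 'rV[R]_m => \sum_(i < m) v 0 i ^+ 2)
    [set x : R | x <= 1]); last exact: closed_le.
  suff H (s : seq 'I_m) : continuous (fun v : 'rV[R]_m => \sum_(i <- s) v 0 i ^+ 2).
    by move=> v _; exact: H.
  elim: s => [|i s IH].
    rewrite (_ : (fun v : 'rV[R]_m => _) = cst 0); first exact: cst_continuous.
    by apply/funext => v; rewrite big_nil.
  rewrite (_ : (fun v : 'rV[R]_m => _) =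
    (fun v => v 0 i * v 0 i + \sum_(j <- s) v 0 j ^+ 2)); last first.
    by apply/funext => v; rewrite big_cons expr2.
  move=> v; have ci : (fun w : 'rV[R]_m => w 0 i) @ v --> v 0 i by exact: coord_continuous.
  exact: (cvgD (cvgM ci ci) (IH v)).
- by apply: (@rV_compact R m (fun=> `[-1 : R, 1]%classic)) => _; exact: segment_compact.
- by move=> v /unit_ball_coord h i; rewrite /= in_itv/=.
Qed.

Lemma kakeya_slice_compact (m : nat) (c : 'rV[R]_m -> 'rV[R]_m) (t : R) :
  {within @unit_ball R m, continuous c} ->
  compact [set c v + t *: v | v in @unit_ball R m].
Proof.
move=> cc; apply: continuous_compact; last exact: compact_unit_ball.
apply/subspace_continuousP => v Bv; apply: cvgD.
  by move/subspace_continuousP: cc; apply.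
by apply: cvg_within_filter; apply: cvgZr; exact: cvg_id.
Qed.

Lemma closed_complement_cube (m : nat) (K : set 'rV[R]_m) (y : 'rV[R]_m) :
  closed K -> ~ K y ->
  exists2 e, 0 < e & forall z, K z -> exists i, e <= `|z 0 i - y 0 i|.
Proof.
move=> cK Ky; have : nbhs y (~` K) by apply: open_nbhs_nbhs; split=> //; exact: closed_openC.
move=> /nbhs_ballP[e /= e0 he]; exists e => // z Kz.
apply: contrapT => h; apply: (he z) => //; split=> // i j; rewrite ord1.
rewrite /ball/= distrC ltNge; apply/negP => hj; apply: h; by exists j.
Qed.

Lemma kakeya_set_compact (m : nat) (c : 'rV[R]_m -> 'rV[R]_m) :
  {within @unit_ball R m, continuous c} -> compact (kakeya_set c).
Proof.
move=> cc; apply: continuous_compact; last first.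
  by apply: compact_setX; [exact: compact_unit_ball | exact: segment_compact].
apply/subspace_continuousP => -[v t] [/= Bv tI].
set G := within _ _.
have FG : Filter G by exact: within_filter.
have h1 : (fun x : 'rV[R]_m * R => x.1) @ G --> v by apply: cvg_within_filter; exact: cvg_fst.
have h2 : (fun x : 'rV[R]_m * R => x.2) @ G --> t by apply: cvg_within_filter; exact: cvg_snd.
have h3 : (fun x : 'rV[R]_m * R => c x.1) @ G --> c v.
  move/subspace_continuousP : cc => /(_ v Bv) hc A /hc cA.
  have cA' : nbhs (v, t) (fun x => unit_ball x.1 -> A (c x.1)).
    exact: (@cvg_fst _ _ (nbhs v) (nbhs t) _ _ cA).
  rewrite /G /within /=; move: cA'; apply: (@filterS _ (nbhs (v, t))) => x hx [Bx _]; exact: hx.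
have h4 : (fun x : 'rV[R]_m * R => c x.1 + x.2 *: x.1) @ G --> c v + t *: v.
  exact: (cvgD h3 (cvgZ h2 h1)).
apply: cvg_rV => i.
rewrite (_ : (fun x : 'rV[R]_m * R => _) = (fun x => if unlift ord_max i is Some j
  then (c x.1 + x.2 *: x.1) 0 j else x.2)); last by apply/funext => x; rewrite mxE.
rewrite [X in _ --> X](_ : _ = if unlift ord_max i is Some j
  then (c v + t *: v) 0 j else t); last by rewrite /from_subspace mxE.
case: unliftP => [j _|_]; last exact: h2.
have h5 : (fun w : 'rV[R]_m => w 0 j) @ (c v + t *: v) --> (c v + t *: v) 0 j.
  exact: coord_continuous.
exact: (cvg_comp _ _ h4 h5).
Qed.

End Topology.

(** * From a cover of small volume to holes in the slices *)

Section Positivity.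
Context (R : realType).

(** One height serves all cubes: once the cross-sections at [t] have total volume below [h ^ m], the
    position [A] is irrelevant. *)
Lemma thin_slice (m : nat) (F : nat -> 'rV[R]_m.+1 * 'rV[R]_m.+1) (a b h : R) :
  a < b -> 0 < h ->
  (\sum_(k <oo) (box_volume (F k).1 (F k).2)%:E < (h ^+ m * (b - a))%:E)%E ->
  exists2 t, a <= t <= b & forall A : 'I_m -> R,
    exists2 y : 'I_m -> R, (forall i, A i <= y i <= A i + h) &
    forall k, ~ box (F k).1 (F k).2
      (\row_i (if unlift ord_max i is Some j then y j else t)).
Proof.
move=> ab h0 hsum.
pose l k := (F k).1 0 ord_max; pose u k := (F k).2 0 ord_max.
pose l' k i := (F k).1 0 (lift ord_max i); pose u' k i := (F k).2 0 (lift ord_max i).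
pose w k : R := \prod_(i < m) Num.max 0 (u' k i - l' k i).
have w0 k : 0 <= w k by rewrite prodr_ge0// => i _; rewrite le_max lexx.
have [|t tab ht] := @exists_slice R l u w a b (h ^+ m) ab (exprn_ge0 _ (ltW h0)) w0.
  move: hsum; congr (_ < _)%E; apply: eq_eseriesr => k _; congr (_%:E).
  rewrite /w /box_volume big_ord_recr/=; congr (_ * _).
  apply: eq_bigr => i _; have -> : widen_ord (leqnSn m) i = lift ord_max i.
    by apply: val_inj; rewrite [RHS]lift_max.
  by [].
exists t => // A.
have [|y yA hy] := @uncovered_point R m h A (fun k => l k <= t <= u k) l' u' h0.
  move: ht; congr (_ < _)%E; apply: eq_eseriesr => k _; congr (_%:E).
  by rewrite indicE mem_setE in_itv/= mulrC.
exists y => // k hk.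
have [|i /negP] := hy k; first by have := hk ord_max; rewrite mxE unlift_none.
by apply; have := hk (lift ord_max i); rewrite mxE liftK.
Qed.

Definition cube_dir {m : nat} (x : 'I_m -> R) : 'rV[R]_m := \row_i (8 * (x i - 1 / 2)).

Lemma kakeya_outer_gt0 (d : nat) (c : 'rV[R]_d.+1 -> 'rV[R]_d.+1)
    (lam : ('I_d.+1 -> R) -> R) (rho : R) : 0 < rho ->
  {within @unit_ball R d.+1, continuous c} ->
  (forall x, unit_cube x -> unit_ball (lam x *: cube_dir x)) ->
  (forall t : 'I_d.+2 -> R,
    (forall i : 'I_d.+2, (2*i)%:R / (2*d.+2)%:R <= t i <= (2*i+1)%:R / (2*d.+2)%:R) ->
    ~ forall i (y0 : 'I_d.+1 -> R), exists y kappa,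
      [/\ 0 < kappa, forall k, y0 k <= y k /\ y k + 2 * kappa <= y0 k + rho &
      forall x, unit_cube x -> exists k,
        ray_map (fun i x => c (lam x *: cube_dir x) 0 i) lam (t i) x k <= y k \/
        y k + 2 * kappa <= ray_map (fun i x => c (lam x *: cube_dir x) 0 i) lam (t i) x k]) ->
  (0 < lebesgue_outer (kakeya_set c))%E.
Proof.
move=> rho0 cc vB core; rewrite lt0e lebesgue_outer_ge0 andbT; apply/negP => /eqP out0.
(* The uncovered point is sought in the middle half of the cube, leaving a margin [rho / 4] on each
   side for the hole around it. *)
pose h := rho / 2; have h0 : 0 < h by rewrite divr_gt0.
have N0 : 0 < (2 * d.+2)%:R :> R by rewrite ltr0n muln_gt0.
pose e : R := h ^+ d.+1 * ((2 * d.+2)%:R)^-1.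
have e0 : 0 < e by rewrite mulr_gt0 ?exprn_gt0 ?invr_gt0.
have [|_ [F AF <-] Fe] := @lb_ereal_inf_adherent R
  [set (\sum_(k <oo) (box_volume (F k).1 (F k).2)%:E)%E | F in box_cover (kakeya_set c)] e e0.
  by rewrite -/(lebesgue_outer _) out0.
rewrite -/(lebesgue_outer _) out0 add0e in Fe.
have slice (i : 'I_d.+2) : exists t : R, (2*i)%:R / (2*d.+2)%:R <= t <= (2*i+1)%:R /
    (2*d.+2)%:R /\
    forall A : 'I_d.+1 -> R, exists2 y : 'I_d.+1 -> R, (forall i, A i <= y i <= A i + h) &
    forall k, ~ box (F k).1 (F k).2
      (\row_i (if unlift ord_max i is Some j then y j else t)).
  have ab : (2*i)%:R / (2*d.+2)%:R < (2*i+1)%:R / (2*d.+2)%:R :> R.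
    by rewrite ltr_pM2r ?invr_gt0// ltr_nat addn1.
  have [|t tab ht] := @thin_slice _ F _ _ h ab h0; last by exists t.
  by rewrite -mulrBl natrD addrAC subrr add0r mul1r.
have [t ht] := choice slice.
apply: (core t) => [i|i y0]; first by have [] := ht i.
have [tI /(_ (fun k => y0 k + rho / 4)) [y yA hy]] := ht i.
have ti : 0 <= t i <= 1.
  case/andP: tI => t1 t2; apply/andP; split.
    by apply: le_trans t1; rewrite divr_ge0 ?ler0n.
  apply: le_trans t2 _; rewrite ler_pdivrMr// mul1r ler_nat.
  by have := ltn_ord i; lia.
(* The cover only yields a missed point; closedness of the slice enlarges it to a missed cube. *)
pose K := [set c v + t i *: v | v in @unit_ball R d.+1].
have Kcl : closed K.
  by apply: compact_closed; [exact: norm_hausdorff | exact: kakeya_slice_compact].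
have Ky : ~ K (\row_k y k).
  move=> [v Bv vy].
  have /AF[k _ hk] : kakeya_set c (kakeya_map c (v, t i)).
    by exists (v, t i) => //; split => //=; rewrite in_itv.
  apply: (hy k); move: hk; congr (box _ _ _); apply/rowP => j; rewrite !mxE/=.
  case: unliftP => // j' _; rewrite vy mxE//.
have [e1 e10 he1] := closed_complement_cube Kcl Ky.
pose kappa := Num.min e1 (rho / 4).
have kappa0 : 0 < kappa by rewrite lt_min e10 divr_gt0.
have ke : kappa <= e1 by rewrite ge_min lexx.
have kr : kappa <= rho / 4 by rewrite ge_min lexx orbT.
exists (fun k => y k - kappa), kappa; split=> //.
  by move=> k; have := yA k; rewrite /h; move: kr kappa0; clear; lra.
move=> x cx; have [|k hk] := he1 (c (lam x *: cube_dir x) + t i *: (lam x *: cube_dir x)).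
  by exists (lam x *: cube_dir x) => //; exact: vB.
exists k; move: hk; rewrite /ray_map !mxE; set z := (_ + _ * _) => hk.
have [zy|zy] := leP z (y k); [left|right]; move: ke hk.
  by rewrite (ler0_norm (_ : z - y k <= 0)) ?subr_le0//; clear; lra.
by rewrite (gtr0_norm (_ : 0 < z - y k)) ?subr_gt0//; clear; lra.
Qed.
End Positivity.

(** * The retraction onto the ball *)

Section EuclideanNorm.
Context (R : realType).

Lemma enorm_ge0 (m : nat) (v : 'rV[R]_m) : 0 <= enorm v.
Proof. exact: sqrtr_ge0. Qed.

Lemma enorm_sqr (m : nat) (v : 'rV[R]_m) : enorm v ^+ 2 = \sum_(i < m) v 0 i ^+ 2.
Proof. by rewrite sqr_sqrtr// sumr_ge0// => i _; exact: sqr_ge0. Qed.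

Lemma enormZ (m : nat) a (v : 'rV[R]_m) : 0 <= a -> enorm (a *: v) = a * enorm v.
Proof.
move=> a0; apply/eqP; rewrite -(@eqrXn2 _ 2) ?mulr_ge0 ?enorm_ge0// exprMn !enorm_sqr.
by rewrite mulr_sumr; apply/eqP; apply: eq_bigr => i _; rewrite mxE exprMn.
Qed.

Lemma coord_le_enorm (m : nat) (v : 'rV[R]_m) i : `|v 0 i| <= enorm v.
Proof.
rewrite -ler_sqr ?nnegrE ?enorm_ge0// enorm_sqr real_normK ?num_real//.
by rewrite (bigD1 i)//= lerDl sumr_ge0// => j _; exact: sqr_ge0.
Qed.

(** A difference of squares, bounded coordinatewise and divided by the sum of the norms, replaces
    the triangle inequality. *)
Lemma enorm_lip (m : nat) (v w : 'rV[R]_m) :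
  `|enorm v - enorm w| <= \sum_i `|v 0 i - w 0 i|.
Proof.
wlog vw : v w / enorm w <= enorm v.
  move=> H; have [/H//|/ltW/H] := leP (enorm w) (enorm v); rewrite distrC.
  by under eq_bigr do rewrite distrC.
rewrite ger0_norm ?subr_ge0//.
have [ew|ew] := leP (enorm v) 0.
  by apply: le_trans (sumr_ge0 _ _) => //; have := enorm_ge0 w; move: ew; clear; lra.
have e0 : 0 < enorm v + enorm w by rewrite ltr_wpDr// enorm_ge0.
rewrite -(ler_pM2r e0) -subr_sqr !enorm_sqr -sumrB mulr_suml; apply: ler_sum => i _.
rewrite subr_sqr; apply: le_trans (ler_norm _) _; rewrite normrM ler_wpM2l//.
by apply: le_trans (ler_normD _ _) _; rewrite lerD// coord_le_enorm.
Qed.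

Lemma enorm_le_sum (m : nat) (v : 'rV[R]_m) : enorm v <= \sum_i `|v 0 i|.
Proof.
have := enorm_lip v 0; have -> : enorm (0 : 'rV[R]_m) = 0.
  by rewrite /enorm big1 ?sqrtr0// => i _; rewrite mxE expr0n.
rewrite subr0 ger0_norm ?enorm_ge0// => h; apply: le_trans h _.
by apply: ler_sum => i _; rewrite mxE subr0.
Qed.

(* Otherwise [y := x `^ a] exceeds both [k^-X] and [k x], whence
   [y ^ X.+1 > x ^ X], although [y <= x `^ (X / X.+1)]. *)
Lemma powR_tradeoff (a x : R) (X k : nat) : X%:R / X.+1%:R < a -> 0 <= x <= 1 ->
  (0 < k)%N -> x `^ a <= (k%:R ^+ X)^-1 + k%:R * x.
Proof.
move=> Xa /andP[x0 x1] k0; set b := X%:R / X.+1%:R in Xa.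
have b0 : 0 <= b by rewrite divr_ge0.
have kX : 0 < (k%:R ^+ X)^-1 :> R by rewrite invr_gt0 exprn_gt0 ?ltr0n.
have kx : 0 <= k%:R * x by rewrite mulr_ge0.
have [xe|xpos] := leP x 0.
  have -> : x = 0 by apply/eqP; rewrite eq_le xe.
  by rewrite powR0 ?mulr0 ?addr0 ?ltW// gt_eqF// (le_lt_trans b0).
apply: (@le_trans _ _ (x `^ b)); first by apply: ger_powR; rewrite ?xpos ?x1 ?ltW.
rewrite leNgt; apply/negP => h; set y := x `^ b in h.
have yX : y ^+ X.+1 = x ^+ X.
  rewrite /y -powR_mulrn ?powR_ge0// -powRrM mulfVK ?pnatr_eq0// powR_mulrn//.
have y1 : (k%:R ^+ X)^-1 < y by move: h kx; clear; lra.
have y2 : k%:R * x < y by move: h kX; clear; lra.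
have : (k%:R * x) ^+ X * (k%:R ^+ X)^-1 < y ^+ X * y.
  apply: (@le_lt_trans _ _ (y ^+ X * (k%:R ^+ X)^-1)).
    by rewrite ler_pM2r// lerXn2r ?nnegrE ?powR_ge0// ltW.
  by rewrite ltr_pM2l// exprn_gt0// powR_gt0.
rewrite -exprSr yX exprMn mulrAC mulfV ?mul1r ?ltxx// expf_neq0// pnatr_eq0.
by rewrite -lt0n.
Qed.

(** Heine-Cantor, with continuity relative to [A]. *)
Lemma unif_continuous_compact (m : nat) (A : set 'rV[R]_m)
    (f : 'rV[R]_m -> 'rV[R]_m) : compact A -> {within A, continuous f} ->
  forall e, 0 < e -> exists2 r, 0 < r & forall u w, A u -> A w -> ball u r w ->
  ball (f u) e (f w).
Proof.
move=> /compact_near_coveringP cov /subspace_continuousP cf e e0.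
have : \forall r \near (0 : R)^'+, A `<=` (fun u => A u -> forall w, A w ->
    ball u r w -> ball (f u) e (f w)).
  apply: cov => x Ax.
  have e20 : 0 < e / 2 by rewrite divr_gt0.
  have /(_ _ e20) : forall e, 0 < e -> \forall w \near within A (nbhs x), ball (f x) e (f w).
    by move=> e' e'0; have /cvg_ballP/(_ e' e'0) := cf x Ax.
  rewrite /within/= => /nbhs_ballP[s /= s0 hs].
  exists (ball x (s / 2), [set r | r < s / 2]).
    split; first by apply: nbhsx_ballx; rewrite divr_gt0.
    by apply: nbhs_right_lt; rewrite divr_gt0.
  move=> [u r] [/= xu rs] Au w Aw uw; apply: (@ball_splitr _ _ (f x)).
    apply: hs => //; apply: le_ball xu; rewrite ler_pdivrMr// ler_peMr// ?ler1n// ltW//.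
  apply: hs => //; rewrite (splitr s); apply: ball_triangle xu _.
  by apply: le_ball uw; exact: ltW.
move=> hr; have [r [r0 hr']] : exists r : R, 0 < r /\ A `<=` (fun u => A u -> forall w,
    A w -> ball u r w -> ball (f u) e (f w)).
  have : \forall r \near (0 : R)^'+, 0 < r /\ A `<=` (fun u => A u -> forall w, A w ->
    ball u r w -> ball (f u) e (f w)) by apply: filterI => //; exact: nbhs_right_gt.
  by move/filter_ex.
by exists r => // u w Au; exact: hr'.
Qed.

End EuclideanNorm.

Section Retraction.
Context (R : realType) (d : nat).
Implicit Types x y : 'I_d.+1 -> R.

(** The factor of the radial retraction onto the unit ball: 1 inside the ball, the inverse norm
    outside. *)
Definition dir_scale x : R := (Num.max 1 (enorm (cube_dir x)))^-1.

Definition retract x : 'rV[R]_d.+1 := dir_scale x *: cube_dir x.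

Let mx x := Num.max 1 (enorm (cube_dir x)).

Lemma max_ge1 x : 1 <= mx x.
Proof. by rewrite le_max lexx. Qed.

Lemma l1dist_ge0 x y : 0 <= l1dist x y.
Proof. by rewrite sumr_ge0. Qed.

Lemma enorm_cube_dir_lip x y : `|enorm (cube_dir y) - enorm (cube_dir x)| <= 8 * l1dist y x.
Proof.
apply: le_trans (enorm_lip _ _) _; rewrite mulr_sumr; apply: ler_sum => i _.
rewrite !mxE -mulrBr normrM ger0_norm//.
by have -> : y i - 1 / 2 - (x i - 1 / 2) = y i - x i by ring.
Qed.

Lemma cube_dir_coord x i : unit_cube x -> `|cube_dir x 0 i| <= 4.
Proof. by move=> /(_ i)/andP[h1 h2]; rewrite mxE ler_norml; apply/andP; split; lra. Qed.

Lemma dir_scale_bounds x : unit_cube x -> (4 * d.+1%:R)^-1 <= dir_scale x <= 1.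
Proof.
move=> cx; have m1 := max_ge1 x; have m0 : 0 < mx x by apply: lt_le_trans m1.
have d1 : 1 <= d.+1%:R :> R by rewrite ler1n.
rewrite /dir_scale invf_le1// m1 andbT lef_pV2 ?posrE ?mulr_gt0//.
rewrite ge_max; apply/andP; split; first by move: d1; clear; lra.
apply: le_trans (enorm_le_sum _) _.
apply: (@le_trans _ _ (\sum_(i < d.+1) 4)); first by apply: ler_sum => i _; exact: cube_dir_coord.
by rewrite sumr_const card_ord mulr_natr.
Qed.

Lemma dir_scale_lip x y : `|dir_scale y - dir_scale x| <= 8 * l1dist y x.
Proof.
have mx1 := max_ge1 x; have my1 := max_ge1 y.
have x0 : 0 < mx x by apply: lt_le_trans mx1.
have y0 : 0 < mx y by apply: lt_le_trans my1.
apply: le_trans (enorm_cube_dir_lip x y).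
have -> : dir_scale y - dir_scale x = (mx x - mx y) * ((mx x)^-1 * (mx y)^-1).
  rewrite /dir_scale -/(mx x) -/(mx y); field.
  by rewrite !gt_eqF.
have i1 : 0 <= (mx x)^-1 * (mx y)^-1 <= 1.
  have [hx hy] : 0 <= (mx x)^-1 /\ 0 <= (mx y)^-1 by rewrite !invr_ge0 !ltW.
  by apply/andP; split; [exact: mulr_ge0 | apply: mulr_ile1; rewrite ?invf_le1].
rewrite normrM (ger0_norm (_ : 0 <= _ * _)); last by case/andP: i1.
apply: (@le_trans _ _ `|mx x - mx y|); first by rewrite ler_piMr//; case/andP: i1.
rewrite distrC /mx; move: (enorm (cube_dir y)) (enorm (cube_dir x)) => a b.
have h1 := ler_norm (a - b); have h2 := ler_norm (b - a); rewrite distrC in h2.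
have h3 := normr_ge0 (a - b).
by rewrite ler_norml; apply/andP; split; have [?|?] := ltP 1 a; have [?|?] := ltP 1 b; lra.
Qed.

Lemma retract_unit_ball x : unit_ball (retract x).
Proof.
have m1 := max_ge1 x; have m0 : 0 < mx x by apply: lt_le_trans m1.
have E : enorm (retract x) = enorm (cube_dir x) / mx x.
  by rewrite mulrC -enormZ// invr_ge0 ltW.
by rewrite /unit_ball/= E ler_pdivrMr// mul1r le_max lexx orbT.
Qed.

Lemma retract_unit_sphere x : 1 <= enorm (cube_dir x) -> unit_sphere (retract x).
Proof.
move=> h; rewrite /unit_sphere/= /retract /dir_scale (max_idPr h) enormZ ?invr_ge0 ?enorm_ge0//.
by rewrite mulVf// gt_eqF// (lt_le_trans _ h).
Qed.

Lemma retract_lip x y i : unit_cube x -> unit_cube y ->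
  `|retract y 0 i - retract x 0 i| <= 40 * l1dist y x.
Proof.
move=> cx cy; have L := dir_scale_lip x y.
rewrite [retract y 0 i]mxE [retract x 0 i]mxE.
have -> : dir_scale y * cube_dir y 0 i - dir_scale x * cube_dir x 0 i =
  dir_scale x * (8 * (y i - x i)) + (dir_scale y - dir_scale x) * cube_dir y 0 i.
  by rewrite !mxE; ring.
apply: le_trans (ler_normD _ _) _; rewrite !normrM.
have [l0 l1] : 0 <= dir_scale x /\ dir_scale x <= 1.
  by have /andP[h ->] := dir_scale_bounds cx; rewrite (le_trans _ h)// invr_ge0 mulr_ge0.
have h1 : `|dir_scale x| * (`|8| * `|y i - x i|) <= 8 * l1dist y x.
  rewrite (ger0_norm l0) (ger0_norm (_ : 0 <= 8 :> R))//.
  apply: (@le_trans _ _ (8 * `|y i - x i|)); first by rewrite ler_piMl// mulr_ge0.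
  by rewrite ler_wpM2l// /l1dist (bigD1 i)//= lerDl sumr_ge0.
have h2 : `|dir_scale y - dir_scale x| * `|cube_dir y 0 i| <= 8 * l1dist y x * 4.
  by apply: ler_pM => //; exact: cube_dir_coord.
by move: h1 h2; clear; lra.
Qed.

Lemma enorm_retract_lip x y : unit_cube x -> unit_cube y ->
  enorm (retract y - retract x) <= 40 * d.+1%:R * l1dist y x.
Proof.
move=> cx cy; apply: le_trans (enorm_le_sum _) _.
apply: (@le_trans _ _ (\sum_(i < d.+1) 40 * l1dist y x)).
  apply: ler_sum => i _; apply: le_trans (retract_lip i cx cy).
  by rewrite [(_ - _ : 'rV_d.+1) 0 i]mxE [(- _ : 'rV_d.+1) 0 i]mxE.
by rewrite sumr_const card_ord -[leLHS]mulr_natr mulrAC.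
Qed.

Lemma boundary_enorm x : on_boundary (1 / 4) (3 / 4) x -> 2 <= enorm (cube_dir x).
Proof.
case=> _ [j hj]; apply: le_trans (coord_le_enorm _ j).
by rewrite mxE; case: hj => ->; [rewrite ler0_norm|rewrite ger0_norm]; lra.
Qed.

Context (c : 'rV[R]_d.+1 -> 'rV[R]_d.+1) (alpha : R).
Context (cc : {within @unit_ball R d.+1, continuous c}).
Context (ac : (hexp d)%:R / (hexp d).+1%:R < alpha).
Context (hc : hoelder_on alpha (@unit_sphere R d.+1) c).

Lemma bounded_on_ball : exists2 M, 0 <= M & forall v i, unit_ball v -> `|c v 0 i| <= M.
Proof.
have [M [_ hM]] := compact_bounded (continuous_compact cc (@compact_unit_ball R d.+1)).
have M0 : 0 <= `|M| + 1 by rewrite addr_ge0.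
have MM : M < `|M| + 1 by have := ler_norm M; lra.
exists (`|M| + 1) => // v i Bv.
apply: le_trans (hM _ MM (c v) _); last by exists v.
rewrite [leRHS]/Num.norm /= mx_normrE; apply/bigmax_geP; right => /=.
by exists (0, i).
Qed.

Lemma unif_cont_scale : unif_cont dir_scale.
Proof.
move=> e e0; exists 8 => // x y cx cy.
by apply: le_trans (dir_scale_lip x y) _; rewrite lerDr ltW.
Qed.

Lemma unif_cont_retract i : unif_cont (fun x => c (retract x) 0 i).
Proof.
move=> e e0; have [M M0 hM] := bounded_on_ball.
have [r r0 hr] := unif_continuous_compact (@compact_unit_ball R d.+1) cc e0.
have K0 : 0 <= 80 * M / r by apply: divr_ge0; [exact: mulr_ge0 | exact: ltW].
exists (80 * M / r) => //.
move=> x y cx cy; have L0 := l1dist_ge0 y x.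
have [lt|ge] := ltP (40 * l1dist y x) r.
  have : ball (c (retract x)) e (c (retract y)).
    apply: hr => //; try exact: retract_unit_ball.
    split=> // a b; rewrite ord1 /ball/= distrC.
    by apply: le_lt_trans lt; exact: retract_lip.
  case=> _ /(_ 0 i); rewrite /ball/= distrC => h; apply: le_trans (ltW h) _.
  by rewrite lerDl mulr_ge0.
apply: (@le_trans _ _ (2 * M)).
  have h1 := hM _ i (retract_unit_ball x); have h2 := hM _ i (retract_unit_ball y).
  by apply: le_trans (ler_normB _ _) _; move: h1 h2; lra.
apply: (@le_trans _ _ (80 * M / r * l1dist y x)); last by rewrite lerDr ltW.
rewrite mulrAC ler_pdivlMr// -[leRHS](_ : 2 * M * (40 * l1dist y x) = _); last by ring.
by rewrite ler_wpM2l// mulr_ge0.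
Qed.

Lemma hoelder_bd_scale C : 8 <= C -> hoelder_bd C dir_scale.
Proof.
move=> C8 k x y k0 bx cy; apply: le_trans (dir_scale_lip x y) _.
have L0 := l1dist_ge0 y x; have k1 : 1 <= k%:R :> R by rewrite ler1n.
apply: ler_pM => //; apply: (@le_trans _ _ (k%:R * l1dist y x)); first by rewrite ler_peMl.
by rewrite lerDr invr_ge0 exprn_ge0.
Qed.

(** Bernstein nodes fill the whole cube, so [y] need not be a boundary point and may retract into
    the open ball, where no Hoelder bound is available. The constant adds up one term for each of
    the three cases. *)
Lemma hoelder_bd_retract : exists2 C, 0 <= C & forall C', C <= C' ->
  forall i, hoelder_bd C' (fun x => c (retract x) 0 i).
Proof.
have [M M0 hM] := bounded_on_ball; have [C hC] := hc.
pose L : R := 40 * d.+1%:R; have L0 : 0 <= L by rewrite mulr_ge0.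
have n0 := normr_ge0 C.
have T1 : 0 <= `|C| * (1 + L) by rewrite mulr_ge0// addr_ge0.
have T2 : 0 <= 2 * M * L by rewrite !mulr_ge0.
have T3 : 0 <= 16 * M by rewrite mulr_ge0.
exists (`|C| * (1 + L) + 2 * M * L + 16 * M); first by rewrite !addr_ge0.
move=> C' CC' i k x y k0 bx cy.
have cx := bd_unit bx.
have l0 := l1dist_ge0 y x; have k1 : 1 <= k%:R :> R by rewrite ler1n.
set X := hexp d; set q := (k%:R ^+ X)^-1; set l := l1dist y x in l0 *.
have q0 : 0 <= q by rewrite invr_ge0 exprn_ge0.
have kl : l <= k%:R * l by rewrite ler_peMl.
have D2 : `|c (retract y) 0 i - c (retract x) 0 i| <= 2 * M.
  have h1 := hM _ i (retract_unit_ball x); have h2 := hM _ i (retract_unit_ball y).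
  by apply: le_trans (ler_normB _ _) _; move: h1 h2; lra.
have fin T : 0 <= T -> T <= C' -> T * (q + k%:R * l) <= C' * (q + k%:R * l).
  by move=> T0 TC; rewrite ler_wpM2r// addr_ge0// (le_trans l0).
(* If [cube_dir y] lies inside the ball, its norm differs by more than 1 from that of [cube_dir x],
   which is at least 2; then [8 * l >= 1] and the trivial bound [2 * M] suffices. *)
have [ny|ny] := leP 1 (enorm (cube_dir y)); last first.
  apply: (@le_trans _ _ (16 * M * (q + k%:R * l))); last first.
    by apply: fin => //; move: CC' T1 T2; lra.
  apply: le_trans D2 _.
  have := boundary_enorm bx; have := enorm_cube_dir_lip x y; rewrite -/l => h1 h2.
  have h3 : 1 <= 8 * l.
    by move: (ler_norm (enorm (cube_dir x) - enorm (cube_dir y))); rewrite distrC => h4;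
      move: ny h1 h2 h4; lra.
  have h4 : 1 <= 8 * (q + k%:R * l) by move: h3 kl q0; lra.
  rewrite (_ : 16 * M * (q + k%:R * l) = 2 * M * (8 * (q + k%:R * l))); last by ring.
  by rewrite ler_peMr// mulr_ge0.
have nx : 1 <= enorm (cube_dir x) by apply: le_trans (boundary_enorm bx); rewrite ler1n.
set e := enorm (retract y - retract x).
have e0 : 0 <= e by exact: enorm_ge0.
have eL : e <= L * l by exact: enorm_retract_lip.
have kLl : k%:R * e <= L * (k%:R * l).
  by rewrite mulrCA ler_wpM2l.
(* [powR_tradeoff] requires [e <= 1]; for larger [e] the points are again far apart. *)
have [e1|e1] := leP e 1; last first.
  apply: (@le_trans _ _ (2 * M * L * (q + k%:R * l))); last first.
    by apply: fin => //; move: CC' T1 T3; lra.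
  apply: le_trans D2 _; rewrite -(mulrA (2 * M)) ler_peMr ?mulr_ge0//.
  have ke : e <= k%:R * e by rewrite ler_peMl.
  have Lq : 0 <= L * q by rewrite mulr_ge0.
  by rewrite mulrDr; move: ke kLl e1 Lq; lra.
apply: (@le_trans _ _ (`|C| * (1 + L) * (q + k%:R * l))); last first.
  by apply: fin => //; move: CC' T2 T3; lra.
have := hC _ _ (retract_unit_sphere ny) (retract_unit_sphere nx); rewrite -/e => h.
have h1 : `|c (retract y) 0 i - c (retract x) 0 i| <= C * e `^ alpha.
  by apply: le_trans h; have := coord_le_enorm (c (retract y) - c (retract x)) i; rewrite !mxE.
apply: le_trans h1 _; rewrite -mulrA.
apply: (@le_trans _ _ (`|C| * e `^ alpha)); first by rewrite ler_wpM2r ?powR_ge0 ?ler_norm.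
rewrite ler_wpM2l//.
have h2 : e `^ alpha <= q + k%:R * e by apply: powR_tradeoff => //; rewrite e0.
apply: le_trans h2 _.
have Lq : 0 <= L * q by rewrite mulr_ge0.
have kl0 : 0 <= k%:R * l by rewrite mulr_ge0.
by rewrite mulrDl mul1r mulrDr; move: kLl Lq kl0; lra.
Qed.

Lemma kakeya_positive : (0 < d)%N -> (0 < lebesgue_outer (kakeya_set c))%E.
Proof.
move=> d0; have [M M0 hM] := bounded_on_ball.
have [C C0 hC] := hoelder_bd_retract.
have [|||||||||rho rho0 core] := @kakeya_core R d (fun i x => c (retract x) 0 i) dir_scale
  (C + 8) M (4 * d.+1%:R)^-1 d0.
- by rewrite addr_ge0.
- exact: M0.
- by rewrite invr_gt0 mulr_gt0// ltr0n.
- by apply: hC; rewrite lerDl.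
- by apply: hoelder_bd_scale; rewrite lerDr.
- exact: unif_cont_retract.
- exact: unif_cont_scale.
- by move=> i x _; apply: hM; exact: retract_unit_ball.
- exact: dir_scale_bounds.
apply: (@kakeya_outer_gt0 R d c dir_scale rho rho0 cc) => // x _.
exact: retract_unit_ball.
Qed.

End Retraction.

(** * Measurability of compact sets *)

Section Measurability.
Context (R : realType) (m : nat).
Local Notation mu := (@lebesgue_outer R m).

Let upd (v : 'rV[R]_m.+1) (i : 'I_m.+1) (r : R) : 'rV[R]_m.+1 :=
  \row_j (if j == i then r else v 0 j).

Lemma box_volume_split (l u : 'rV[R]_m.+1) i a :
  box_volume l (upd u i (Num.min (u 0 i) a)) + box_volume (upd l i (Num.max (l 0 i) a)) u =
  box_volume l u.
Proof.
rewrite /box_volume (bigD1 i)//= [X in _ + X](bigD1 i)//= [RHS](bigD1 i)//=.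
rewrite !mxE eqxx.
rewrite [X in _ * X + _](eq_bigr (fun j => Num.max 0 (u 0 j - l 0 j))); last first.
  by move=> j /negPf ji; rewrite !mxE ji.
rewrite [X in _ + _ * X](eq_bigr (fun j => Num.max 0 (u 0 j - l 0 j))); last first.
  by move=> j /negPf ji; rewrite !mxE ji.
rewrite -mulrDl; congr (_ * _); move: (u 0 i) (l 0 i) => x y.
have [xa|xa] := leP x a; have [ya|ya] := leP y a.
all: repeat match goal with |- context [Num.max 0 ?z] => case: (leP 0 z) => ? end; lra.
Qed.

(** Every box of a cover is cut at the level [a] into two boxes whose volumes add up, which is
    Caratheodory's condition. *)
Lemma measurable_halfspace (i : 'I_m.+1) (a : R) :
  mu.-cara.-measurable [set x : 'rV[R]_m.+1 | x 0 i <= a].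
Proof.
apply: le_caratheodory_measurable => X; apply: le_ereal_inf_tmp => _ [F XF <-].
pose F1 k := ((F k).1, upd (F k).2 i (Num.min ((F k).2 0 i) a)).
pose F2 k := (upd (F k).1 i (Num.max ((F k).1 0 i) a), (F k).2).
have v0 (G : nat -> 'rV[R]_m.+1 * 'rV[R]_m.+1) k : predT k -> (0 <= (box_volume (G k).1 (G
    k).2)%:E)%E.
  by rewrite lee_fin box_volume_ge0.
apply: (@le_trans _ _ (\sum_(k <oo) (box_volume (F1 k).1 (F1 k).2)%:E +
                       \sum_(k <oo) (box_volume (F2 k).1 (F2 k).2)%:E)%E); last first.
  rewrite -nneseriesD => [|k _ _|k _ _]; try exact: v0.
  apply: lee_nneseries => [k _ _|k _]; last by rewrite -EFinD box_volume_split.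
  by apply: adde_ge0; exact: v0.
apply: leeD; apply: ereal_inf_lbound.
  exists F1 => // x [/XF[k _ xk] xa]; exists k => // j; rewrite /F1 mxE.
  by case: eqP => [->|_]; [rewrite le_min andbA (xk i) | exact: xk].
exists F2 => // x [/XF[k _ xk] xa]; exists k => // j; rewrite /F2 mxE.
case: eqP => [->|_]; last exact: xk.
by have /andP[h1 ->] := xk i; rewrite ge_max h1 andbT/= ltW// ltNge; exact/negP.
Qed.

Lemma measurable_closed (A : set 'rV[R]_m.+1) : closed A -> mu.-cara.-measurable A.
Proof.
move=> cA; rewrite -(setCK A); apply: measurableC.
pose ob (pq : {ffun 'I_m.+1 -> rat} * {ffun 'I_m.+1 -> rat}) : set 'rV[R]_m.+1 :=
  [set x | forall i, ratr (pq.1 i) < x 0 i <= ratr (pq.2 i)].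
pose G pq := if pselect (ob pq `<=` ~` A) then ob pq else set0.
have -> : ~` A = \bigcup_pq G pq.
  apply/seteqP; split=> x; last first.
    by move=> [pq _]; rewrite /G; case: pselect => // h /h.
  move=> Ax; have : nbhs x (~` A) by apply: open_nbhs_nbhs; split=> //; exact: closed_openC.
  move=> /nbhs_ballP[e /= e0 he].
  have /choice[p hp] (i : 'I_m.+1) : exists p : rat, x 0 i - e < ratr p < x 0 i.
    have /rat_in_itvoo[p] : x 0 i - e < x 0 i by rewrite ltrBlDr ltrDl.
    by rewrite in_itv/=; exists p.
  have /choice[q hq] (i : 'I_m.+1) : exists q : rat, x 0 i < ratr q < x 0 i + e.
    have /rat_in_itvoo[q] : x 0 i < x 0 i + e by rewrite ltrDl.
    by rewrite in_itv/=; exists q.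
  pose pq := ([ffun i => p i], [ffun i => q i]).
  have xob : ob pq x.
    move=> i; rewrite !ffunE; have /andP[_ ->] := hp i.
    by have /andP[/ltW-> _] := hq i.
  have obA : ob pq `<=` ~` A.
    move=> y hy; apply: he; split=> //; move=> j i; rewrite (ord1 j) /ball/= distrC ltr_distl.
    have := hy i; rewrite !ffunE => /andP[h1 h2].
    have /andP[h3 h4] := hp i; have /andP[h5 h6] := hq i.
    by apply/andP; split; lra.
  exists pq => //; rewrite /G; by case: (pselect (ob pq `<=` ~` A)).
apply: countable_bigcupT_measurable => // pq.
have mob : mu.-cara.-measurable (ob pq).
  have -> : ob pq = \bigcap_(i in setT)
      (~` [set x : 'rV[R]_m.+1 | x 0 i <= ratr (pq.1 i)] `&` [set x | x 0 i <= ratr (pq.2 i)]).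
    apply/seteqP; split=> x hx i; last first.
      by have [//|/= /negP h1 h2] := hx i; rewrite ltNge h1.
    by have /andP[h1 h2] := hx i; split=> //=; apply/negP; rewrite -ltNge.
  apply: fin_bigcap_measurable => // i _; apply: measurableI; last exact: measurable_halfspace.
  by apply: measurableC; exact: measurable_halfspace.
have [h|h] := pselect (ob pq `<=` ~` A).
  have -> : G pq = ob pq by rewrite /G; case: pselect.
  exact: mob.
have -> : G pq = set0 by rewrite /G; case: pselect.
exact: measurable0.
Qed.

End Measurability.

Unset Implicit Arguments.

Theorem theorem1 (R : realType) (n : nat) (alpha : R)
    (c : 'rV[R]_n.-1 -> 'rV[R]_n.-1) :
  (3 <= n)%N ->
  {within @unit_ball R n.-1, continuous c} ->
  (n%:R - 2) * n%:R / (n%:R - 1) ^+ 2 < alpha ->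
  hoelder_on alpha (@unit_sphere R n.-1) c ->
  (@lebesgue_outer R n.-1).-cara.-measurable (kakeya_set c) /\
  (0 < lebesgue_measure_rV R n.-1 (kakeya_set c))%E.
Proof.
case: n c => [|[|d]] c //= n3 cc ac hc; split.
  apply: measurable_closed; apply: compact_closed; first exact: norm_hausdorff.
  exact: kakeya_set_compact.
apply: kakeya_positive cc _ hc _; last by lia.
(* With [n = d + 2] the threshold is [d (d + 2) / (d + 1) ^ 2], that is [hexp d] over its
   successor. *)
move: ac; congr (_ < _); rewrite /hexp !natrM.
have -> : d.+2%:R = d%:R + 2 :> R by rewrite -addn2 natrD.
have -> : (d * d.+2).+1%:R = (d%:R + 1) ^+ 2 :> R.
  by rewrite -natr1 natrM -addn2 natrD; ring.
congr (_ / _); ring.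
Qed.
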